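(* Let $a\in(0,1)$ be irrational and let $\omega_1$ be the lower convex envelope of the sequence $(\sin^2(n\pi a))_{n\in\mathbb N}$. Set $\varphi(t)=\dfrac{\omega_1(t)}{t^4}$ for all $t>0$. Then there exists a constant $C=C(a)>0$ such that for any initial data $(u^0,u^1)\in\mathcal D(\mathcal A_3)$, the solution $u$ of $$u_{tt}+u_{xxxx}+\delta_a u_t(t,a)=0\ \text{ in }(0,\infty)\times(0,1),\quad u(t,0)=u(t,1)=u_{xx}(t,0)=u_{xx}(t,1)=0,\quad u(0,\cdot)=u^0,\ u_t(0,\cdot)=u^1,$$ satisfies $$\forall t\ge0,\quad\|(u(t),u_t(t))\|_{V_3\times L^2(0,1)}\le\frac{C}{\left(\varphi^{-1}\left(\frac1{t+1}\right)\right)^2}\|(u^0,u^1)\|_{\mathcal D(\mathcal A_3)}.$$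
   Context: Conventions: $\mathbb N=\{1,2,3,\dots\}$; ''decreasing'' is strict; $\delta_a$ is the Dirac mass at $a$. Lower convex envelope: for $(u_n)_{n\in\mathbb N}\subset(0,\infty)$ with $\liminf_{n\to\infty}u_n=0$, let $\mathcal C\subset[1,\infty)\times[0,\infty)$ be the closure of the convex hull of $\{(n,u_n):n\in\mathbb N\}$. The lower convex envelope of $(u_n)$ is the function $\omega_1$ on $[0,\infty)$ given by $\omega_1(t)=\min\{s:(t,s)\in\mathcal C\}$ for $t\ge1$, extended to $[0,1]$ (in an arbitrary fixed way) so that $\omega_1$ is decreasing, continuous and convex on $[0,\infty)$. Then $\varphi:(0,\infty)\to(0,\infty)$ is a decreasing bijection and $\varphi^{-1}$ is its inverse. Beam equation setting: $V_3=H^1_0(0,1)\cap H^2(0,1)$ with norm $\|u\|_{V_3}=\|u_{xx}\|_{L^2(0,1)}$, $X_3=V_3\times L^2(0,1)$, $$Y_3=\left\{u\in H^1_0(0,1)\cap H^2(0,1)\cap H^4(0,a)\cap H^4(a,1):\ \tfrac{d^2u}{dx^2}(0)=\tfrac{d^2u}{dx^2}(1)=0\right\}\times V_3,$$ $$\mathcal D(\mathcal A_3)=\left\{(u,v)\in Y_3:\ \tfrac{d^2u}{dx^2}(a_+)=\tfrac{d^2u}{dx^2}(a_-)\ \text{and}\ \tfrac{d^3u}{dx^3}(a_+)-\tfrac{d^3u}{dx^3}(a_-)=-v(a)\right\},$$ $$\|(u,v)\|^2_{\mathcal D(\mathcal A_3)}=\|u\|^2_{H^4(0,a)}+\|u\|^2_{H^4(a,1)}+\|v\|^2_{H^2(0,1)}.$$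 The operator $\mathcal A_3(u,v)=(v,\,-u_{xxxx}-v(a)\delta_a)$ ($u_{xxxx}$ in the distributional sense on $(0,1)$) with domain $\mathcal D(\mathcal A_3)$ generates a semigroup of contractions on $X_3$, and the solution with data $(u^0,u^1)$ is given by $(u(t),u_t(t))$ being the trajectory of this semigroup starting at $(u^0,u^1)$. *)

(* Defs.v *)
From HB Require Import structures.
From mathcomp Require Import all_boot all_order all_algebra.
From mathcomp Require Import all_classical all_reals all_analysis.
Set Implicit Arguments.
Unset Strict Implicit.
Unset Printing Implicit Defensive.
Import Order.TTheory GRing.Theory Num.Theory.
Import numFieldNormedType.Exports.

(* All function spaces are real.  A function on the interval (c, d) is
   represented by a total Borel function R -> R, of which only the restriction to
   (c, d) matters; equality in L^2(c, d) is equality almost everywhere. *)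

Local Open Scope classical_set_scope.
Local Open Scope ring_scope.

Section LowerConvexEnvelope.
Context {R : realType}.
Implicit Types (u : nat -> R) (w : R -> R).

Definition convex_hull (M : lmodType R) (A : set M) : set M :=
  smallest (@convex_set R M) A.

(* The sequence is indexed by the positive integers: u 0 is not used. *)
Definition sequence_points u : set (R^o * R^o) :=
  [set p | exists n : nat, (0 < n)%N /\ p = (n%:R, u n)].

Definition closed_hull u : set (R^o * R^o) :=
  closure (convex_hull (sequence_points u)).

(* The values on [0, 1[ are any extension with the last three properties, hence
   a predicate on w rather than a function of u. *)
Definition lower_convex_envelope u w : Prop :=
  [/\ forall t, 1 <= t ->
        closed_hull u (t, w t) /\ (forall s, closed_hull u (t, s) -> w t <= s),
      {in `[0, +oo[ &, {homo w : s t /~ s < t}},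
      {within `[0, +oo[, continuous w} &
      @convex_function R R^o `[0, +oo[ w].

End LowerConvexEnvelope.

Section SobolevSpaces.
Context {R : realType}.
Implicit Types (c d : R) (u v g w phi : R -> R) (k : nat).

Definition lebesgue_on c d : {measure set (measurableTypeR R) -> \bar R} :=
  mrestr (@lebesgue_measure R) (measurable_itv `]c, d[).

Definition L2 c d : set (R -> R) := [set f | f \in Lfun (lebesgue_on c d) 2%:E].

Definition L2norm c d (f : R -> R) : R :=
  fine ('N[lebesgue_on c d]_2%:E [EFin \o f]).

Definition test_function c d phi : Prop :=
  [/\ forall k x, derivable (derive1n k phi) x 1,
      compact (closure [set x | phi x != 0]) &
      closure [set x | phi x != 0] `<=` `]c, d[].

Definition is_weak_derivative c d k u g : Prop :=
  forall phi, test_function c d phi ->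
    (\int[lebesgue_on c d]_x (u x * derive1n k phi x) =
     (-1) ^+ k * \int[lebesgue_on c d]_x (g x * phi x))%R.

Definition sobolev k c d : set (R -> R) :=
  [set u | L2 c d u /\
     forall j, (j <= k)%N -> exists2 g, L2 c d g & is_weak_derivative c d j u g].

(* The L^2 weak derivative, unique up to equality almost everywhere. *)
Definition weak_derivative c d k u : R -> R :=
  xget (fun=> 0) [set g | L2 c d g /\ is_weak_derivative c d k u g].

Definition sobolev_norm k c d u : R :=
  Num.sqrt (\sum_(j < k.+1) L2norm c d (weak_derivative c d j u) ^+ 2).

(* H^1_0(c, d), as the closure of C_c^oo(c, d) in H^1(c, d). *)
Definition sobolev0 c d : set (R -> R) :=
  [set u | sobolev 1 c d u /\
     forall e, 0 < e -> exists2 phi, test_function c d phi &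
       sobolev_norm 1 c d (u \- phi) < e].

(* u^(k)(x) for x in [c, d], where u^(k) is taken on (c, d), through the
   representative of u^(k) that is continuous on [c, d]; it exists for u in
   H^(k+1)(c, d).  At an endpoint this is the one-sided value. *)
Definition value_at c d k u (x : R) : R :=
  xget (fun=> 0) [set w | {within `[c, d], continuous w} /\
    {ae lebesgue_on c d, forall y, weak_derivative c d k u y = w y}] x.

End SobolevSpaces.

(* The semigroups below act on the space X of representatives with seminorm N,
   two representatives being identified when N (x - y) = 0; all the laws are
   stated up to this identification. *)
Section Semigroups.
Context {R : realType} {E : lmodType R}.
Implicit Types (X D : set E) (N : E -> R) (S : R -> E -> E) (A : E -> E).

Definition contraction_semigroup X N S : Prop :=
  (forall t x, 0 <= t -> X x -> X (S t x)) /\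
  [/\ forall t k x y, 0 <= t -> X x -> X y ->
        N (S t (k *: x + y) - (k *: S t x + S t y)) = 0,
      forall x, X x -> N (S 0 x - x) = 0,
      forall s t x, 0 <= s -> 0 <= t -> X x -> N (S (s + t) x - S s (S t x)) = 0,
      forall t x, 0 <= t -> X x -> N (S t x) <= N x &
      forall x, X x -> N (S t x - x) @[t --> 0^'+] --> 0].

Definition right_derivative_at0 N S (x y : E) : Prop :=
  N (h^-1 *: (S h x - x) - y) @[h --> 0^'+] --> 0.

Definition infinitesimal_generator X N S D A : Prop :=
  (forall x, D x <-> X x /\ exists2 y, X y & right_derivative_at0 N S x y) /\
  (forall x, D x -> X (A x) /\ right_derivative_at0 N S x (A x)).

End Semigroups.

(* The pairs (u, v); X3 below selects the admissible ones. *)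
Notation beam_state R := ((R -> R^o) * (R -> R^o))%type.

Section Beam.
Context {R : realType}.
Implicit Types (a : R) (z : beam_state R).

Definition V3 : set (R -> R) := sobolev0 0 1 `&` sobolev 2 0 1.

Definition V3_norm (u : R -> R) : R := L2norm 0 1 (weak_derivative 0 1 2 u).

Definition X3 : set (beam_state R) := V3 `*` L2 0 1.

Definition X3_norm z : R := Num.sqrt (V3_norm z.1 ^+ 2 + L2norm 0 1 z.2 ^+ 2).

Definition Y3 a : set (beam_state R) :=
  [set u | [/\ V3 u, sobolev 4 0 a u, sobolev 4 a 1 u,
               value_at 0 a 2 u 0 = 0 & value_at a 1 2 u 1 = 0]] `*` V3.

Definition A3_domain a : set (beam_state R) :=
  [set z | [/\ Y3 a z,
      value_at a 1 2 z.1 a = value_at 0 a 2 z.1 a &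
      value_at a 1 3 z.1 a - value_at 0 a 3 z.1 a = - value_at 0 1 0 z.2 a]].

Definition A3_domain_norm a z : R :=
  Num.sqrt (sobolev_norm 4 0 a z.1 ^+ 2 + sobolev_norm 4 a 1 z.1 ^+ 2 +
            sobolev_norm 2 0 1 z.2 ^+ 2).

(* - u_xxxx - v(a) delta_a, as a distribution on (0, 1), tested against phi. *)
Definition A3_distribution a z (phi : R -> R) : R :=
  - (\int[lebesgue_on 0 1]_x (z.1 x * derive1n 4 phi x))%R -
  value_at 0 1 0 z.2 a * phi a.

(* For z in A3_domain a, the distribution is represented by a function in
   L^2(0, 1), unique up to equality almost everywhere. *)
Definition A3 a z : beam_state R :=
  (z.2, xget (fun=> 0) [set f | L2 0 1 f /\
     forall phi, test_function 0 1 phi ->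
       (\int[lebesgue_on 0 1]_x (f x * phi x))%R = A3_distribution a z phi]).

(* t |-> S t (u0, u1) is then the solution (u(t), u_t(t)) with data (u0, u1). *)
Definition beam_semigroup a (S : R -> beam_state R -> beam_state R) : Prop :=
  contraction_semigroup X3 X3_norm S /\
  infinitesimal_generator X3 X3_norm S (A3_domain a) (A3 a).

End Beam.

(* Main.v *)
Require Import Defs.
From mathcomp Require Import all_boot all_order all_algebra.
From mathcomp Require Import all_classical all_reals all_analysis.
From mathcomp Require Import measurable_realfun.
From mathcomp Require Import ring lra.
Set Implicit Arguments.
Unset Strict Implicit.
Unset Printing Implicit Defensive.
Import Order.TTheory GRing.Theory Num.Theory.
Import numFieldNormedType.Exports.
Local Open Scope classical_set_scope.
Local Open Scope ring_scope.

(** Why the decay holds.  Let z = (u, v) be in the domain, e_n = sqrt 2 sin (n pi x)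
    and s_n = e_n(a).  In the coordinates p_n = <v, e_n> and q_n = - <u'', e_n> the
    operator A becomes

      p_n(A z) = - l_n q_n - s_n g,   q_n(A z) = l_n p_n,   l_n = (n pi)^2,

    with g = v(a) = sum_n s_n p_n, and the energy N(z)^2 = |u''|^2 + |v|^2 is
    sum_n (p_n^2 + q_n^2).  Hence the energy decreases at the rate 2 g^2, and
    one has to show that g observes the modes: the n-th one is seen with strength
    s_n^2 = 2 sin^2 (n pi a), which is at least 2 w, w = omega1(tau), for n <= tau,
    because the envelope decreases and lies below the sequence.

    The observation inequality comes from a Lyapunov function K N^2 + W instead of
    resolvent estimates.  The bilinear form W = sum_(m, n) k_mn p_m q_n (lemma
    form_derivative) is chosen so that along z' = A z its derivative is exactly
    2 (sum_n s_n p_n)^2 - sum_n s_n^2 (p_n^2 + q_n^2), apart from a bilinear term in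
    g and q.  Half of the second sum and the dissipation 2 K g^2 absorb this term
    and the first one.  The boundedness of W and of that bilinear term is a
    matter of sums of 1 / |m^2 - n^2| (lemma sum_gap): the quadratic growth of
    the frequencies is used here.  Modes with n > tau cost at most tau^-4 N(A z)^2
    and a multiple of g^2, since l_n >= n^2 (lemma high_modes).  So

      (K N^2 + W)' <= - w N(z)^2 + 2 w tau^-4 N(A z)^2,

    where N(A z) decreases along trajectories.  Integrating, w (t + 1) N(z(t))^2 is
    bounded by C N(z(0))^2 + 2 w t tau^-4 N(A z(0))^2 (lemma modal_decay).  The
    choice tau = phi^-1 (1 / (t + 1)) means w (t + 1) = tau^4, and then
    N(z(t))^2 <= (C + 2) tau^-4 |z(0)|^2 in the norm of the domain.

    Two points need care.  Trajectories are known only through a semigroup of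
    contractions with generator A, so the Lyapunov inequality is integrated with
    Euler steps whose error is uniform in time (lemmas trajectory_increment and
    lyap_step), on finite truncations of W.  And the modal description of the
    operator has to be derived from distributional derivatives: functions in H^1
    have an absolutely continuous representative (weak_derivative_prim), the
    conditions defining the domain leave v(a) phi(a) as the only boundary term of the
    integrations by parts against phi (beam_green), and sine series of Lipschitz
    functions converge pointwise (sine_sum_cvg), which gives both Parseval's
    identity and the series of v(a). *)

(** * Square-integrable functions on an interval *)

Section SquareIntegrable.
Context {R : realType}.
Implicit Types (c d k : R) (f g h : R -> R).

Local Notation mu := (@lebesgue_measure R).

Lemma integral_lebesgue_on c d (f : R -> \bar R) : measurable_fun setT f ->
  (\int[lebesgue_on c d]_x f x = \int[mu]_(x in `]c, d[) f x)%E.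
Proof.
move=> mf.
have mI : measurable (`]c, d[ : set R) by exact: measurable_itv.
have E D (g : R -> \bar R) : D `<=` `]c, d[ ->
    (\int[lebesgue_on c d]_(x in D) g x = \int[mu]_(x in D) g x)%E.
  move=> sD; apply: eq_measure_integral => A mA AD.
  by rewrite /lebesgue_on/= /mrestr setIidl//; exact: subset_trans AD sD.
rewrite -E// [RHS]integral_mkcond.
apply: ae_eq_integral => //.
  by apply/(measurable_restrictT _ _).1 => //; exact: measurable_funTS.
exists (~` `]c, d[); split.
- exact: measurableC.
- by rewrite /lebesgue_on/= /mrestr setICl measure0.
- move=> x/= nx xI; apply: nx => _; rewrite patchE mem_set//.
Qed.

Lemma ae_lebesgue_on c d (P : R -> Prop) :
  {ae lebesgue_on c d, forall x, P x} <->
  {ae mu, forall x, x \in `]c, d[ -> P x}.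
Proof.
have mI : measurable (`]c, d[ : set R) by exact: measurable_itv.
split=> -[A [mA A0 PA]].
- exists (A `&` `]c, d[); split => //; first exact: measurableI.
  move=> x /= /not_implyP[xI nP]; split => //.
  exact: PA.
- exists (A `|` ~` `]c, d[); split => //.
  + by apply: measurableU => //; exact: measurableC.
  + rewrite /lebesgue_on/= /mrestr setIUl setICl setU0.
    apply: (@subset_measure0 _ _ _ mu _ A) => //.
    by apply: measurableI => //; exact: measurable_itv.
  + move=> x nP; have [xI|xI] := boolP (x \in `]c, d[); last by right; apply/negP.
    by left; apply: PA => h; apply: nP; exact: h.
Qed.

(** Makes statements true almost everywhere on (c, d) combine by [filterS] and
    [near]. *)
#[global] Instance lebesgue_on_ae_filter c d :
  Filter (nbhs (almost_everywhere (lebesgue_on c d))).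
Proof. exact: ae_filter_ringOfSetsType. Qed.

Lemma lebesgue_on_setT c d : c <= d -> lebesgue_on c d setT = (d - c)%:E.
Proof.
move=> cd; rewrite /lebesgue_on/= /mrestr setTI lebesgue_measure_itv/= lte_fin.
have [_|dc] := ltP c d; first by rewrite EFinB.
by have -> : c = d; [apply/eqP; rewrite eq_le cd dc|rewrite subrr].
Qed.

Lemma lebesgue_on_fin c d : lebesgue_on c d setT \is a fin_num.
Proof.
rewrite /lebesgue_on/= /mrestr setTI lebesgue_measure_itv/= lte_fin.
by case: ifP.
Qed.

Lemma L2_measurable c d f : L2 c d f -> measurable_fun setT f.
Proof. by rewrite /L2/= inE => /andP[]; rewrite inE. Qed.

Lemma L2_lin c d k f g : L2 c d f -> L2 c d g -> L2 c d (fun x => k * f x + g x).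
Proof.
move=> Lf Lg.
have p1 : (1 <= 2%:E :> \bar R)%E by rewrite lee_fin ler1n.
by have [_ /(_ k f g Lf Lg)] := Lfun_submod_closed (lebesgue_on c d) p1.
Qed.

Lemma L20 c d : L2 c d (cst 0).
Proof.
have p1 : (1 <= 2%:E :> \bar R)%E by rewrite lee_fin ler1n.
by have [] := Lfun_submod_closed (lebesgue_on c d) p1.
Qed.

Lemma L2D c d f g : L2 c d f -> L2 c d g -> L2 c d (f \+ g).
Proof.
move=> Lf Lg; have := @L2_lin c d 1 f g Lf Lg.
by under eq_fun do rewrite mul1r.
Qed.

Lemma L2Z c d k f : L2 c d f -> L2 c d (fun x => k * f x).
Proof.
move=> Lf; have := @L2_lin c d k f _ Lf (L20 c d).
by under eq_fun do rewrite addr0.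
Qed.

Lemma L2B c d f g : L2 c d f -> L2 c d g -> L2 c d (f \- g).
Proof.
move=> Lf Lg; have := L2D Lf (L2Z (-1) Lg).
by under eq_fun do rewrite mulN1r.
Qed.

Lemma integrable_L2_mul c d f g : L2 c d f -> L2 c d g ->
  (lebesgue_on c d).-integrable setT (EFin \o (fun x => f x * g x)).
Proof. by move=> Lf Lg; apply/Lfun1_integrable; exact: Lfun2_mul_Lfun1. Qed.

Lemma L2_integrable c d f : L2 c d f ->
  (lebesgue_on c d).-integrable setT (EFin \o f).
Proof.
move=> Lf; apply/Lfun1_integrable.
exact: (Lfun_subset12 (lebesgue_on_fin c d)).
Qed.

(** Trades the L^2 norm of the definition for the integral of the square, on which
    comparison and restriction lemmas act. *)
Lemma L2P c d f : L2 c d f <-> measurable_fun setT f /\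
  (lebesgue_on c d).-integrable setT (EFin \o (fun x => f x * f x)).
Proof.
split=> [Lf|[mf fi]]; first by split; [exact: L2_measurable Lf|exact: integrable_L2_mul].
rewrite /L2/= inE; apply/andP; split; rewrite inE//=.
rewrite /finite_norm unlock; apply: poweR_lty.
under eq_integral => x _.
  rewrite /= (_ : (`|f x| `^ 2)%:E = (f x * f x)%:E); last first.
    by rewrite powR_mulrn// -normrX ger0_norm ?sqr_ge0// expr2.
  over.
have /integrableP[_] := fi; apply: le_lt_trans.
apply: ge0_le_integral => //=.
- by move=> x _; rewrite lee_fin -expr2 sqr_ge0.
- by apply/measurable_EFinP; exact: measurable_funM.
- by apply/measurable_EFinP; apply: measurableT_comp => //; exact: measurable_funM.
- by move=> x _; rewrite lee_fin ler_norm.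
Qed.

Lemma L2norm_ge0 c d f : 0 <= L2norm c d f.
Proof. by rewrite fine_ge0// Lnorm_ge0. Qed.

Definition ip c d f g : R := (\int[lebesgue_on c d]_x (f x * g x))%R.

Lemma L2norm_sqr c d f : L2norm c d f ^+ 2 = ip c d f f.
Proof.
rewrite /L2norm unlock /ip /Rintegral.
set I := (\int[_]_x _)%E; set J := (\int[_]_x _)%E.
have <- : I = J.
  apply: eq_integral => x _ /=.
  by rewrite powR_mulrn// -normrX ger0_norm ?sqr_ge0// expr2.
have : (0 <= I)%E by apply: integral_ge0 => x _; exact: poweR_ge0.
case: I => [r||]//= r0.
  by rewrite -powR_mulrn ?powR_ge0// -powRrM mulVf// powRr1.
by rewrite invr_eq0 pnatr_eq0 /= expr0n.
Qed.

Lemma ipC c d f g : ip c d f g = ip c d g f.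
Proof. by apply: eq_Rintegral => x _; rewrite mulrC. Qed.

Lemma ipDl c d f g h : L2 c d f -> L2 c d g -> L2 c d h ->
  ip c d (fun x => f x + g x) h = ip c d f h + ip c d g h.
Proof.
move=> Lf Lg Lh; rewrite /ip -RintegralD//; [|exact: integrable_L2_mul..].
by apply: eq_Rintegral => x _; rewrite mulrDl.
Qed.

Lemma ipZl c d k f h : L2 c d f -> L2 c d h ->
  ip c d (fun x => k * f x) h = k * ip c d f h.
Proof.
move=> Lf Lh; rewrite /ip -RintegralZl//; [|exact: integrable_L2_mul].
by apply: eq_Rintegral => x _; rewrite mulrA.
Qed.

Lemma ip_ge0 c d f : 0 <= ip c d f f.
Proof. by apply: Rintegral_ge0 => x _; rewrite -expr2 sqr_ge0. Qed.

Lemma ae_eq_Rintegral c d f g : measurable_fun setT f -> measurable_fun setT g ->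
  {ae lebesgue_on c d, forall x, f x = g x} ->
  (\int[lebesgue_on c d]_x f x = \int[lebesgue_on c d]_x g x)%R.
Proof.
move=> mf mg fg; rewrite /Rintegral; congr fine.
apply: ae_eq_integral => //; [exact/measurable_EFinP..|].
by apply: filterS fg => x -> _.
Qed.

Lemma ip_ae c d f f' g g' :
  L2 c d f -> L2 c d f' -> L2 c d g -> L2 c d g' ->
  {ae lebesgue_on c d, forall x, f x = f' x} ->
  {ae lebesgue_on c d, forall x, g x = g' x} -> ip c d f g = ip c d f' g'.
Proof.
move=> Lf Lf' Lg Lg' ff gg; apply: ae_eq_Rintegral.
- by apply: measurable_funM; [exact: L2_measurable Lf|exact: L2_measurable Lg].
- by apply: measurable_funM; [exact: L2_measurable Lf'|exact: L2_measurable Lg'].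
by apply: filterS2 ff gg => x -> ->.
Qed.

(** Discriminant of the nonnegative form (k, l) |-> <k f + l g, k f + l g>. *)
Lemma ip_CS c d f g : L2 c d f -> L2 c d g ->
  ip c d f g ^+ 2 <= ip c d f f * ip c d g g.
Proof.
move=> Lf Lg.
have P (k l : R) : 0 <= k ^+ 2 * ip c d f f + 2 * k * l * ip c d f g + l ^+ 2 * ip c d g g.
  have Lk := L2Z k Lf; have Ll := L2Z l Lg; have Lkl := L2D Lk Ll.
  have := ip_ge0 c d (fun x => k * f x + l * g x).
  rewrite ipDl// !ipZl// ![ip _ _ _ (fun x => _ + _)]ipC !ipDl// !ipZl//.
  rewrite (ipC c d g f); congr (_ <= _); ring.
have [g0|g0] := eqVneq (ip c d g g) 0.
  rewrite g0 mulr0; have [->|fg0] := eqVneq (ip c d f g) 0; first by rewrite expr0n.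
  have := P (- ip c d f g) ((ip c d f f + 1) / 2); rewrite g0 mulr0 addr0.
  rewrite [X in 0 <= X](_ : _ = - ip c d f g ^+ 2); first by rewrite oppr_ge0.
  by field.
have g1 : 0 < ip c d g g by rewrite lt_def g0 ip_ge0.
have := P (ip c d g g) (- ip c d f g).
rewrite [X in 0 <= X](_ : _ = ip c d g g * (ip c d f f * ip c d g g - ip c d f g ^+ 2)); last by ring.
by rewrite pmulr_rge0// subr_ge0.
Qed.

Lemma ip_le c d f g : L2 c d f -> L2 c d g ->
  `|ip c d f g| <= L2norm c d f * L2norm c d g.
Proof.
move=> Lf Lg; rewrite -ler_sqr ?nnegrE ?mulr_ge0 ?L2norm_ge0//.
by rewrite real_normK ?num_real// exprMn !L2norm_sqr ip_CS.
Qed.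

End SquareIntegrable.

(** * Smooth functions built from exp (- 1 / x) *)

Section SmoothFunctions.
Context {R : realType}.
Implicit Types (f g h : R -> R).

Definition smooth f := forall k x, derivable (derive1n k f) x 1.

(** Smoothness of a whole class at once, without a formula for the higher
    derivatives. *)
Lemma smooth_coind (P : (R -> R) -> Prop) :
  (forall f, P f -> (forall x, derivable f x 1) /\ P (derive1 f)) ->
  forall f, P f -> smooth f.
Proof.
move=> stepP f Pf k x; apply: (stepP _ _).1.
by elim: k => // k Pk; rewrite derive1nS; exact: (stepP _ Pk).2.
Qed.

Lemma derive1SnE f k : derive1n k.+1 f = derive1n k (derive1 f).
Proof. by rewrite /derive1n iterSr. Qed.

Lemma smooth_derive1 f : smooth f -> smooth (derive1 f).
Proof. by move=> sf k x; rewrite -derive1SnE; exact: sf. Qed.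

Lemma smooth_derivable f x : smooth f -> derivable f x 1.
Proof. by move=> /(_ 0%N x). Qed.

Lemma derivable_continuous f : (forall x, derivable f x 1) -> continuous f.
Proof. by move=> df x; apply/differentiable_continuous/derivable1_diffP; exact: df. Qed.

Lemma smooth_continuous f : smooth f -> continuous f.
Proof. by move=> sf; apply: derivable_continuous => x; exact: smooth_derivable. Qed.

Lemma is_derive1_derive1 f f' : (forall x : R, is_derive x 1 f (f' x)) -> derive1 f = f'.
Proof. by move=> ff; apply/funext => x; rewrite derive1E; case: (ff x). Qed.

(** The functions x |-> x^-j exp(-1/x) extended by 0 to x <= 0: the family is
    stable under differentiation up to linear combinations, which makes every
    member smooth. *)
Definition flat (j : nat) (x : R) : R :=
  if 0 < x then x^-1 ^+ j * expR (- x^-1) else 0.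

Lemma flat_ge0 j x : 0 <= flat j x.
Proof.
rewrite /flat; case: ifP => // x0.
by rewrite mulr_ge0 ?expR_ge0// exprn_ge0// invr_ge0 ltW.
Qed.

(** The quadratic bound is what gives the derivative 0 at the origin; it comes
    from one term of the exponential series at 1 / x. *)
Lemma flat_small j x : flat j x <= (j.+2`!)%:R * x ^+ 2.
Proof.
rewrite /flat; case: ifP => x0; last by rewrite mulr_ge0// sqr_ge0.
have y0 : 0 <= x^-1 by rewrite invr_ge0 ltW.
have y1 : 0 < x^-1 by rewrite invr_gt0.
have H := expR_ge1Dxn j.+1 y0.
have {}H : x^-1 ^+ j.+2 / (j.+2`!)%:R <= expR x^-1.
  by apply: le_trans H; rewrite lerDr.
rewrite expRN ler_pdivrMr ?expR_gt0//.
move: H; rewrite ler_pdivrMr ?ltr0n ?fact_gt0// => H.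
have -> : x^-1 ^+ j = x ^+ 2 * x^-1 ^+ j.+2.
  by rewrite (exprSr _ j.+1) (exprSr _ j); set y := x^-1 ^+ j; field; rewrite gt_eqF.
rewrite -[leRHS]mulrA [leRHS]mulrCA ler_pM2l ?exprn_gt0//; apply: le_trans H _.
by rewrite mulrC.
Qed.

Lemma is_derive_flat j (x : R) :
  is_derive x 1 (flat j) (flat j.+2 x - j%:R * flat j.+1 x).
Proof.
have [x0|x0|->] := ltgtP x 0.
- have nx : \forall y \near x, cst 0 y = flat j y.
    near=> y; rewrite /flat ifF//; apply/negbTE; rewrite -leNgt ltW//.
    by near: y; exact: lt_nbhsl.
  apply: (near_eq_is_derive nx).
  by rewrite /flat (lt_gtF x0) mulr0 subr0; exact: is_derive_cst.
- have nx : \forall y \near x, y^-1 ^+ j * expR (- y^-1) = flat j y.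
    near=> y; rewrite /flat ifT//.
    by near: y; exact: lt_nbhsr.
  apply: (near_eq_is_derive nx).
  have xn0 : x != 0 by rewrite gt_eqF.
  have dV : is_derive x 1 (fun y => y^-1) (- x ^- 2).
    by have := @is_deriveV R id x 1 1 xn0 (is_derive_id _ _); rewrite scaler1.
  have dE : is_derive x 1 (fun y => expR (- y^-1)) (expR (- x^-1) * x ^- 2).
    have := @is_derive1_comp R expR (fun y => - y^-1) x _ _ (is_derive_expR _) (is_deriveN dV).
    by rewrite opprK.
  rewrite (_ : (fun y => _) =
    ((fun y : R => y^-1) ^+ j * (fun y => expR (- y^-1)))); last first.
    by rewrite exprfctE.
  apply: (is_derive_eq (is_deriveM (is_deriveX j dV) dE)).
  rewrite /flat x0 /= /GRing.scale/=.
  rewrite exprfctE; set e := expR _.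
  case: j {nx} => [|j]; first by rewrite expr0; field.
  rewrite (exprS _ j.+2) (exprS _ j.+1) (exprS _ j) /=; set y := x^-1 ^+ j.
  by field.
- rewrite /flat ltxx mulr0 subrr.
  have lim0 : h^-1 *: (flat j (h *: 1 + 0) - flat j 0) @[h --> 0^'] --> (0:R).
    apply/cvgr0Pnorm_le => e e0.
    near=> h.
    have h0 : h != 0 by near: h; exact: nbhs_dnbhs_neq.
    rewrite [X in flat _ X](_ : _ = h); last by rewrite addr0 /GRing.scale/= mulr1.
    rewrite {2}/flat ltxx subr0 /GRing.scale/= normrM normfV (ger0_norm (flat_ge0 _ _)).
    rewrite ler_pdivrMl ?normr_gt0//.
    apply: le_trans (flat_small _ _) _.
    rewrite -(real_normK (num_real h)) expr2 mulrA mulrC ler_wpM2l//.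
    rewrite -ler_pdivlMl ?ltr0n ?fact_gt0//.
    near: h; apply: (@dnbhs0_le R R); rewrite mulr_gt0// invr_gt0 ltr0n fact_gt0//.
  by apply: DeriveDef; [apply/cvg_ex; exists 0|apply/cvg_lim].
Unshelve. all: by end_near. Qed.

(** Closed under differentiation, and large enough to contain the bumps and their
    linear combinations. *)
Inductive flat_alg : (R -> R) -> Prop :=
| flat_alg_cst c : flat_alg (cst c)
| flat_alg_flat j k b : flat_alg (fun x => flat j (k * x + b))
| flat_alg_add f g : flat_alg f -> flat_alg g -> flat_alg (fun x => f x + g x)
| flat_alg_mul f g : flat_alg f -> flat_alg g -> flat_alg (fun x => f x * g x).

Lemma flat_alg_derive f : flat_alg f ->
  exists2 f', flat_alg f' & forall x : R, is_derive x 1 f (f' x).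
Proof.
elim=> [c|j k b|{}f g _ [f' af' df] _ [g' ag' dg]|{}f g af [f' af' df] ag [g' ag' dg]].
- by exists (cst 0); [exact: flat_alg_cst|move=> x; exact: is_derive_cst].
- exists (fun x => (flat j.+2 (k * x + b) + - j%:R * flat j.+1 (k * x + b)) * k).
    apply: flat_alg_mul; last exact: flat_alg_cst.
    apply: flat_alg_add; first exact: flat_alg_flat.
    by apply: flat_alg_mul; [exact: flat_alg_cst|exact: flat_alg_flat].
  move=> x; apply: is_derive1_comp.
    by apply: is_derive_eq (is_derive_flat _ _) _; rewrite mulNr.
  have H := is_deriveD (is_deriveM (is_derive_cst k x (1 : R)) (is_derive_id x 1))
    (is_derive_cst b x 1).
  by apply: (is_derive_eq H); rewrite /= scaler0 !addr0 /GRing.scale/= mulr1.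
- exists (fun x => f' x + g' x); first exact: flat_alg_add.
  by move=> x; exact: is_deriveD.
- exists (fun x => f x * g' x + g x * f' x).
    by apply: flat_alg_add; exact: flat_alg_mul.
  by move=> x; exact: is_deriveM.
Qed.

Lemma flat_alg_smooth f : flat_alg f -> smooth f.
Proof.
apply: smooth_coind => {}f /flat_alg_derive[f' af' df]; split=> [x|].
  by case: (df x).
by rewrite (is_derive1_derive1 df).
Qed.

End SmoothFunctions.

(** * Integrals of bounded and of continuous functions *)

Section BoundedFunctions.
Context {R : realType}.
Implicit Types (c d k : R) (f g h : R -> R).

Local Notation mu := (@lebesgue_measure R).

Lemma L2_bounded c d K f : measurable_fun setT f ->
  (forall x, x \in `]c, d[ -> `|f x| <= K) -> L2 c d f.
Proof.
move=> mf fK; apply/L2P; split => //.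
have mff : measurable_fun setT (fun x => f x * f x) by exact: measurable_funM.
apply/integrableP; split; first exact/measurable_EFinP.
rewrite integral_lebesgue_on; last first.
  by apply: measurableT_comp => //; exact/measurable_EFinP.
apply: (@le_lt_trans _ _ (\int[mu]_(x in `]c, d[) (K ^+ 2)%:E)%E).
  apply: ge0_le_integral => //=.
  - apply: measurable_funTS; apply/measurable_EFinP.
    by apply: measurableT_comp => //; exact: mff.
  - move=> x xI; rewrite lee_fin -expr2 normrX.
    by rewrite lerXn2r ?nnegrE//; [exact: le_trans (fK _ xI)|exact: fK].
rewrite integral_cst//= lebesgue_measure_itv/= lte_fin.
by case: ifP; rewrite ?mule0 -?EFinB -?EFinM ltry.
Qed.

Lemma continuous_bounded c d f : {within `[c, d], continuous f} ->
  exists K, forall x, x \in `[c, d] -> `|f x| <= K.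
Proof.
move=> cf; have [cd|dc] := leP c d; last first.
  by exists 0 => x; rewrite in_itv/= => /andP[cx xd]; have := le_lt_trans (le_trans cx xd) dc; rewrite ltxx.
have cnf : {within `[c, d], continuous (fun x => `|f x|)}.
  by move=> x; apply: (continuous_comp (cf x)); exact: norm_continuous.
have [M _ fM] := EVT_max cd cnf.
by exists `|f M|.
Qed.

Lemma continuous_measurable f : continuous f -> measurable_fun setT f.
Proof. exact: continuous_measurable_fun. Qed.

Lemma continuous_L2 c d f : continuous f -> L2 c d f.
Proof.
move=> cf; have [K fK] := @continuous_bounded c d f (continuous_subspaceT cf).
apply: (@L2_bounded c d K); first exact: continuous_measurable.
by move=> x xI; apply: fK; exact: subset_itv_oo_cc.
Qed.

Lemma Rintegral_lebesgue_on c d f : measurable_fun setT f ->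
  (\int[lebesgue_on c d]_x f x = \int[mu]_(x in `]c, d[) f x)%R.
Proof.
by move=> mf; rewrite /Rintegral integral_lebesgue_on//; exact/measurable_EFinP.
Qed.

Lemma FTC_lebesgue_on c d (F : R -> R) f : c <= d ->
  (forall x : R, is_derive x 1 F (f x)) -> continuous f ->
  (\int[lebesgue_on c d]_x f x)%R = F d - F c.
Proof.
move=> cd dF cf; rewrite Rintegral_lebesgue_on; last exact: continuous_measurable.
move: cd; rewrite le_eqVlt => /predU1P[->|cd].
  by rewrite subrr set_itv_ge ?Rintegral_set0// bnd_simp ltxx.
have cF : continuous F by apply: derivable_continuous => x; case: (dF x).
have mf : measurable_fun `]c, d[ (EFin \o f).
  by apply/measurable_EFinP; apply: measurable_funTS; exact: continuous_measurable.
rewrite /Rintegral -(@integral_itv_bndoo _ _ _ _ true false)//.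
rewrite (@continuous_FTC2 _ f F)//.
- exact: continuous_subspaceT.
- split; [|exact: cvg_at_right_filter (cF c)|exact: cvg_at_left_filter (cF d)].
  by move=> x _; case: (dF x).
- by move=> x _; rewrite derive1E; case: (dF x).
Qed.

Lemma bounded_cvg_Rintegral c d (f_ : nat -> R -> R) f h :
  (forall n, measurable_fun setT (f_ n)) -> measurable_fun setT f ->
  L2 c d h ->
  {ae lebesgue_on c d, forall x, f_ ^~ x @ \oo --> f x} ->
  (forall n x, `|f_ n x| <= `|h x|) ->
  (\int[lebesgue_on c d]_x f_ n x)%R @[n --> \oo] --> (\int[lebesgue_on c d]_x f x)%R.
Proof.
move=> mf_ mf Lh ff fh.
have [|||||/= fi _] := @dominated_convergence _ _ _ (lebesgue_on c d) setT
  measurableT (fun n x => (f_ n x)%:E) (fun x => (f x)%:E) (fun x => `|h x|%:E).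
- by move=> n; apply/measurable_EFinP; exact: mf_.
- exact/measurable_EFinP.
- by apply: filterS ff => x fx _; apply: cvg_EFin => //; exact: nearW.
- have := integrable_abse (L2_integrable Lh); apply: eq_integrable => //.
- by apply: nearW => x n _; rewrite lee_fin.
move=> cvgf; rewrite /Rintegral; apply: fine_cvg; rewrite fineK//.
exact: integrable_fin_num.
Qed.

End BoundedFunctions.

(** * Test functions and the fundamental lemma *)

Section TestFunctions.
Context {R : realType}.
Implicit Types (c d : R) (f g h phi : R -> R).

Local Notation mu := (@lebesgue_measure R).

Lemma test_functionI c d alpha beta phi : smooth phi -> c < alpha -> beta < d ->
  (forall x, phi x != 0 -> alpha <= x <= beta) -> test_function c d phi.
Proof.
move=> sphi ca bd supp.
have cl : closure [set x | phi x != 0] `<=` `[alpha, beta].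
  rewrite closureE; apply: smallest_sub; first exact: interval_closed.
  by move=> x /=; rewrite in_itv/=; exact: supp.
split => //.
- by apply: (subclosed_compact _ (@segment_compact R alpha beta)) => //; exact: closed_closure.
- apply: subset_trans cl _ => x /=; rewrite !in_itv/= => /andP[ax xb].
  by rewrite (lt_le_trans ca ax) (le_lt_trans xb bd).
Qed.

Lemma test_smooth c d phi : test_function c d phi -> smooth phi.
Proof. by case. Qed.

Lemma test_out c d phi x : test_function c d phi -> x \notin `]c, d[ -> phi x = 0.
Proof.
move=> [_ _ supp] xcd; apply/eqP/negPn/negP => px.
have /= xI : `]c, d[%classic x by apply: supp; exact: subset_closure.
by rewrite xI in xcd.
Qed.

Lemma test_derive1 c d phi : test_function c d phi -> test_function c d (derive1 phi).
Proof.
move=> [sphi cphi supp].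
have sub : [set x | derive1 phi x != 0] `<=` closure [set x | phi x != 0].
  move=> x /= dx; apply/not_notP => xn; move/eqP: dx; apply.
  have nx : \forall y \near x, cst 0 y = phi y.
    have : nbhs x (~` closure [set x | phi x != 0]).
      apply: open_nbhs_nbhs; split => //; apply: closed_openC; exact: closed_closure.
    apply: filterS => y ny /=; apply/esym/eqP/negPn/negP => py; apply: ny.
    exact: subset_closure.
  by rewrite derive1E -(near_eq_derive _ nx) derive_cst.
have sub2 := closure_subset sub.
rewrite -((closure_id (closure [set x | phi x != 0])).1 (@closed_closure _ _)) in sub2.
split.
- exact: smooth_derive1.
- by apply: (subclosed_compact _ cphi sub2); exact: closed_closure.
- exact: subset_trans sub2 supp.
Qed.

Lemma test_derive1n c d phi k : test_function c d phi -> test_function c d (derive1n k phi).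
Proof. by move=> tphi; elim: k => // k; rewrite derive1nS; exact: test_derive1. Qed.

(** Positive exactly on (alpha, beta); the factor n + 1 in the arguments flattens
    the bump towards the indicator function, as exp (- 1 / (n y)) tends to 1. *)
Definition bump_fun (alpha beta : R) (n : nat) (x : R) : R :=
  flat 0 (n.+1%:R * x + - n.+1%:R * alpha) *
  flat 0 (- n.+1%:R * x + n.+1%:R * beta).

Lemma bump_smooth alpha beta n : smooth (bump_fun alpha beta n).
Proof. by apply: flat_alg_smooth; apply: flat_alg_mul; exact: flat_alg_flat. Qed.

Lemma flat0_le1 (x : R) : flat 0 x <= 1.
Proof.
rewrite /flat; case: ifP => // x0.
by rewrite expr0 mul1r expR_le1 oppr_le0 invr_ge0 ltW.
Qed.

Lemma bump_supp alpha beta n x : bump_fun alpha beta n x != 0 -> alpha < x < beta.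
Proof.
have n0 : 0 < n.+1%:R :> R by rewrite ltr0n.
rewrite mulf_eq0 negb_or => /andP[].
rewrite /flat; case: ifP => [|_]; last by rewrite eqxx.
rewrite mulNr -mulrBr pmulr_rgt0// subr_gt0 => ax _.
case: ifP => [|_]; last by rewrite eqxx.
by rewrite mulNr addrC -mulrBr pmulr_rgt0// subr_gt0 ax.
Qed.

Lemma bump_le1 alpha beta n x : `|bump_fun alpha beta n x| <= 1.
Proof.
rewrite normrM !ger0_norm ?flat_ge0//.
by rewrite mulr_ile1 ?flat_ge0 ?flat0_le1.
Qed.

Lemma bump_test c d alpha beta n : c < alpha -> beta < d ->
  test_function c d (bump_fun alpha beta n).
Proof.
move=> ca bd; apply: (@test_functionI c d alpha beta) => //; first exact: bump_smooth.
by move=> x /bump_supp/andP[ax xb]; rewrite !ltW.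
Qed.

Lemma flat0_cvg (y : R) : 0 < y -> flat 0 (n.+1%:R * y) @[n --> \oo] --> (1 : R).
Proof.
move=> y0; have -> : (fun n : nat => flat 0 (n.+1%:R * y)) =
    (fun n : nat => expR (- (n.+1%:R^-1 * y^-1))).
  apply/funext => n; rewrite /flat pmulr_rgt0// y0 expr0 mul1r.
  by rewrite invfM.
rewrite -[X in _ --> X](@expR0 R).
apply: continuous_cvg; first exact: continuous_expR.
rewrite -oppr0 -(mul0r y^-1); apply: cvgN; apply: cvgMl => //.
exact: cvg_harmonic.
Qed.

Lemma bump_cvg alpha beta x : bump_fun alpha beta n x @[n --> \oo] --> (\1_`]alpha, beta[ x : R).
Proof.
rewrite indicE; have [|xI] := boolP (x \in `]alpha, beta[); last first.
  rewrite memNset; last exact/negP.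
  rewrite (_ : (fun n => _) = cst 0); first exact: cvg_cst.
  apply/funext => n; apply/eqP/negPn/negP => /bump_supp xab.
  by rewrite in_itv/= xab in xI.
move=> xI; rewrite mem_set//; move: xI; rewrite in_itv/= => /andP[ax xb].
rewrite -[X in _ --> X](mulr1 (1 : R)).
rewrite (_ : (fun n => _) = (fun n : nat => flat 0 (n.+1%:R * (x - alpha)) *
   flat 0 (n.+1%:R * (beta - x)))); last first.
  by apply/funext => n; rewrite /bump_fun; congr (flat _ _ * flat _ _); ring.
by apply: cvgM; apply: flat0_cvg; rewrite subr_gt0.
Qed.

(** In the limit of the bumps h has integral 0 over every compact subinterval, so
    its primitive is constant, while by Lebesgue's theorem the derivative of this
    primitive is h almost everywhere. *)
Lemma bump_fundamental c d h : L2 c d h ->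
  (forall alpha beta n, c < alpha -> beta < d ->
    (\int[lebesgue_on c d]_x (h x * bump_fun alpha beta n x))%R = 0) ->
  {ae lebesgue_on c d, forall x, h x = 0}.
Proof.
move=> Lh hb.
have mh := L2_measurable Lh.
have mI a b : measurable (`]a, b[ : set R) by exact: measurable_itv.
have ind alpha beta : c < alpha -> beta < d ->
    (\int[lebesgue_on c d]_x (h x * \1_`]alpha, beta[ x))%R = 0.
  move=> ca bd.
  have E : (fun n => \int[lebesgue_on c d]_x (h x * bump_fun alpha beta n x))%R = cst 0.
    by apply/funext => n; rewrite hb.
  have := @bounded_cvg_Rintegral R c d (fun n x => h x * bump_fun alpha beta n x)
    (fun x => h x * \1_`]alpha, beta[ x) h.
  rewrite E => /(_ _ _ Lh) H; apply/esym.
  apply: (@cvg_unique _ _ (cst (0 : R) n @[n --> \oo])) => //; first exact: cvg_cst.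
  apply: H => //.
  - move=> n; apply: measurable_funM => //; apply: continuous_measurable.
    by apply: smooth_continuous; exact: bump_smooth.
  - by apply: measurable_funM => //; exact: measurable_indic.
  - by apply: nearW => x; apply: cvgMr; exact: bump_cvg.
  - by move=> n x; rewrite normrM ler_piMr ?bump_le1.
pose hI := h \_ `]c, d[.
have ihI : mu.-integrable setT (EFin \o hI).
  rewrite -restrict_EFin; apply/integrable_restrict => //.
  rewrite setTI.
  have /integrableP[mE iE] := L2_integrable Lh.
  apply/integrableP; split; first exact: measurable_funTS.
  by move: iE; rewrite integral_lebesgue_on//; exact: measurableT_comp.
have ihIs (A : set R) : measurable A -> mu.-integrable A (EFin \o hI).
  by move=> mA; apply: integrableS ihI.
have locI : locally_integrable setT hI.
  have := integrable_locally measurableT ihI.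
  by rewrite (_ : hI \_ setT = hI)//; apply/funext => x; rewrite patchE mem_set.
have := @FTC1Ny R hI (fun y => ihIs _ (measurable_itv _)) locI.
set F := (fun x => Rintegral _ _ _) => aeF.
have Fc z y : c < z -> y < d -> z <= y -> F y - F z = 0.
  move=> cz yd zy; rewrite /F.
  rewrite Rintegral_itvB//; first last.
    exact: ihIs.
  rewrite -Rintegral_itv_bndo_bndc; last exact: ihIs.
  rewrite -(ind z y)// Rintegral_lebesgue_on; last first.
    by apply: measurable_funM => //; exact: measurable_indic.
  rewrite [RHS]Rintegral_mkcond [LHS]Rintegral_mkcond.
  apply: eq_Rintegral => x _; rewrite /hI !patchE indicE.
  have [xI|xI] := boolP (x \in `]c, d[%classic).
    by case: ifP => _; rewrite ?mulr1 ?mulr0.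
  by case: ifP.
apply/ae_lebesgue_on; move: aeF.
apply: filterS; first exact: (ae_filter_ringOfSetsType mu).
move=> x /= [dFx Fx] xI.
move: Fx; rewrite /hI patchE mem_set// => <-.
rewrite derive1E -[RHS](@derive_cst R R R (F x) x 1).
apply: near_eq_derive.
move: (near_in_itvoo xI); apply: filterS => y /=.
move: xI; rewrite !in_itv/= => /andP[cx xd] /andP[cy yd].
change (F y = F x).
have [xy|yx] := leP x y.
  by apply/eqP; rewrite -subr_eq0 Fc.
by apply/eqP; rewrite eq_sym -subr_eq0 Fc// ltW.
Qed.

End TestFunctions.

(** * Primitives of square-integrable functions *)

Section Primitives.
Context {R : realType}.
Implicit Types (c d : R) (f g h phi : R -> R).

Local Notation mu := (@lebesgue_measure R).

Definition step (x y : R) : R := (y < x)%R%:R.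

Lemma step_itv x : step x = \1_`]-oo, x[.
Proof.
apply/funext => y; rewrite /step indicE.
case: (boolP (y \in `]-oo, x[%classic)) => [/set_mem|/negP yx].
  by rewrite /= in_itv/= => ->.
have [yx'|//] := ltP y x.
by exfalso; apply: yx; apply/mem_set; rewrite /= in_itv.
Qed.

Lemma measurable_step x : measurable_fun setT (step x).
Proof. by rewrite step_itv; exact: measurable_indic. Qed.

Lemma step_le1 x y : `|step x y| <= 1.
Proof. by rewrite /step ger0_norm ?ler_nat ?ler0n ?lern1 ?leq_b1. Qed.

Lemma L2_step c d x : L2 c d (step x).
Proof.
by apply: (@L2_bounded R c d 1); [exact: measurable_step|move=> y _; exact: step_le1].
Qed.

(** The primitive of h vanishing at c, as an inner product: Cauchy-Schwarz then
    gives its continuity, and Fubini its integration by parts. *)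
Definition prim c d h x := ip c d h (step x).

Lemma prim_left c d h x : L2 c d h -> x <= c -> prim c d h x = 0.
Proof.
move=> Lh xc; rewrite /prim /ip.
rewrite (@ae_eq_Rintegral _ _ _ _ (cst 0))//.
- by rewrite Rintegral_cst// mul0r.
- by apply: measurable_funM; [exact: L2_measurable Lh|exact: measurable_step].
- apply/ae_lebesgue_on/nearW => y; rewrite in_itv/= => /andP[cy _].
  by rewrite /step ltNge (le_trans xc (ltW cy)) mulr0.
Qed.

Lemma ipDr c d f g h : L2 c d f -> L2 c d g -> L2 c d h ->
  ip c d h (fun x => f x + g x) = ip c d h f + ip c d h g.
Proof. by move=> *; rewrite ipC ipDl// !(ipC _ _ h). Qed.

Lemma ipZr c d k f h : L2 c d f -> L2 c d h ->
  ip c d h (fun x => k * f x) = k * ip c d h f.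
Proof. by move=> *; rewrite ipC ipZl// (ipC _ _ h). Qed.

Lemma ipBr c d f g h : L2 c d f -> L2 c d g -> L2 c d h ->
  ip c d h (fun x => f x - g x) = ip c d h f - ip c d h g.
Proof.
move=> Lf Lg Lh.
have -> : (fun x => f x - g x) = (fun x => f x + -1 * g x).
  by apply/funext => x; rewrite mulN1r.
by rewrite ipDr ?ipZr ?mulN1r//; exact: L2Z.
Qed.

Lemma ipBl c d f g h : L2 c d f -> L2 c d g -> L2 c d h ->
  ip c d (fun x => f x - g x) h = ip c d f h - ip c d g h.
Proof. by move=> *; rewrite ipC ipBr// !(ipC _ _ h). Qed.

Lemma prim_itv c d h x y : x <= y -> L2 c d h ->
  prim c d h y - prim c d h x = ip c d h \1_`[x, y[.
Proof.
move=> xy Lh; rewrite /prim -ipBr//; try exact: L2_step.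
congr ip; apply/funext => z; rewrite /step indicE.
case: (boolP (z \in `[x, y[%classic)) => [/set_mem|/negP zI].
  by rewrite /= in_itv/= => /andP[xz zy]; rewrite zy ltNge xz subr0.
have [zx|xz] := ltP z x; first by rewrite (lt_le_trans zx xy) subrr.
have [zy|_] := ltP z y; last by rewrite subr0.
by exfalso; apply: zI; apply/mem_set; rewrite /= in_itv/= xz zy.
Qed.

Lemma ip_indic_le c d x y : x <= y -> ip c d \1_`[x, y[ \1_`[x, y[ <= y - x.
Proof.
move=> xy; rewrite /ip Rintegral_lebesgue_on; last first.
  by apply: measurable_funM; exact: measurable_indic.
have -> : (fun z : R => \1_`[x, y[ z * \1_`[x, y[ z : R) = \1_`[x, y[.
  by apply/funext => z; rewrite indicE; case: (_ \in _); rewrite ?mul1r ?mul0r.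
rewrite /Rintegral integral_indic//= -[leRHS]/(fine (y - x)%:E).
have xyE : (y - x)%:E = mu (`[x, y[ : set R).
  rewrite lebesgue_measure_itv/= lte_fin EFinB; have [//|yx] := ltP x y.
  by have -> : x = y; [apply/eqP; rewrite eq_le xy yx|rewrite subee].
have le1 : (mu (`[x, y[ `&` `]c, d[) <= (y - x)%:E)%E.
  by rewrite xyE; apply: le_measure; rewrite ?inE//; exact: measurableI.
by apply: fine_le => //; rewrite ge0_fin_numE// (le_lt_trans le1) ?ltry.
Qed.

Lemma L2_indic c d x y : L2 c d (\1_`[x, y[ : R -> R).
Proof.
apply: (@L2_bounded R c d 1); first exact: measurable_indic.
by move=> z _; rewrite indicE ger0_norm ?ler_nat ?ler0n ?lern1 ?leq_b1.
Qed.

(** Cauchy-Schwarz against the indicator function of [x, y), of norm at most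
    sqrt (y - x). *)
Lemma prim_holder c d h x y : L2 c d h ->
  `|prim c d h y - prim c d h x| <= L2norm c d h * Num.sqrt `|y - x|.
Proof.
move=> Lh; wlog xy : x y / x <= y.
  move=> H; have [xy|/ltW yx] := leP x y; first exact: H.
  by rewrite distrC (distrC y); exact: H.
rewrite prim_itv//; apply: le_trans (ip_le Lh (L2_indic _ _ _ _)) _.
rewrite ler_wpM2l ?L2norm_ge0//.
rewrite (ger0_norm (_ : 0 <= y - x)) ?subr_ge0//.
rewrite -[X in X <= _]ger0_norm ?L2norm_ge0// -sqrtr_sqr L2norm_sqr.
by apply: ler_wsqrtr; exact: ip_indic_le.
Qed.

Lemma prim_continuous c d h : L2 c d h -> continuous (prim c d h).
Proof.
move=> Lh x; apply/cvgrPdist_le => e e0.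
have [h0|h0] := eqVneq (L2norm c d h) 0.
  by near=> y; apply: le_trans (prim_holder _ _ Lh) _; rewrite h0 mul0r ltW.
have h1 : 0 < L2norm c d h by rewrite lt_def h0 L2norm_ge0.
have q0 : 0 < (L2norm c d h)^-1 * e by rewrite mulr_gt0 ?invr_gt0.
near=> y.
rewrite distrC; apply: le_trans (prim_holder _ _ Lh) _.
rewrite -ler_pdivlMl// -[leRHS](gtr0_norm q0) -[leRHS]sqrtr_sqr; apply: ler_wsqrtr.
near: y; apply: cvgr_distC_le; first exact: cvg_id.
by rewrite exprn_gt0.
Unshelve. all: by end_near. Qed.

Lemma integrable_lebesgue_on c d (f : R -> \bar R) :
  (lebesgue_on c d).-integrable setT f -> mu.-integrable `]c, d[ f.
Proof.
move=> /integrableP[mf fi]; apply/integrableP; split; first exact: measurable_funTS.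
by move: fi; rewrite integral_lebesgue_on//; exact: measurableT_comp.
Qed.

Lemma prim_lip c d h K x y : L2 c d h -> 0 <= K ->
  (forall z, z \in `]c, d[ -> `|h z| <= K) ->
  `|prim c d h y - prim c d h x| <= K * `|y - x|.
Proof.
move=> Lh K0 hK; wlog xy : x y / x <= y.
  move=> H; have [xy|/ltW yx] := leP x y; first exact: H.
  by rewrite distrC (distrC y); exact: H.
have LI := @L2_indic c d x y.
have LKI := L2Z K LI.
have mI : measurable_fun setT (\1_`[x, y[ : R -> R) by exact: measurable_indic.
have mh := L2_measurable Lh.
have iL := integrable_lebesgue_on (integrable_L2_mul Lh LI).
have iR := integrable_lebesgue_on (integrable_L2_mul LKI LI).
rewrite prim_itv// (ger0_norm (_ : 0 <= y - x)) ?subr_ge0//.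
apply: (@le_trans _ _ (ip c d (fun z => K * \1_`[x, y[ z) \1_`[x, y[)); last first.
  by rewrite ipZl// ler_wpM2l//; exact: ip_indic_le.
rewrite /ip !Rintegral_lebesgue_on; [|apply: measurable_funM => //; exact: L2_measurable LKI|exact: measurable_funM].
apply: le_trans (le_normr_Rintegral _ iL) _ => //.
apply: le_Rintegral => //.
  by have := integrable_abse iL; apply: eq_integrable.
move=> z zI; rewrite indicE normrM.
case: (z \in _); rewrite ?normr1 ?normr0 ?mulr0// !mulr1; exact: hK.
Qed.

Lemma EFin_ip c d f g : L2 c d f -> L2 c d g ->
  (\int[lebesgue_on c d]_x (f x * g x)%:E = (ip c d f g)%:E)%E.
Proof.
move=> Lf Lg; rewrite /ip /Rintegral fineK//.
exact: integrable_fin_num (integrable_L2_mul Lf Lg).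
Qed.

Lemma L2_cst c d k : L2 c d (cst k).
Proof. by apply: (@L2_bounded R c d `|k|). Qed.

Lemma L2_stepr c d y : L2 c d (step^~ y).
Proof.
apply: (@L2_bounded R c d 1); last by move=> x _; exact: step_le1.
rewrite (_ : step^~ y = \1_`]y, +oo[); first exact: measurable_indic.
apply/funext => x; rewrite /step indicE.
case: (boolP (x \in `]y, +oo[%classic)) => [/set_mem|/negP yx].
  by rewrite /= in_itv/= andbT => ->.
have [yx'|//] := ltP y x.
by exfalso; apply: yx; apply/mem_set; rewrite /= in_itv/= andbT.
Qed.

Lemma ip_step_derive c d phi phi' y : y \in `]c, d[ ->
  (forall x : R, is_derive x 1 phi (phi' x)) -> continuous phi' ->
  ip c d (step^~ y) phi' = phi d - phi y.
Proof.
rewrite in_itv/= => /andP[cy yd] dphi cphi'.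
rewrite -(FTC_lebesgue_on (ltW yd) dphi cphi').
rewrite /ip !Rintegral_lebesgue_on; [|exact: continuous_measurable|]; last first.
  apply: measurable_funM; last exact: continuous_measurable.
  exact: L2_measurable (L2_stepr c d y).
rewrite [LHS]Rintegral_mkcond [RHS]Rintegral_mkcond.
apply: eq_Rintegral => x _; rewrite !patchE /step.
have [yx|xy] := ltP y x; last first.
  rewrite mul0r [X in _ = if X then _ else _]memNset; first by case: ifP.
  by rewrite /= in_itv/= ltNge xy.
rewrite mul1r; congr (if _ then _ else _); apply/idP/idP => /set_mem /=;
  rewrite in_itv/= => /andP[_ xd]; apply/mem_set; rewrite /= in_itv/= xd ?yx//.
by rewrite (lt_trans cy yx).
Qed.

(** Integration by parts against an absolutely continuous primitive, by
    exchanging the order of integration over the triangle y < x. *)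
Lemma prim_ibp c d h phi phi' : c <= d -> L2 c d h ->
  (forall x : R, is_derive x 1 phi (phi' x)) -> continuous phi' ->
  ip c d (prim c d h) phi' = prim c d h d * phi d - ip c d h phi.
Proof.
move=> cd Lh dphi cphi'.
have mI : measurable (`]c, d[ : set (measurableTypeR R)) by exact: measurable_itv.
have muI : (mu `]c, d[ < +oo)%E.
  by rewrite lebesgue_measure_itv/=; case: ifP => _; rewrite -?EFinB ltry.
pose m : {finite_measure set (measurableTypeR R) -> \bar R} := mfrestr mI muI.
have mh := L2_measurable Lh.
have Lphi' : L2 c d phi' by exact: continuous_L2.
have mphi' := L2_measurable Lphi'.
have cphi : continuous phi by apply: derivable_continuous => x; case: (dphi x).
have Lphi : L2 c d phi by exact: continuous_L2.
pose F (z : measurableTypeR R * measurableTypeR R) : \bar R :=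
  (h z.2 * step z.1 z.2 * phi' z.1)%:E.
have mF : measurable_fun setT F.
  apply/measurable_EFinP; apply: measurable_funM; first apply: measurable_funM.
  - exact: (measurableT_comp mh).
  - rewrite (_ : (fun _ => _) = \1_[set z : measurableTypeR R * measurableTypeR R | z.2 < z.1]).
      apply: measurable_indic.
      have mlt : measurable_fun setT
          (fun z : measurableTypeR R * measurableTypeR R => (z.2 < z.1)%R).
        by apply: measurable_fun_ltr; [exact: measurable_snd|exact: measurable_fst].
      have := mlt measurableT [set true] I; rewrite setTI.
      by congr measurable; apply/seteqP; split.
    apply/funext => z; rewrite /step indicE.
    rewrite (_ : (z \in _) = (z.2 < z.1))//.
    by apply/idP/idP => [/set_mem//|?]; exact/mem_set.
  - exact: (measurableT_comp mphi').
have iF : (m \x m)%E.-integrable setT F.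
  apply/(@integrable12ltyP _ _ _ _ _ m m _ mF).
  have /integrableP[mE iE] := L2_integrable Lh.
  have /integrableP[mE' iE'] := L2_integrable Lphi'.
  pose A : \bar R := (\int[m]_y `|h y|%:E)%E.
  have A0 : (0 <= A)%E by apply: integral_ge0 => y _; rewrite lee_fin.
  apply: (@le_lt_trans _ _ (\int[m]_x (`|phi' x|%:E * A))%E).
    apply: ge0_le_integral => //.
    - by move=> x _; exact: integral_ge0.
    - by apply: (measurable_fun_fubini_tonelli_F (abse \o F)) => //=; exact: measurableT_comp.
    - apply: emeasurable_funM => //; apply/measurable_EFinP; exact: measurableT_comp.
    - move=> x _; rewrite /A -ge0_integralZl//; last first.
        by apply/measurable_EFinP; exact: measurableT_comp.
      apply: ge0_le_integral => //.
      + apply: measurableT_comp => //; apply/measurable_EFinP.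
        rewrite /=; apply: measurable_funM; last exact: measurable_cst.
        by apply: measurable_funM; [exact: mh|exact: measurable_step].
      + by apply: emeasurable_funM => //; apply/measurable_EFinP; exact: measurableT_comp.
      + move=> y _; rewrite -EFinM lee_fin !normrM mulrC ler_wpM2l//.
        by rewrite ler_piMr ?step_le1.
  have Afin : A \is a fin_num by rewrite ge0_fin_numE.
  rewrite -(fineK Afin) ge0_integralZr//; last 2 first.
    by apply/measurable_EFinP; exact: measurableT_comp.
    by rewrite lee_fin fine_ge0.
  by rewrite muleC lte_mul_pinfty// lee_fin fine_ge0.
have := Fubini iF.
have Lp : L2 c d (prim c d h) by apply: continuous_L2; exact: prim_continuous.
have -> : (\int[m]_x \int[m]_y F (x, y) = (ip c d (prim c d h) phi')%:E)%E.
  rewrite -EFin_ip//; apply: eq_integral => x _.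
  rewrite EFinM -EFin_ip//; last exact: L2_step.
  rewrite -integralZr//; exact: integrable_L2_mul (L2_step _ _ _).
have -> : (\int[m]_y \int[m]_x F (x, y) = (prim c d h d * phi d - ip c d h phi)%:E)%E.
  have Lk : L2 c d (fun y => phi d - phi y) by apply: L2B => //; exact: L2_cst.
  transitivity (\int[m]_y (h y * (phi d - phi y))%:E)%E.
    apply: ae_eq_integral => //.
    - exact: measurable_fubini_G iF.
    - by apply/measurable_EFinP; apply: measurable_funM => //; exact: L2_measurable Lk.
    - have : {ae lebesgue_on c d, forall y,
          (\int[m]_x F (x, y) = (h y * (phi d - phi y))%:E)%E}.
        apply/ae_lebesgue_on/nearW => y yI.
        rewrite -(ip_step_derive yI dphi cphi') EFinM -EFin_ip//; last exact: L2_stepr.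
        rewrite -integralZl//; last exact: integrable_L2_mul (L2_stepr _ _ _) Lphi'.
        by apply: eq_integral => x _; rewrite /F /= -EFinM mulrA.
      by apply: filterS => y ->.
  rewrite [LHS]EFin_ip// ipBr//; last exact: L2_cst.
  congr (_ - _)%:E; rewrite mulrC /prim -ipZr//; last exact: L2_step.
  apply: ip_ae => //; [exact: L2_cst|exact: L2Z (L2_step _ _ _)|exact: nearW|].
  apply/ae_lebesgue_on/nearW => y; rewrite in_itv/= => /andP[_ yd].
  by rewrite /step yd mulr1.
by case.
Qed.

End Primitives.

(** * Weak derivatives *)

Section WeakDerivatives.
Context {R : realType}.
Implicit Types (c d : R) (f g h phi : R -> R).

Local Notation mu := (@lebesgue_measure R).

Lemma test_L2 c d c' d' phi : test_function c' d' phi -> L2 c d phi.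
Proof. by move=> /test_smooth/smooth_continuous; exact: continuous_L2. Qed.

Lemma bump_L2 c d alpha beta n : L2 c d (bump_fun alpha beta n).
Proof. by apply: continuous_L2; apply: smooth_continuous; exact: bump_smooth. Qed.

Lemma ip_bump_eq c d f g : L2 c d f -> L2 c d g ->
  (forall alpha beta n, c < alpha -> beta < d ->
    ip c d f (bump_fun alpha beta n) = ip c d g (bump_fun alpha beta n)) ->
  {ae lebesgue_on c d, forall x, f x = g x}.
Proof.
move=> Lf Lg fg.
have : {ae lebesgue_on c d, forall x, f x - g x = 0}.
  apply: bump_fundamental; first exact: L2B.
  move=> alpha beta n ca bd.
  rewrite -/(ip c d (fun x => f x - g x) _) ipBl ?fg ?subrr//.
  exact: bump_L2.
by apply: filterS => x /eqP; rewrite subr_eq0 => /eqP.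
Qed.

Lemma weak_derivative_unique c d k u g g' : L2 c d g -> L2 c d g' ->
  is_weak_derivative c d k u g -> is_weak_derivative c d k u g' ->
  {ae lebesgue_on c d, forall x, g x = g' x}.
Proof.
move=> Lg Lg' ug ug'; apply: ip_bump_eq => // alpha beta n ca bd.
have t := bump_test n ca bd.
have := ug _ t; rewrite ug' // => /esym.
by move/mulfI; apply; rewrite signr_eq0.
Qed.

Lemma bump_nonzero c d : c < d -> exists alpha beta n,
  [/\ c < alpha, beta < d & ip c d (cst 1) (bump_fun alpha beta n) != 0].
Proof.
move=> cd; apply/not_notP => H.
have : {ae lebesgue_on c d, forall x, (1 : R) = 0}.
  apply: (@ip_bump_eq c d (cst 1) (cst 0)); [exact: L2_cst..|].
  move=> alpha beta n ca bd; have [-> |i0] := eqVneq (ip c d (cst 1) (bump_fun alpha beta n)) 0.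
    rewrite (_ : cst 0 = (fun x => 0 * cst 1 x)).
      by rewrite ipZl ?mul0r//; [exact: L2_cst|exact: bump_L2].
    by apply/funext => x; rewrite mul0r.
  by exfalso; apply: H; exists alpha, beta, n.
move=> [A [mA A0 HA]].
have AT : A = setT by apply/seteqP; split => // x _; apply: HA => /= /eqP; rewrite oner_eq0.
move: A0; rewrite AT; move/eqP; rewrite lebesgue_on_setT ?ltW// eqe subr_eq0.
by move=> /eqP dc; rewrite dc ltxx in cd.
Qed.

(** The primitive vanishes to the left of alpha, and to the right of beta because
    theta has integral 0. *)
Lemma primitive_test c d alpha beta theta : smooth theta -> c < alpha -> beta < d ->
  (forall x, theta x != 0 -> alpha <= x <= beta) ->
  (\int[lebesgue_on c d]_x theta x)%R = 0 ->
  exists2 phi, test_function c d phi & derive1 phi = theta.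
Proof.
move=> sth ca bd supp i0.
have cth := smooth_continuous sth.
have suppE x : x \notin `]c, d[ -> theta x = 0.
  move=> xI; apply/eqP/negPn/negP => /supp/andP[ax xb].
  by rewrite in_itv/= (lt_le_trans ca ax) (le_lt_trans xb bd) in xI.
have ith : mu.-integrable setT (EFin \o theta).
  have := integrable_lebesgue_on (L2_integrable (continuous_L2 c d cth)).
  move=> iI; have : mu.-integrable setT ((EFin \o theta) \_ `]c, d[).
    by apply/integrable_restrict => //; rewrite ?setTI//; exact: measurable_itv.
  apply: eq_integrable => // x _; rewrite patchE/=.
  by case: ifPn => // /negP xI; rewrite suppE//; apply/negP => xI'; apply: xI; apply/mem_set.
pose phi x : R := (\int[mu]_(t in [set` `]-oo, x]]) theta t)%R.
have dphi (x : R) : is_derive x 1 phi (theta x).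
  have iS : mu.-integrable [set` Interval -oo%O (BRight (x + 1))] (EFin \o theta).
    by apply: integrableS ith => //; exact: measurable_itv.
  have xx : x < x + 1 by rewrite ltrDl.
  have [dx <-] := continuous_FTC1 xx iS (ltNyr _) (cth x).
  by rewrite derive1E; exact: derivableP.
have dE := is_derive1_derive1 dphi.
exists phi; last exact: dE.
apply: (test_functionI _ ca bd).
  by case=> [|k] x; [case: (dphi x)|rewrite derive1SnE dE; exact: sth].
move=> x; apply: contraNT; rewrite negb_and -!ltNge => /orP[xa|bx]; apply/eqP.
  rewrite /phi (@eq_Rintegral _ _ _ mu _ (cst 0)).
    by rewrite Rintegral_cst ?mul0r//; exact: measurable_itv.
  move=> t /set_mem; rewrite /= in_itv/= => tx.
  apply/eqP/negPn/negP => /supp/andP[at_ _].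
  by have := lt_le_trans xa (le_trans at_ tx); rewrite ltxx.
rewrite -i0 Rintegral_lebesgue_on; last exact: continuous_measurable.
rewrite /phi Rintegral_mkcond [RHS]Rintegral_mkcond.
apply: eq_Rintegral => t _; rewrite !patchE.
have [->|t0] := eqVneq (theta t) 0; first by rewrite !if_same.
have /andP[at_ tb] := supp _ t0.
rewrite !mem_set//= in_itv/= ?(lt_le_trans ca at_) ?(le_lt_trans tb bd)//.
exact: ltW (le_lt_trans tb bx).
Qed.

(** The bumps psi are corrected by a multiple of one fixed bump rho of nonzero
    integral, so as to become derivatives of test functions; testing f against them
    gives <f, psi> = (<f, rho> / <1, rho>) <1, psi>. *)
Lemma weak_const c d f : c < d -> L2 c d f ->
  (forall phi, test_function c d phi -> ip c d f (derive1 phi) = 0) ->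
  exists k, {ae lebesgue_on c d, forall x, f x = k}.
Proof.
move=> cd Lf H.
have [a0 [b0 [n0 [ca0 b0d m0]]]] := bump_nonzero cd.
set m := ip _ _ _ _ in m0; pose rho := bump_fun a0 b0 n0.
have Lrho : L2 c d rho by exact: bump_L2.
exists (ip c d f rho / m); apply: ip_bump_eq => //; first exact: L2_cst.
move=> alpha beta n ca bd; set psi := bump_fun alpha beta n.
have Lpsi : L2 c d psi by exact: bump_L2.
pose r := ip c d (cst 1) psi / m.
pose theta x := psi x + cst (- r) x * rho x.
have Lr : L2 c d (fun x => cst (- r) x * rho x) by exact: (L2Z (- r) Lrho).
have sth : smooth theta.
  apply: flat_alg_smooth; apply: flat_alg_add; last apply: flat_alg_mul.
  - by apply: flat_alg_mul; exact: flat_alg_flat.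
  - exact: flat_alg_cst.
  - by apply: flat_alg_mul; exact: flat_alg_flat.
have L1 : L2 c d (cst 1) by exact: L2_cst.
have [||||phi tphi dphi] := @primitive_test c d (Num.min a0 alpha) (Num.max b0 beta) theta sth.
- by rewrite lt_min ca0.
- by rewrite gt_max b0d.
- move=> x; apply: contraNT; rewrite /theta ge_min le_max => nx.
  rewrite (_ : psi x = 0); last first.
    apply/eqP; apply: contraNT nx => /bump_supp/andP[ax xb].
    by rewrite (ltW ax) (ltW xb) !orbT.
  rewrite (_ : rho x = 0) ?mulr0 ?addr0//.
  apply/eqP; apply: contraNT nx => /bump_supp/andP[ax xb].
  by rewrite (ltW ax) (ltW xb) !orTb.
- transitivity (ip c d (cst 1) theta).
    by apply: eq_Rintegral => x _; rewrite mul1r.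
  have E : ip c d (cst 1) (fun x => cst (- r) x * rho x) = - r * m := ipZr (- r) Lrho L1.
  by rewrite ipDr// E mulNr divfK ?subrr.
have E : ip c d f (fun x => cst (- r) x * rho x) = - r * ip c d f rho := ipZr (- r) Lrho Lf.
have := H _ tphi; rewrite dphi ipDr// E.
move/eqP; rewrite mulNr subr_eq0 => /eqP ->.
have E2 K : ip c d (cst K) psi = K * ip c d (cst 1) psi.
  by rewrite -ipZl//; congr ip; apply/funext => x; rewrite mulr1.
rewrite [RHS]E2 /r; move: (ip c d (cst 1) psi) (ip c d f rho) => A B.
by rewrite mulrAC [RHS]mulrAC (mulrC A).
Qed.

(** The primitive of g has the same weak derivative as w, by integration by parts,
    so that the difference is constant. *)
Lemma weak_derivative_prim c d w g : c < d -> L2 c d w -> L2 c d g ->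
  is_weak_derivative c d 1 w g ->
  exists k, {ae lebesgue_on c d, forall x, w x = k + prim c d g x}.
Proof.
move=> cd Lw Lg wg.
have Lp : L2 c d (prim c d g) by apply: continuous_L2; exact: prim_continuous.
have [||k Hk] := @weak_const c d (fun x => w x - prim c d g x) cd; first exact: L2B.
  move=> phi tphi; have sphi := test_smooth tphi.
  have t1 := test_derive1 tphi.
  rewrite ipBl//; last exact: test_L2 t1.
  have := wg phi tphi; rewrite expr1 mulN1r => e.
  rewrite [X in X - _]e.
  have dphi (x : R) : is_derive x 1 phi (derive1 phi x).
    by rewrite derive1E; apply: derivableP; exact: smooth_derivable.
  have cphi : continuous (derive1 phi) by apply: smooth_continuous; exact: test_smooth t1.
  rewrite (prim_ibp (ltW cd) Lg dphi cphi).
  rewrite (test_out tphi (x := d)); last by rewrite in_itv/= ltxx andbF.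
  by rewrite mulr0 sub0r opprK addNr.
by exists k; apply: filterS Hk => x /eqP; rewrite subr_eq => /eqP.
Qed.

End WeakDerivatives.

(** * Continuous representatives of Sobolev functions *)

Section SobolevFunctions.
Context {R : realType}.
Implicit Types (c d : R) (f g h u v phi : R -> R).

Local Notation mu := (@lebesgue_measure R).
Local Notation wd := weak_derivative.

Lemma weak_derivativeP c d k u j : sobolev k c d u -> (j <= k)%N ->
  L2 c d (wd c d j u) /\ is_weak_derivative c d j u (wd c d j u).
Proof.
move=> [_ Hu] jk; have [g Lg ug] := Hu j jk.
rewrite /weak_derivative; case: xgetP => [h -> //|/(_ g)]; by case.
Qed.

Lemma sobolev_L2wd c d k u j : sobolev k c d u -> (j <= k)%N -> L2 c d (wd c d j u).
Proof. by move=> su jk; case: (weak_derivativeP su jk). Qed.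

Lemma weak_derivative_step c d k u j : sobolev k c d u -> (j < k)%N ->
  is_weak_derivative c d 1 (wd c d j u) (wd c d j.+1 u).
Proof.
move=> su jk phi tphi.
have [L0 w0] := weak_derivativeP su (ltnW jk).
have [L1 w1] := weak_derivativeP su jk.
have := w0 _ (test_derive1 tphi); rewrite -derive1SnE (w1 _ tphi).
rewrite exprS -mulrA mulN1r expr1 mulN1r.
by rewrite -mulrN => /mulfI => /(_ _) <-//; rewrite signr_eq0.
Qed.

Lemma wd0_ae c d k u : sobolev k c d u ->
  {ae lebesgue_on c d, forall x, wd c d 0 u x = u x}.
Proof.
move=> su; have [L0 w0] := weak_derivativeP su (leq0n k).
apply: weak_derivative_unique w0 _ => //; first by case: su.
by move=> phi _; rewrite expr0 mul1r.
Qed.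

(** A statement true almost everywhere holds somewhere in each subinterval, which
    has positive measure. *)
Lemma lebesgue_on_nonnull c d x y : c <= x -> x < y -> y <= d ->
  (forall P : R -> Prop, {ae lebesgue_on c d, forall z, P z} ->
   exists2 z, x < z < y & P z).
Proof.
move=> cx xy yd P /ae_lebesgue_on[A [mA A0 HA]]; apply/not_notP => H.
have sub : `]x, y[ `<=` A.
  move=> z /=; rewrite in_itv/= => zI; apply: HA => /= Pz; apply: H; exists z => //.
  apply: Pz; case/andP: zI => xz zy; rewrite in_itv/=.
  by rewrite (le_lt_trans cx xz) (lt_le_trans zy yd).
have mI : measurable (`]x, y[ : set (measurableTypeR R)) by exact: measurable_itv.
have m0 : mu (`]x, y[ : set R) = 0%E by exact: (subset_measure0 mI mA sub A0).
move: m0; rewrite lebesgue_measure_itv/= lte_fin xy -EFinB => -[] /eqP.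
by rewrite subr_eq0 => /eqP yx; rewrite yx ltxx in xy.
Qed.

(** If f - g were nonzero at a point of [c, d], it would stay nonzero on an
    interval inside (c, d), even when the point is an endpoint. *)
Lemma continuous_ae_eq c d f g : c < d -> {within `[c, d], continuous f} ->
  {within `[c, d], continuous g} ->
  {ae lebesgue_on c d, forall x, f x = g x} -> {in `[c, d], f =1 g}.
Proof.
move=> cd cf cg fg x xI; apply/eqP/negPn/negP => fgx.
have cfg : {within `[c, d], continuous (fun x => f x - g x)}.
  by move=> z; apply: cvgB; [exact: cf|exact: cg].
have e0 : 0 < `|f x - g x| by rewrite normr_gt0 subr_eq0.
move/subspace_continuousP : cfg => /(_ x xI).
move=> /cvgrPdist_lt/(_ _ e0); rewrite near_withinE => /nbhs_ballP[e /= e1 He].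
move: xI; rewrite in_itv/= => /andP[cx xd].
have lo : Num.max c (x - e) < Num.min d (x + e).
  rewrite lt_min !gt_max cd/= (le_lt_trans cx (_ : x < x + e)) ?ltrDl//.
  by rewrite (lt_le_trans (_ : x - e < x) xd) ?gtrBl//= ltrBlDr -addrA ltrDl addr_gt0.
have [||z /andP[z1 z2] fgz] := lebesgue_on_nonnull _ lo _ fg.
- by rewrite le_max lexx.
- by rewrite ge_min lexx.
move: z1 z2; rewrite lt_min gt_max => /andP[cz xz] /andP[zd zx].
have H1 : `|x - z| < e by rewrite ltr_distlC; apply/andP; split; lra.
have H2 : `[c, d]%classic z by rewrite /= in_itv/= !ltW.
have : `|(f x - g x) - (f z - g z)| < `|f x - g x| := He z H1 H2.
by rewrite fgz subrr subr0 ltxx.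
Qed.

(** For j < k the j-th weak derivative of an H^k function has the continuous
    representative k0 + prim c d u^(j+1), which value_at then returns. *)
Lemma sobolev_rep c d k u j : c < d -> sobolev k c d u -> (j < k)%N ->
  exists k0, let W := fun x => k0 + prim c d (wd c d j.+1 u) x in
  [/\ continuous W, {ae lebesgue_on c d, forall x, wd c d j u x = W x} &
      {in `[c, d], value_at c d j u =1 W}].
Proof.
move=> cd su jk.
have L0 := sobolev_L2wd su (ltnW jk); have L1 := sobolev_L2wd su jk.
have [k0 Hk] := weak_derivative_prim cd L0 L1 (weak_derivative_step su jk).
have cW : continuous (fun x => k0 + prim c d (wd c d j.+1 u) x).
  by move=> x; apply: cvgD; [exact: cvg_cst|exact: prim_continuous].
exists k0; split => // x xI; rewrite /value_at; set P := [set w | _].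
have [cw Hw] : P (xget (fun=> 0) P).
  apply: xgetPex; exists (fun x => k0 + prim c d (wd c d j.+1 u) x).
  by split => //; exact: continuous_subspaceT.
set w := xget _ _ in cw Hw *.
have ww : {ae lebesgue_on c d, forall y, w y = k0 + prim c d (wd c d j.+1 u) y}.
  by apply: filterS2 Hw Hk => z -> ->.
exact: (continuous_ae_eq cd cw (continuous_subspaceT cW) ww xI).
Qed.

(** Green's formula for a weak derivative; the boundary terms are values of the
    absolutely continuous representative. *)
Lemma ip_green c d k u j phi phi' : c < d -> sobolev k c d u -> (j < k)%N ->
  (forall x : R, is_derive x 1 phi (phi' x)) -> continuous phi' ->
  ip c d (wd c d j.+1 u) phi =
  value_at c d j u d * phi d - value_at c d j u c * phi c - ip c d (wd c d j u) phi'.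
Proof.
move=> cd su jk dphi cphi'.
have L0 := sobolev_L2wd su (ltnW jk); have L1 := sobolev_L2wd su jk.
have [k0 [cW HW VW]] := sobolev_rep cd su jk.
have Lphi' : L2 c d phi' by exact: continuous_L2.
rewrite !VW; [|by rewrite in_itv/= lexx ltW..].
rewrite (prim_left L1 (lexx c)) addr0.
rewrite (@ip_ae _ c d _ _ phi' phi' L0 (continuous_L2 c d cW) Lphi' Lphi' HW); last exact: nearW.
rewrite (@ipDl _ c d (cst k0)) ?(prim_ibp (ltW cd) L1 dphi cphi')//; last first.
- by apply: continuous_L2; exact: prim_continuous.
- exact: L2_cst.
have -> : ip c d (cst k0) phi' = k0 * (phi d - phi c).
  rewrite -(FTC_lebesgue_on (ltW cd) dphi cphi') /ip RintegralZl//.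
  exact: L2_integrable.
ring.
Qed.

(** With one more derivative the integrand of the primitive has itself a
    continuous, hence bounded, representative. *)
Lemma sobolev_rep_lip c d k u j : c < d -> sobolev k c d u -> (j.+1 < k)%N ->
  exists k0 K, let W := fun x => k0 + prim c d (wd c d j.+1 u) x in
  [/\ continuous W, {ae lebesgue_on c d, forall x, wd c d j u x = W x},
      {in `[c, d], value_at c d j u =1 W} &
      forall x y, `|W x - W y| <= K * `|x - y|].
Proof.
move=> cd su jk; have [k0 [cW HW VW]] := sobolev_rep cd su (ltnW jk).
have [k1 [cW1 HW1 _]] := sobolev_rep cd su jk.
set W1 := fun x => _ in cW1 HW1.
have [K KW1] := continuous_bounded (continuous_subspaceT cW1 (A := `[c, d])).
have LW1 := continuous_L2 c d cW1.
have L1 := sobolev_L2wd su (ltnW jk).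
have pE x : prim c d (wd c d j.+1 u) x = prim c d W1 x.
  by apply: ip_ae => //; [exact: L2_step|exact: L2_step|exact: nearW].
exists k0, `|K|; split => // x y.
rewrite opprD addrACA subrr add0r !pE; apply: prim_lip => //.
move=> z zI; apply: le_trans (ler_norm K); apply: KW1.
exact: subset_itv_oo_cc.
Qed.

(** Linear combinations of derivatives are again of the same shape, so that
    coinduction applies. *)
Lemma smooth_lin k f g : smooth f -> smooth g -> smooth (fun x => k * f x + g x).
Proof.
move=> sf sg; pose P h := exists f g, [/\ smooth f, smooth g & h = fun x => k * f x + g x].
apply: (@smooth_coind R P); last by exists f, g.
move=> _ [{sf sg}f0 [g0 [sf sg ->]]].
have D (x : R) : is_derive x 1 (fun x => k * f0 x + g0 x) (k * derive1 f0 x + derive1 g0 x).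
  have Hf : is_derive x 1 f0 (derive1 f0 x).
    by rewrite derive1E; apply: derivableP; exact: smooth_derivable.
  have Hg : is_derive x 1 g0 (derive1 g0 x).
    by rewrite derive1E; apply: derivableP; exact: smooth_derivable.
  have := is_deriveD (is_deriveM (is_derive_cst k x (1:R)) Hf) Hg.
  by move=> H; apply: is_derive_eq H _; rewrite scaler0 addr0.
split=> [x|]; first by case: (D x).
by exists (derive1 f0), (derive1 g0); split; [exact: smooth_derive1..|exact: is_derive1_derive1].
Qed.

Lemma test_lin c d k f g : test_function c d f -> test_function c d g ->
  test_function c d (fun x => k * f x + g x).
Proof.
move=> [sf kf cf] [sg kg cg].
set Sf := closure [set x | f x != 0] in kf cf; set Sg := closure [set x | g x != 0] in kg cg.
have sub : closure [set x | k * f x + g x != 0] `<=` Sf `|` Sg.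
  rewrite closureE; apply: smallest_sub.
    by apply: closedU; exact: closed_closure.
  move=> x /= kfg; have [f0|f0] := eqVneq (f x) 0; last by left; exact: subset_closure.
  by right; apply: subset_closure => /=; move: kfg; rewrite f0 mulr0 add0r.
split.
- exact: (@smooth_lin k f g sf sg).
- apply: (subclosed_compact _ _ sub); first exact: closed_closure.
  exact: compactU.
- by apply: subset_trans sub _; rewrite subUset.
Qed.

Lemma weak_derivative_lin c d j k u v g h : L2 c d u -> L2 c d v -> L2 c d g -> L2 c d h ->
  is_weak_derivative c d j u g -> is_weak_derivative c d j v h ->
  is_weak_derivative c d j (fun x => k * u x + v x) (fun x => k * g x + h x).
Proof.
move=> Lu Lv Lg Lh ug vh phi tphi.
have Lk f : L2 c d f -> L2 c d (fun x => k * f x) by exact: L2Z.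
have L1 : L2 c d phi := test_L2 c d tphi.
have L2' : L2 c d (derive1n j phi) := test_L2 c d (test_derive1n j tphi).
have := ug phi tphi; have := vh phi tphi; rewrite -!/(ip _ _ _ _) => E1 E2.
rewrite !ipDl ?ipZl//; try exact: Lk.
by rewrite E1 E2; ring.
Qed.

Lemma sobolev_lin K c d k u v : sobolev K c d u -> sobolev K c d v ->
  sobolev K c d (fun x => k * u x + v x).
Proof.
move=> su sv; have [Lu _] := su; have [Lv _] := sv.
split=> [|j jK]; first exact: L2_lin.
have [Lg ug] := weak_derivativeP su jK; have [Lh vh] := weak_derivativeP sv jK.
by exists (fun x => k * wd c d j u x + wd c d j v x);
  [exact: L2_lin|exact: weak_derivative_lin].
Qed.

Lemma wd_lin K c d k u v j : sobolev K c d u -> sobolev K c d v -> (j <= K)%N ->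
  {ae lebesgue_on c d, forall x,
    wd c d j (fun x => k * u x + v x) x = k * wd c d j u x + wd c d j v x}.
Proof.
move=> su sv jK; have [Lu _] := su; have [Lv _] := sv.
have [Lg ug] := weak_derivativeP su jK; have [Lh vh] := weak_derivativeP sv jK.
have [L w] := weak_derivativeP (sobolev_lin k su sv) jK.
apply: weak_derivative_unique w _ => //; first exact: L2_lin.
exact: weak_derivative_lin.
Qed.

End SobolevFunctions.

(** * Sine series *)

Section SineSeries.
Context {R : realType}.
Implicit Types (f g h F : R -> R) (n m k M : nat).

Local Notation mu := (@lebesgue_measure R).
Local Notation L01 := (L2 (0 : R) 1).
Local Notation ip01 := (ip (0 : R) 1).

Definition sn n (x : R) : R := Num.sqrt 2 * sin (n%:R * pi * x).
Definition cn n (x : R) : R := Num.sqrt 2 * cos (n%:R * pi * x).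

Lemma is_derive_mulk (k : R) (x : R) : is_derive x 1 (fun y => k * y) k.
Proof.
have H := is_deriveM (is_derive_cst k x (1 : R)) (is_derive_id x 1).
by apply: (is_derive_eq H); rewrite /= scaler0 addr0 /GRing.scale/= mulr1.
Qed.

Lemma is_derive_cmul (k : R) f (x f' : R) : is_derive x 1 f f' ->
  is_derive x 1 (fun y => k * f y) (k * f').
Proof.
move=> df; have H := is_deriveM (is_derive_cst k x (1 : R)) df.
by apply: (is_derive_eq H); rewrite /= scaler0 addr0.
Qed.

Lemma is_derive_sin_mul (k x : R) : is_derive x 1 (fun y => sin (k * y)) (cos (k * x) * k).
Proof. exact: is_derive1_comp (is_derive_sin _) (is_derive_mulk _ _). Qed.

Lemma is_derive_cos_mul (k x : R) : is_derive x 1 (fun y => cos (k * y)) (- sin (k * x) * k).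
Proof. exact: is_derive1_comp (is_derive_cos _) (is_derive_mulk _ _). Qed.

Lemma is_derive_sn n (x : R) : is_derive x 1 (sn n) (n%:R * pi * cn n x).
Proof.
apply: (is_derive_eq (is_derive_cmul (Num.sqrt 2) (is_derive_sin_mul (n%:R * pi) x))).
by rewrite /cn; ring.
Qed.

Lemma is_derive_cn n (x : R) : is_derive x 1 (cn n) (- (n%:R * pi) * sn n x).
Proof.
apply: (is_derive_eq (is_derive_cmul (Num.sqrt 2) (is_derive_cos_mul (n%:R * pi) x))).
by rewrite /sn; ring.
Qed.

Lemma sn_continuous n : continuous (sn n).
Proof. by apply: derivable_continuous => x; case: (is_derive_sn n x). Qed.

Lemma cn_continuous n : continuous (cn n).
Proof. by apply: derivable_continuous => x; case: (is_derive_cn n x). Qed.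

Lemma L2_sn c d n : L2 c d (sn n).
Proof. by apply: continuous_L2; exact: sn_continuous. Qed.

Lemma sin_natpi n : sin (n%:R * pi) = 0 :> R.
Proof.
elim: n => [|n IH]; first by rewrite mul0r sin0.
by rewrite -natr1 mulrDl mul1r sinDpi IH oppr0.
Qed.

Lemma sn_0 n : sn n 0 = 0. Proof. by rewrite /sn mulr0 sin0 mulr0. Qed.

Lemma sn_1 n : sn n 1 = 0. Proof. by rewrite /sn mulr1 sin_natpi mulr0. Qed.

Lemma sn0E x : sn 0 x = 0. Proof. by rewrite /sn !mul0r sin0 mulr0. Qed.

Lemma sqr_sqrt2 : Num.sqrt 2 * Num.sqrt 2 = 2 :> R.
Proof. by rewrite -expr2 sqr_sqrtr. Qed.

Lemma int_cos (k : R) : k != 0 -> sin k = 0 ->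
  (\int[lebesgue_on 0 1]_x cos (k * x))%R = 0.
Proof.
move=> k0 sk.
have D (x : R) : is_derive x 1 (fun x => k^-1 * sin (k * x)) (cos (k * x)).
  apply: (is_derive_eq (is_derive_cmul k^-1 (is_derive_sin_mul k x))).
  by field.
rewrite (FTC_lebesgue_on (@ler01 R) D).
  by rewrite mulr1 mulr0 sk sin0 subrr.
by apply: derivable_continuous => x; case: (is_derive_cos_mul k x).
Qed.

Lemma ip_sn n m : (0 < n)%N -> (0 < m)%N -> ip01 (sn n) (sn m) = (n == m)%:R.
Proof.
move=> n0 m0.
have cc (k : R) : continuous (fun x : R => cos (k * x)).
  by apply: derivable_continuous => x; case: (is_derive_cos_mul k x).
have -> : ip01 (sn n) (sn m) = (\int[lebesgue_on 0 1]_x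
    (cos ((n%:R * pi - m%:R * pi) * x) - cos ((n%:R * pi + m%:R * pi) * x)))%R.
  apply: eq_Rintegral => x _; rewrite /sn mulrACA sqr_sqrt2.
  rewrite (mulrBl x) (mulrDl (n%:R * pi) (m%:R * pi) x) cosB cosD; ring.
have ic (k : R) : (lebesgue_on 0 1).-integrable setT (EFin \o (fun x : R => cos (k * x))).
  by apply: L2_integrable; exact: continuous_L2.
rewrite RintegralB//.
have -> : (\int[lebesgue_on (0 : R) 1]_x cos ((n%:R * pi + m%:R * pi) * x))%R = 0.
  apply: int_cos; last by rewrite sinD !sin_natpi mul0r mulr0 addr0.
  by rewrite -mulrDl -natrD mulf_neq0 ?gt_eqF ?pi_gt0// ltr0n addn_gt0 n0.
rewrite subr0; have [->|nm] := eqVneq n m.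
  under eq_Rintegral do rewrite subrr mul0r cos0.
  by rewrite Rintegral_cst// lebesgue_on_setT ?ler01// subr0 mulr1.
apply: int_cos; last by rewrite sinB !sin_natpi mul0r mulr0 subr0.
rewrite -mulrBl mulf_neq0//; last by rewrite gt_eqF ?pi_gt0.
by rewrite subr_eq0 eqr_nat.
Qed.

Definition sine_sum f M x : R := \sum_(i < M) ip01 f (sn i.+1) * sn i.+1 x.

Lemma ip_sub_sqr c d f g : L2 c d f -> L2 c d g ->
  ip c d (fun x => f x - g x) (fun x => f x - g x) =
  ip c d f f - 2 * ip c d f g + ip c d g g.
Proof.
move=> Lf Lg; have LB := L2B Lf Lg.
rewrite ipBr// !ipBl// (ipC c d g f); ring.
Qed.

(** The remainder is orthogonal to the first M sines and satisfies Pythagoras'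
    identity; these facts are proved together because each step of the induction
    on M needs all of them. *)
Lemma sine_sum_spec f M : L01 f ->
  [/\ L01 (sine_sum f M),
      forall k, ip01 (fun x => f x - sine_sum f M x) (sn k.+1) =
        if (k < M)%N then 0 else ip01 f (sn k.+1) &
      ip01 (fun x => f x - sine_sum f M x) (fun x => f x - sine_sum f M x) =
        ip01 f f - \sum_(i < M) ip01 f (sn i.+1) ^+ 2].
Proof.
move=> Lf; elim: M => [|M [LS IHk IHs]].
  have -> : sine_sum f 0 = cst 0 by apply/funext => x; rewrite /sine_sum big_ord0.
  have -> : (fun x => f x - cst 0 x) = f by apply/funext => x; rewrite subr0.
  by rewrite big_ord0 subr0; split => //; exact: L20.
have LM := L2_sn 0 1 M.+1.
have LpM := L2Z (ip01 f (sn M.+1)) LM.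
have SE : sine_sum f M.+1 = (fun x => sine_sum f M x + ip01 f (sn M.+1) * sn M.+1 x).
  by apply/funext => x; rewrite /sine_sum big_ord_recr.
have fE : (fun x => f x - sine_sum f M.+1 x) =
    (fun x => (f x - sine_sum f M x) - ip01 f (sn M.+1) * sn M.+1 x).
  by apply/funext => x; rewrite SE opprD addrA.
have LfS := L2B Lf LS.
split.
- by rewrite SE; exact: L2D.
- move=> k; have Lk := L2_sn 0 1 k.+1.
  rewrite fE ipBl// IHk (ipZl _ LM Lk) ip_sn// eqSS ltnS eq_sym.
  by case: ltngtP => [kM|kM|->]; rewrite ?mulr0 ?subr0 ?mulr1 ?subrr.
- have := IHk M; rewrite ltnn => IHM.
  have LfSM := L2B LfS LpM.
  rewrite fE ip_sub_sqr// IHs (ipZr _ LM LfS) (ipZl _ LM LpM) (ipZr _ LM LM) IHM.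
  rewrite ip_sn// eqxx mulr1.
  by rewrite big_ord_recr/=; ring.
Qed.

Lemma bessel f M : L01 f -> \sum_(i < M) ip01 f (sn i.+1) ^+ 2 <= ip01 f f.
Proof.
move=> Lf; have [_ _ E] := sine_sum_spec M Lf.
by rewrite -subr_ge0 -E; exact: ip_ge0.
Qed.

Lemma ip_sine_sum f M : L01 f ->
  ip01 (sine_sum f M) (sine_sum f M) = \sum_(i < M) ip01 f (sn i.+1) ^+ 2.
Proof.
move=> Lf; have [LS Hk E] := sine_sum_spec M Lf.
have H N : (N <= M)%N -> ip01 (fun x => f x - sine_sum f M x) (sine_sum f N) = 0.
  elim: N => [|N IH] NM.
    have -> : sine_sum f 0 = (fun x => 0 * cst 0 x).
      by apply/funext => x; rewrite /sine_sum big_ord0 mul0r.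
    by rewrite ipZr ?mul0r//; [exact: L20|exact: L2B].
  have -> : sine_sum f N.+1 = (fun x => sine_sum f N x + ip01 f (sn N.+1) * sn N.+1 x).
    by apply/funext => x; rewrite /sine_sum big_ord_recr.
  have [LN _ _] := sine_sum_spec N Lf.
  have LM := L2_sn 0 1 N.+1; have LB := L2B Lf LS; have LZ := L2Z (ip01 f (sn N.+1)) LM.
  by rewrite ipDr// IH 1?ltnW// (ipZr _ LM LB) Hk NM mulr0 addr0.
have := H M (leqnn M); rewrite ipBl// => /eqP; rewrite subr_eq0 => /eqP fS.
move: E; rewrite ip_sub_sqr// fS => E.
lra.
Qed.

Lemma bessel_cvg f : L01 f ->
  cvgn (fun M => \sum_(i < M) ip01 f (sn i.+1) ^+ 2).
Proof.
move=> Lf; apply: nondecreasing_is_cvgn.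
  apply/nondecreasing_seqP => M; rewrite big_ord_recr/= lerDl; exact: sqr_ge0.
by exists (ip01 f f) => _ [M _ <-]; exact: bessel.
Qed.

(** By Bessel's inequality the squares of the coefficients are summable. *)
Lemma sine_coef_cvg0 f : L01 f -> ip01 f (sn n.+1) @[n --> \oo] --> (0 : R).
Proof.
move=> Lf; apply/cvgr0Pnorm_le => e e0.
have H : (fun n => ip01 f (sn n.+1) ^+ 2) @ \oo --> (0 : R).
  apply: cvg_series_cvg_0; have := bessel_cvg Lf.
  by under eq_fun do rewrite -(big_mkord xpredT (fun i => ip01 f (sn i.+1) ^+ 2)).
move/cvgr0Pnorm_le : H => /(_ _ (exprn_gt0 2 e0)).
apply: filterS => n; rewrite normrX => H.
by rewrite -(@ler_pXn2r _ 2) ?nnegrE// ltW.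
Qed.

(** One inequality is Bessel's; the other is Fatou's lemma applied to the squares
    of the partial sums. *)
Lemma parseval f : L01 f ->
  {ae lebesgue_on 0 1, forall x, sine_sum f M x @[M --> \oo] --> f x} ->
  \sum_(i < M) ip01 f (sn i.+1) ^+ 2 @[M --> \oo] --> ip01 f f.
Proof.
move=> Lf Sf; have cB := bessel_cvg Lf.
suff -> : ip01 f f = limn (fun M => \sum_(i < M) ip01 f (sn i.+1) ^+ 2) by [].
apply/eqP; rewrite eq_le; apply/andP; split; last first.
  by apply: limr_le => //; apply: nearW => M; exact: bessel.
have LS M : L01 (sine_sum f M) by have [] := sine_sum_spec M Lf.
have mS M : measurable_fun setT (sine_sum f M) by exact: L2_measurable (LS M).
have mSS M : measurable_fun setT (fun x => sine_sum f M x * sine_sum f M x).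
  exact: measurable_funM.
have mf := L2_measurable Lf.
have := @fatou _ _ _ (lebesgue_on 0 1) setT measurableT
  (fun M x => (sine_sum f M x * sine_sum f M x)%:E).
move=> H; have {H} := H _ _.
set L := (\int[_]_x _)%E; set L' := limn_einf _.
have -> : L' = (limn (fun M => \sum_(i < M) ip01 f (sn i.+1) ^+ 2))%:E.
  rewrite /L' (_ : (fun n => _) = (fun M => (\sum_(i < M) ip01 f (sn i.+1) ^+ 2)%:E)); last first.
    by apply/funext => M; rewrite EFin_ip// ip_sine_sum.
  have cE : (\sum_(i < M) ip01 f (sn i.+1) ^+ 2)%:E @[M --> \oo] -->
      (limn (fun M => \sum_(i < M) ip01 f (sn i.+1) ^+ 2))%:E.
    by apply: cvg_EFin; [exact: nearW|exact: cB].
  by rewrite is_cvg_limn_einfE; [apply/cvg_lim|apply/cvg_ex; eexists; exact: cE].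
have -> : L = (ip01 f f)%:E.
  rewrite -EFin_ip//; apply: ae_eq_integral => //.
  - apply: (@emeasurable_fun_cvg _ _ _ _
      (fun n x => einfs (fun M => (sine_sum f M x * sine_sum f M x)%:E) n)).
      by move=> n; apply: measurable_fun_einfs => M; exact/measurable_EFinP.
    by move=> x _; rewrite limn_einf_lim; exact: is_cvg_einfs.
  - by apply/measurable_EFinP; exact: measurable_funM.
  - apply: filterS Sf => x Sx _.
    have c2 : (sine_sum f M x * sine_sum f M x)%:E @[M --> \oo] --> (f x * f x)%:E.
      by apply: cvg_EFin; [exact: nearW|exact: cvgM].
    by rewrite is_cvg_limn_einfE; [apply/cvg_lim|apply/cvg_ex; eexists; exact: c2].
rewrite lee_fin; apply.
- by move=> M; apply/measurable_EFinP; exact: mSS.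
- by move=> M x _; rewrite lee_fin -expr2 sqr_ge0.
Qed.

Lemma sin_ge_cos (y m : R) : 0 <= y <= m -> m < pi / 2 -> y * cos m <= sin y.
Proof.
move=> /andP[y0 ym] mp.
have [c cy] := MVT_segment y0 (fun x _ => is_derive_sin x)
  (continuous_subspaceT (@continuous_sin R)).
rewrite sin0 !subr0 => ->; rewrite mulrC ler_wpM2r//.
move: cy; rewrite in_itv/= => /andP[c0 cy].
have p0 := @pi_gt0 R.
have cm : c <= m := le_trans cy ym.
move: cm; rewrite le_eqVlt => /predU1P[->//|cm].
by apply/ltW; rewrite ltr_cos// in_itv/=; apply/andP; split; lra.
Qed.

(** The difference of cosines is a product of two sines.  Up to a shift by pi / 2
    for the first, their arguments have absolute value at most pi m / 2 < pi / 2
    with m = max (x0, 1 - x0), where the cosine is at least c0. *)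
Lemma cos_separation (x0 : R) : 0 < x0 < 1 -> exists2 c : R, 0 < c &
  forall x, 0 < x < 1 -> c * `|x - x0| <= `|cos (pi * x) - cos (pi * x0)|.
Proof.
move=> /andP[x00 x01]; have p0 := @pi_gt0 R.
pose m := Num.max x0 (1 - x0); pose c0 := cos (pi * m / 2).
have mx : x0 <= m by rewrite le_max lexx.
have mx' : 1 - x0 <= m by rewrite le_max lexx orbT.
have m1 : m < 1 by rewrite gt_max x01/=; lra.
have m0 : 0 < m by lra.
have pm : 0 < pi * m by rewrite mulr_gt0.
have pm' : pi * m < pi by rewrite gtr_pMr.
have c00 : 0 < c0 by apply: cos_gt0_pihalf; apply/andP; split; lra.
exists (pi * c0 ^+ 2); first by rewrite mulr_gt0// exprn_gt0.
move=> x /andP[x0' x1].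
have -> : cos (pi * x) - cos (pi * x0) =
    - 2 * sin (pi * (x + x0) / 2) * sin (pi * (x - x0) / 2).
  rewrite (_ : pi * x = pi * (x + x0) / 2 + pi * (x - x0) / 2); last by field.
  rewrite (_ : pi * x0 = pi * (x + x0) / 2 - pi * (x - x0) / 2); last by field.
  rewrite cosD cosB; ring.
rewrite !normrM normrN (ger0_norm (_ : 0 <= 2 :> R))//.
have H1 : c0 <= `|sin (pi * (x + x0) / 2)|.
  apply: le_trans (ler_norm _).
  rewrite (_ : pi * (x + x0) / 2 = pi * (x + x0 - 1) / 2 + pi / 2); last by field.
  rewrite sinDpihalf -cos_norm.
  have yb : `|pi * (x + x0 - 1) / 2| <= pi * m / 2.
    rewrite !normrM (gtr0_norm p0) (@ger0_norm _ (2^-1))// ler_pM2r// ler_pM2l//.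
    by rewrite ler_norml; apply/andP; split; lra.
  move: yb; rewrite le_eqVlt => /predU1P[->//|yb].
  by apply/ltW; rewrite ltr_cos// in_itv/=; apply/andP; split; rewrite ?normr_ge0//; lra.
have H2 : pi * `|x - x0| / 2 * c0 <= `|sin (pi * (x - x0) / 2)|.
  have -> : `|sin (pi * (x - x0) / 2)| = `|sin (pi * `|x - x0| / 2)|.
    have [h|h] := ger0P (x - x0); first by [].
    by rewrite mulrN mulNr sinN normrN.
  apply: le_trans (ler_norm _).
  have xm : `|x - x0| <= m by rewrite ler_norml; apply/andP; split; lra.
  have xm' : pi * `|x - x0| <= pi * m by rewrite ler_pM2l.
  have xm0 : 0 <= pi * `|x - x0| by rewrite mulr_ge0// ltW.
  by apply: sin_ge_cos; [apply/andP; split|]; lra.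
have H0 : 0 <= pi * `|x - x0| / 2 * c0.
  by rewrite mulr_ge0 ?divr_ge0 ?mulr_ge0// ltW.
have := ler_pM (ltW c00) H0 H1 H2.
nra.
Qed.

Lemma sin_lip (k x y : R) : `|sin (k * x) - sin (k * y)| <= `|k| * `|x - y|.
Proof.
wlog xy : x y / y <= x.
  move=> H; have [yx|/ltW xy] := leP y x; first exact: H.
  by rewrite distrC (distrC x); exact: H.
have cs : continuous (fun z : R => sin (k * z)).
  by apply: derivable_continuous => z; case: (is_derive_sin_mul k z).
have [c _ ->] := MVT_segment xy (fun z _ => is_derive_sin_mul k z) (continuous_subspaceT cs).
by rewrite !normrM ler_wpM2r// ler_piMl// cos_max.
Qed.

Lemma lipschitz_continuous F (K : R) : (forall x y, `|F x - F y| <= K * `|x - y|) ->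
  continuous F.
Proof.
move=> FK x; apply/cvgrPdist_le => e e0.
have K0 : 0 < `|K| + 1 by rewrite ltr_wpDl.
near=> y.
apply: (le_trans (FK _ _)); apply: (@le_trans _ _ ((`|K| + 1) * `|x - y|)).
  by rewrite ler_wpM2r// ler_wpDr// ler_norm.
rewrite -ler_pdivlMl//.
near: y; apply: cvgr_dist_le; first exact: cvg_id.
by rewrite mulr_gt0// invr_gt0.
Unshelve. all: by end_near. Qed.

(** Pointwise convergence of the sine series of a Lipschitz function at an
    interior point x0: subtracting a multiple of sin (pi x), one divides by
    cos (pi x) - cos (pi x0); multiplication by this factor acts on the
    coefficients as a second difference, so that the partial sums at x0
    telescope to boundary terms which tend to 0 by Riemann-Lebesgue. *)
Lemma sine_sum_cvg F (K x0 : R) : (forall x y, `|F x - F y| <= K * `|x - y|) ->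
  0 < x0 < 1 -> sine_sum F M x0 @[M --> \oo] --> F x0.
Proof.
move=> FK x001; have cF := lipschitz_continuous FK.
have LF : L01 F by exact: continuous_L2.
have [c c0 sep] := cos_separation x001.
have p0 := @pi_gt0 R; have /andP[x00 x01] := x001.
have s1 : sn 1 x0 != 0.
  rewrite /sn mul1r mulf_neq0 ?gt_eqF// ?sqrtr_gt0// sin_gt0_pi//.
  by rewrite mulr_gt0//= gtr_pMr.
pose al := F x0 / sn 1 x0.
pose den x : R := cos (pi * x) - cos (pi * x0).
pose num x : R := F x - al * sn 1 x.
pose D : set R := `]0, x0[ `|` `]x0, 1[.
have D01 x : D x -> 0 < x < 1.
  case; rewrite /= in_itv/= => /andP[h1 h2]; first by rewrite h1 (lt_trans h2 x01).
  by rewrite (lt_trans x00 h1).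
have Dn x : D x -> x != x0 by case; rewrite /= in_itv/= => /andP[h1 h2]; [rewrite lt_eqF|rewrite gt_eqF].
have denN x : D x -> den x != 0.
  move=> Dx; have := sep x (D01 _ Dx); rewrite -/(den x) => H.
  rewrite -normr_gt0; apply: lt_le_trans H.
  by rewrite mulr_gt0// normr_gt0 subr_eq0 Dn.
pose h := (fun x => num x / den x) \_ D.
have cden : continuous den.
  move=> x; apply: cvgB; last exact: cvg_cst.
  by apply: derivable_continuous => z; case: (is_derive_cos_mul pi z).
have cnum : continuous num.
  by move=> x; apply: cvgB; [exact: cF|apply: cvgM; [exact: cvg_cst|exact: sn_continuous]].
have oD : open D by apply: openU; exact: interval_open.
have mh : measurable_fun setT h.
  apply/(measurable_restrictT _ _).1; first exact: open_measurable.
  apply: open_continuous_measurable_fun => // x /set_mem Dx.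
  apply: cvgM; first exact: cnum.
  by apply: cvgV; [exact: denN|exact: cden].
have K0 : 0 <= K.
  by have := le_trans (normr_ge0 _) (FK 0 1); rewrite sub0r normrN normr1 mulr1.
pose B : R := (K + `|al| * (Num.sqrt 2 * pi)) / c.
have hB x : `|h x| <= `|B|.
  rewrite /h patchE.
  case: ifPn => [/set_mem Dx|_]; last by rewrite normr0.
  apply: le_trans (ler_norm B).
  rewrite normrM normfV ler_pdivrMr ?normr_gt0 ?denN//.
  have H := sep x (D01 _ Dx); rewrite -/(den x) in H.
  apply: (@le_trans _ _ ((K + `|al| * (Num.sqrt 2 * pi)) * `|x - x0|)).
    rewrite (_ : num x = (F x - F x0) - al * (sn 1 x - sn 1 x0)); last first.
      by rewrite /num mulrBr /al divfK//; ring.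
    apply: (le_trans (ler_normB _ _)); rewrite mulrDl lerD//.
    rewrite normrM -[leRHS]mulrA; apply: ler_wpM2l => //.
    rewrite /sn -mulrBr normrM (ger0_norm (sqrtr_ge0 _)) -[leRHS]mulrA.
    apply: ler_wpM2l; first exact: sqrtr_ge0.
    by apply: le_trans (sin_lip _ _ _) _; rewrite mul1r gtr0_norm.
  have B0 : 0 <= B.
    by rewrite divr_ge0 ?(ltW c0)// addr_ge0// mulr_ge0// mulr_ge0 ?sqrtr_ge0// ltW.
  rewrite (_ : _ * `|x - x0| = B * (c * `|x - x0|)); last first.
    by rewrite /B; field; rewrite gt_eqF.
  exact: ler_wpM2l.
have Lh : L01 h by apply: (@L2_bounded R 0 1 `|B|).
have den0 : den x0 = 0 by rewrite /den subrr.
have Ldh : L01 (fun x => den x * h x).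
  have [Kd Hd] := continuous_bounded (continuous_subspaceT cden (A := `[0 : R, 1])).
  apply: (@L2_bounded R 0 1 (Kd * `|B|)).
    by apply: measurable_funM => //; exact: continuous_measurable.
  move=> x xI; have Hx := Hd x (subset_itv_oo_cc xI).
  by rewrite normrM; apply: ler_pM.
pose a n := ip01 h (sn n).
have coefE n : (0 < n)%N -> ip01 F (sn n) =
    al * (n == 1)%:R + 2^-1 * (a n.+1 + a n.-1) - cos (pi * x0) * a n.
  move=> n0; have Ln := L2_sn 0 1 n.
  have L1 := L2_sn 0 1 1; have La1 := L2Z al L1.
  transitivity (ip01 (fun x => al * sn 1 x + den x * h x) (sn n)).
    apply: ip_ae => //; [exact: L2D|apply/ae_lebesgue_on/nearW => x xI|exact: nearW].
    have [->|xx0] := eqVneq x x0; first by rewrite den0 mul0r addr0 /al divfK.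
    have Dx : D x.
      move: xI; rewrite in_itv/= => /andP[h1 h2]; have [h3|h3] := ltP x x0; [left|right].
        by rewrite /= in_itv/= h1.
      by rewrite /= in_itv/= lt_def xx0 h3.
    rewrite /h patchE mem_set//= [den x * _]mulrC divfK ?denN//.
    by rewrite /num addrC subrK.
  rewrite ipDl// (ipZl _ L1 Ln) ip_sn// eq_sym -addrA; congr (_ + _).
  have Lp := L2_sn 0 1 n.+1; have Lm := L2_sn 0 1 n.-1.
  transitivity (ip01 h (fun x => 2^-1 * (sn n.+1 x + sn n.-1 x) - cos (pi * x0) * sn n x)).
    apply: eq_Rintegral => x _; rewrite mulrAC mulrC; congr (_ * _).
    case: n n0 {Ln Lp Lm} => // n _; rewrite /den /sn /=.
    rewrite (_ : n.+2%:R * pi * x = n.+1%:R * pi * x + pi * x); last by rewrite -(@natr1 _ n.+1); ring.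
    rewrite (_ : n%:R * pi * x = n.+1%:R * pi * x - pi * x); last by rewrite -natr1; ring.
    by rewrite sinD sinB; field.
  have LD := L2D Lp Lm; have LZ := L2Z 2^-1 LD; have LZ' := L2Z (cos (pi * x0)) Ln.
  by rewrite ipBr// (ipZr _ LD Lh) (ipZr _ Ln Lh) ipDr.
pose d n : R := sn n x0 * a n.+1 - sn n.+1 x0 * a n.
have rec n : sn n.+2 x0 + sn n x0 = 2 * cos (pi * x0) * sn n.+1 x0.
  rewrite /sn.
  rewrite (_ : n.+2%:R * pi * x0 = n.+1%:R * pi * x0 + pi * x0); last by rewrite -(@natr1 _ n.+1); ring.
  rewrite (_ : n%:R * pi * x0 = n.+1%:R * pi * x0 - pi * x0); last by rewrite -natr1; ring.
  by rewrite sinD sinB; ring.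
have a0 : a 0%N = 0.
  rewrite /a (_ : sn 0 = (fun x => 0 * cst 0 x)).
    by rewrite ipZr ?mul0r//; exact: L20.
  by apply/funext => x; rewrite sn0E mul0r.
have SE M : sine_sum F M.+1 x0 = F x0 + 2^-1 * d M.+1.
  elim: M => [|M IH].
    rewrite /sine_sum big_ord1 coefE// eqxx /= a0 /d.
    have := rec 0%N; rewrite sn0E addr0 => ->.
    have Fal : F x0 = al * sn 1 x0 by rewrite /al divfK.
    by rewrite Fal mulr1n; field.
  rewrite /sine_sum big_ord_recr -/(sine_sum F M.+1 x0) IH coefE// eqSS mulr0 add0r /d /=.
  by have := rec M.+1 => e; rewrite (_ : sn M.+3 x0 = 2 * cos (pi * x0) * sn M.+2 x0 - sn M.+1 x0);
    [field|rewrite -e addrK].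
suff dc : d n.+1 @[n --> \oo] --> (0 : R).
  have H : F x0 + 2^-1 * d n.+1 @[n --> \oo] --> F x0 + 2^-1 * 0.
    by apply: cvgD; [exact: cvg_cst|apply: cvgM; [exact: cvg_cst|exact: dc]].
  rewrite mulr0 addr0 in H; rewrite -cvg_shiftS.
  by under eq_fun do rewrite /= SE.
have ac : a n.+1 @[n --> \oo] --> (0 : R) by exact: sine_coef_cvg0.
have ac2 : a n.+2 @[n --> \oo] --> (0 : R) by rewrite (cvg_shiftS (fun n => a n.+1)).
have snb n : `|sn n x0| <= Num.sqrt 2.
  by rewrite /sn normrM (ger0_norm (sqrtr_ge0 _)) ler_piMr ?sqrtr_ge0// sin_max.
have nc (u : nat -> R) : u @ \oo --> (0 : R) -> Num.sqrt 2 * `|u n| @[n --> \oo] --> (0 : R).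
  move=> u0; rewrite -(mulr0 (Num.sqrt 2)) -(normr0 R).
  by apply: cvgM; [exact: cvg_cst|exact: cvg_norm].
have bc : Num.sqrt 2 * `|a n.+2| + Num.sqrt 2 * `|a n.+1| @[n --> \oo] --> (0 : R).
  by rewrite -(addr0 (0 : R)); apply: cvgD; exact: nc.
have bcN : - (Num.sqrt 2 * `|a n.+2| + Num.sqrt 2 * `|a n.+1|) @[n --> \oo] --> (0 : R).
  have : - (Num.sqrt 2 * `|a n.+2| + Num.sqrt 2 * `|a n.+1|) @[n --> \oo] --> (- 0 : R).
    exact: cvgN.
  by rewrite oppr0.
apply: (squeeze_cvgr _ bcN bc); apply: nearW => n.
rewrite -ler_norml; apply: (le_trans (ler_normB _ _)).
by apply: lerD; rewrite normrM; apply: ler_wpM2r => //; exact: snb.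
Qed.

End SineSeries.

(** * Functions in H^1_0 *)

Section ClampedFunctions.
Context {R : realType}.
Implicit Types (c d : R) (f g h u v phi : R -> R).

Local Notation wd := weak_derivative.

Lemma L2norm_ae c d f g : L2 c d f -> L2 c d g ->
  {ae lebesgue_on c d, forall x, f x = g x} -> L2norm c d f = L2norm c d g.
Proof.
move=> Lf Lg fg; apply/eqP; rewrite -(@eqrXn2 _ 2) ?L2norm_ge0// !L2norm_sqr.
by apply/eqP; exact: ip_ae.
Qed.

Lemma L2norm_lin c d k f g : L2 c d f -> L2 c d g ->
  L2norm c d (fun x => k * f x + g x) <= `|k| * L2norm c d f + L2norm c d g.
Proof.
move=> Lf Lg; have Lk := L2Z k Lf.
rewrite -ler_sqr ?nnegrE ?addr_ge0 ?mulr_ge0 ?L2norm_ge0// L2norm_sqr.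
rewrite ipDl ?ipDr ?ipDr//; try exact: L2D.
rewrite (ipZl k Lf Lk) (ipZr k Lf Lf) (ipZl k Lf Lg) (ipZr k Lf Lg) (ipC c d g f).
rewrite sqrrD exprMn -!L2norm_sqr.
have h1 := ip_le Lf Lg.
have h2 : k * ip c d f g <= `|k| * (L2norm c d f * L2norm c d g).
  by apply: le_trans (ler_norm _) _; rewrite normrM ler_wpM2l.
rewrite real_normK ?num_real//; lra.
Qed.

Lemma L2norm_le_sobolev c d k u j : (j <= k)%N ->
  L2norm c d (wd c d j u) <= sobolev_norm k c d u.
Proof.
move=> jk; rewrite -[leLHS]ger0_norm ?L2norm_ge0// -sqrtr_sqr ler_wsqrtr//.
rewrite (bigD1 (Ordinal (jk : (j < k.+1)%N)))//= lerDl sumr_ge0// => i _.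
exact: sqr_ge0.
Qed.

Lemma sobolev_norm1_le c d u :
  sobolev_norm 1 c d u <= L2norm c d (wd c d 0 u) + L2norm c d (wd c d 1 u).
Proof.
have h0 := L2norm_ge0 c d (wd c d 0 u); have h1 := L2norm_ge0 c d (wd c d 1 u).
rewrite -[leRHS]ger0_norm ?addr_ge0// -sqrtr_sqr ler_wsqrtr//.
rewrite !big_ord_recr big_ord0/= add0r.
by have := mulr_ge0 h0 h1; rewrite sqrrD; lra.
Qed.

Lemma is_derive_smooth phi (x : R) : smooth phi -> is_derive x 1 phi (derive1 phi x).
Proof. by move=> sphi; rewrite derive1E; apply: derivableP; exact: smooth_derivable. Qed.

Lemma ip_smooth_parts c d f f' phi phi' : c <= d ->
  (forall x : R, is_derive x 1 f (f' x)) -> (forall x : R, is_derive x 1 phi (phi' x)) ->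
  continuous f' -> continuous phi' ->
  ip c d f' phi + ip c d f phi' = f d * phi d - f c * phi c.
Proof.
move=> cd df dphi cf' cphi'.
have cf : continuous f by apply: derivable_continuous => x; case: (df x).
have cphi : continuous phi by apply: derivable_continuous => x; case: (dphi x).
have L h : continuous h -> L2 c d h by exact: continuous_L2.
rewrite /ip -RintegralD//; [|by apply: integrable_L2_mul; exact: L..].
apply: (@FTC_lebesgue_on _ c d (fun x => f x * phi x) _ cd).
  move=> x; apply: (is_derive_eq (is_deriveM (df x) (dphi x))).
  by rewrite /GRing.scale/= addrC mulrC.
by move=> x; apply: cvgD; apply: cvgM; [exact: cf'|exact: cphi|exact: cf|exact: cphi'].
Qed.

Lemma test_weak_derivative c d phi : test_function c d phi ->
  is_weak_derivative c d 1 phi (derive1 phi).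
Proof.
move=> tphi psi tpsi; rewrite expr1 mulN1r.
have sphi := test_smooth tphi; have spsi := test_smooth tpsi.
have [cd|dc] := leP c d; last first.
  have E (f : R -> R) : continuous f -> (\int[lebesgue_on c d]_x f x)%R = 0.
    move=> cf; rewrite Rintegral_lebesgue_on; last exact: continuous_measurable.
    by rewrite set_itv_ge ?Rintegral_set0// bnd_simp -leNgt ltW.
  have cM (f g : R -> R) : continuous f -> continuous g -> continuous (fun x => f x * g x).
    by move=> cf cg x; apply: cvgM; [exact: cf|exact: cg].
  have cphi := smooth_continuous sphi; have cpsi := smooth_continuous spsi.
  have cphi1 := smooth_continuous (smooth_derive1 sphi).
  have cpsi1 := smooth_continuous (smooth_derive1 spsi).
  by rewrite (E _ (cM _ _ cphi cpsi1)) (E _ (cM _ _ cphi1 cpsi)) oppr0.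
have H := ip_smooth_parts cd (fun x => is_derive_smooth x sphi) (fun x => is_derive_smooth x spsi)
  (smooth_continuous (smooth_derive1 sphi)) (smooth_continuous (smooth_derive1 spsi)).
move: H; rewrite (test_out tphi (x := d)); last by rewrite in_itv/= ltxx andbF.
rewrite (test_out tphi (x := c)); last by rewrite in_itv/= ltxx.
by rewrite !mul0r subrr addrC => /eqP; rewrite addr_eq0 => /eqP.
Qed.

Lemma test_sobolev1 c d phi : test_function c d phi -> sobolev 1 c d phi.
Proof.
move=> tphi; have Lphi := test_L2 c d tphi; split => // -[|[|//]] _.
  by exists phi => // psi _; rewrite expr0 mul1r.
by exists (derive1 phi); [exact: test_L2 (test_derive1 tphi)|exact: test_weak_derivative].
Qed.

Lemma wd_test c d phi : test_function c d phi ->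
  {ae lebesgue_on c d, forall x, wd c d 1 phi x = derive1 phi x}.
Proof.
move=> tphi; have [L w] := weak_derivativeP (test_sobolev1 tphi) (leqnn 1).
apply: weak_derivative_unique w (test_weak_derivative tphi) => //.
exact: test_L2 (test_derive1 tphi).
Qed.

(** No boundary terms appear when integrating an H^1_0 function by parts: pass to
    the limit in the formula for test functions. *)
Lemma sobolev0_parts c d v phi phi' : c < d -> sobolev0 c d v ->
  (forall x : R, is_derive x 1 phi (phi' x)) -> continuous phi' ->
  ip c d (wd c d 1 v) phi = - ip c d v phi'.
Proof.
move=> cd [sv approx] dphi cphi'.
have cphi : continuous phi by apply: derivable_continuous => x; case: (dphi x).
have Lphi := continuous_L2 c d cphi; have Lphi' := continuous_L2 c d cphi'.
have Lv : L2 c d v by case: sv.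
have L1 := sobolev_L2wd sv (leqnn 1).
apply/eqP; rewrite -subr_eq0 opprK -normr_le0; apply/ler_addgt0Pl => e e0.
rewrite addr0; set n := L2norm c d phi + L2norm c d phi' + 1.
have n0 : 0 < n by rewrite ltr_wpDl// addr_ge0// L2norm_ge0.
have [th tth Hth] := approx (e / n) (divr_gt0 e0 n0).
have sth := test_smooth tth.
have Lth := test_L2 c d tth; have Lth' := test_L2 c d (test_derive1 tth).
have P0 : ip c d (derive1 th) phi + ip c d th phi' = 0.
  rewrite (ip_smooth_parts (ltW cd) (fun x => is_derive_smooth x sth) dphi
    (smooth_continuous (smooth_derive1 sth)) cphi').
  rewrite (test_out tth (x := d)); last by rewrite in_itv/= ltxx andbF.
  rewrite (test_out tth (x := c)); last by rewrite in_itv/= ltxx.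
  by rewrite !mul0r subrr.
have uE : v \- th = (fun x => -1 * th x + v x).
  by apply/funext => x /=; rewrite mulN1r addrC.
have s1 := test_sobolev1 tth.
have ae1 : {ae lebesgue_on c d, forall x, wd c d 1 (v \- th) x = wd c d 1 v x - derive1 th x}.
  rewrite uE; have h1 := wd_lin (-1) s1 sv (leqnn 1); have h2 := wd_test tth.
  by apply: filterS2 h1 h2 => x -> ->; rewrite mulN1r addrC.
have su := sobolev_lin (-1) s1 sv; rewrite -uE in su.
have ae0 := wd0_ae su.
have LB1 := L2B L1 Lth'; have LB0 := L2B Lv Lth.
have -> : ip c d (wd c d 1 v) phi + ip c d v phi' =
   ip c d (fun x => wd c d 1 v x - derive1 th x) phi + ip c d (fun x => v x - th x) phi'.
  by rewrite !ipBl//; lra.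
have n1 : L2norm c d (fun x => wd c d 1 v x - derive1 th x) <= e / n.
  rewrite -(L2norm_ae (sobolev_L2wd su (leqnn 1)) LB1 ae1).
  by apply: le_trans (ltW Hth); exact: L2norm_le_sobolev.
have n2 : L2norm c d (fun x => v x - th x) <= e / n.
  rewrite -(L2norm_ae (sobolev_L2wd su (leq0n 1)) LB0 ae0).
  by apply: le_trans (ltW Hth); exact: L2norm_le_sobolev.
apply: le_trans (ler_normD _ _) _.
apply: le_trans (lerD (ip_le LB1 Lphi) (ip_le LB0 Lphi')) _.
apply: (@le_trans _ _ (e / n * L2norm c d phi + e / n * L2norm c d phi')).
  by apply: lerD; apply: ler_wpM2r => //; exact: L2norm_ge0.
have -> : e = e / n * n by rewrite divfK ?gt_eqF.
rewrite -mulrDr mulfK ?gt_eqF// ler_wpM2l ?divr_ge0 ?ltW//.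
by rewrite /n ltrDl.
Qed.

(** The same linear combination of approximating test functions is close to the
    given one, by the triangle inequality for the derivatives of order 0 and 1. *)
Lemma sobolev0_lin c d k u v : sobolev0 c d u -> sobolev0 c d v ->
  sobolev0 c d (fun x => k * u x + v x).
Proof.
move=> [su au] [sv av]; split; first exact: sobolev_lin.
move=> e e0; set n := 2 * (`|k| + 1).
have n0 : 0 < n by rewrite mulr_gt0// ltr_wpDl.
have [th1 t1 H1] := au _ (divr_gt0 e0 n0).
have [th2 t2 H2] := av _ (divr_gt0 e0 n0).
exists (fun x => k * th1 x + th2 x); first exact: test_lin.
have s1 := test_sobolev1 t1; have s2 := test_sobolev1 t2.
have E w th : w \- th = (fun x => -1 * th x + w x) :> (R -> R).
  by apply/funext => x /=; rewrite mulN1r addrC.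
have sd1 := sobolev_lin (-1) s1 su; have sd2 := sobolev_lin (-1) s2 sv.
rewrite -!E in sd1 sd2.
rewrite (_ : _ \- _ = (fun x => k * (u \- th1) x + (v \- th2) x)); last first.
  by apply/funext => x /=; ring.
have b j : (j <= 1)%N -> L2norm c d (wd c d j (fun x => k * (u \- th1) x + (v \- th2) x)) <=
    `|k| * sobolev_norm 1 c d (u \- th1) + sobolev_norm 1 c d (v \- th2).
  move=> j1; have La := sobolev_L2wd sd1 j1; have Lb := sobolev_L2wd sd2 j1.
  rewrite (L2norm_ae (sobolev_L2wd (sobolev_lin k sd1 sd2) j1) (L2_lin k La Lb) (wd_lin k sd1 sd2 j1)).
  apply: le_trans (L2norm_lin _ La Lb) _; apply: lerD; last exact: L2norm_le_sobolev.
  by apply: ler_wpM2l => //; exact: L2norm_le_sobolev.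
apply: le_lt_trans (sobolev_norm1_le _ _ _) _.
apply: le_lt_trans (lerD (b 0%N isT) (b 1%N isT)) _.
have en : e = 2 * (`|k| * (e / n) + e / n).
  by rewrite -[X in _ + X]mul1r -mulrDl mulrA mulrC divfK// gt_eqF.
rewrite [ltRHS]en mulr_natl mulr2n; have h1 := ler_wpM2l (normr_ge0 k) (ltW H1).
by apply: ltrD; exact: ler_ltD.
Qed.

End ClampedFunctions.

(** * Restriction to a subinterval *)

Section Restriction.
Context {R : realType}.
Implicit Types (c d : R) (f g h u v phi : R -> R).

Local Notation mu := (@lebesgue_measure R).
Local Notation wd := weak_derivative.

Lemma indic_itv c d (x : R) : \1_`]c, d[ x = (x \in `]c, d[)%:R :> R.
Proof.
rewrite indicE; congr (nat_of_bool _)%:R.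
by apply/idP/idP => [/set_mem//|?]; exact/mem_set.
Qed.

Lemma Rintegral_restrict c d c' d' f : c <= c' -> d' <= d -> measurable_fun setT f ->
  (\int[lebesgue_on c d]_x (f x * \1_`]c', d'[ x) = \int[lebesgue_on c' d']_x f x)%R.
Proof.
move=> cc dd mf; rewrite !Rintegral_lebesgue_on//; last first.
  by apply: measurable_funM => //; exact: measurable_indic.
rewrite [LHS]Rintegral_mkcond [RHS]Rintegral_mkcond.
apply: eq_Rintegral => x _; rewrite !patchE.
have E b1 b2 : (x \in [set` `]b1, b2[]) = (x \in `]b1, b2[).
  by apply/idP/idP => [/set_mem//|?]; exact/mem_set.
rewrite !E indic_itv; case: (boolP (x \in `]c', d'[)) => [xI|xI]; last by rewrite mulr0 if_same.
rewrite mulr1; case: ifP => // /negP; rewrite in_itv/= => -[].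
move: xI; rewrite in_itv/= => /andP[h1 h2].
by rewrite (le_lt_trans cc h1) (lt_le_trans h2 dd).
Qed.

Lemma itv_mono c d c' d' : c <= c' -> d' <= d -> (`]c', d'[ : set R) `<=` `]c, d[.
Proof.
move=> cc dd x /=; rewrite !in_itv/= => /andP[h1 h2].
by rewrite (le_lt_trans cc h1) (lt_le_trans h2 dd).
Qed.

Lemma measurable_indic_itv c d : measurable_fun setT (\1_`]c, d[ : R -> R).
Proof. exact: measurable_indic. Qed.

Lemma L2_ext c d c' d' f : c <= c' -> d' <= d -> L2 c' d' f ->
  L2 c d (fun x => f x * \1_`]c', d'[ x).
Proof.
move=> cc dd Lf; have mf := L2_measurable Lf.
have mI := measurable_indic_itv c' d'.
have m1 : measurable_fun setT (fun x => f x * \1_`]c', d'[ x) by exact: measurable_funM.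
have m2 : measurable_fun setT (fun x => (f x * \1_`]c', d'[ x) * (f x * \1_`]c', d'[ x)).
  exact: measurable_funM.
apply/L2P; split => //; apply/integrableP; split; first exact/measurable_EFinP.
have /integrableP[_] := integrable_L2_mul Lf Lf.
have mn1 : measurable_fun setT (fun x : R => `|(f x * f x)%:E|%E).
  by apply: measurableT_comp => //; apply/measurable_EFinP; exact: measurable_funM.
have mn2 : measurable_fun setT (fun x : R =>
    `|((f x * \1_`]c', d'[ x) * (f x * \1_`]c', d'[ x))%:E|%E).
  by apply: measurableT_comp => //; exact/measurable_EFinP.
rewrite (integral_lebesgue_on c d mn2) (integral_lebesgue_on c' d' mn1).
apply: le_lt_trans; rewrite le_eqVlt; apply/orP; left; apply/eqP.
rewrite [LHS]integral_mkcond [RHS]integral_mkcond.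
apply: eq_integral => x _; rewrite !patchE.
have E b1 b2 : (x \in [set` `]b1, b2[]) = (x \in `]b1, b2[).
  by apply/idP/idP => [/set_mem//|?]; exact/mem_set.
rewrite !E /= indic_itv; case: (boolP (x \in `]c', d'[)) => [xI|xI].
  rewrite mulr1; case: ifP => // /negP; rewrite in_itv/= => -[].
  move: xI; rewrite in_itv/= => /andP[h1 h2].
  by rewrite (le_lt_trans cc h1) (lt_le_trans h2 dd).
by rewrite !mulr0 normr0 if_same.
Qed.

Lemma L2_restrict c d c' d' f : c <= c' -> d' <= d -> L2 c d f -> L2 c' d' f.
Proof.
move=> cc dd Lf; have mf := L2_measurable Lf.
have mff : measurable_fun setT (fun x => f x * f x) by exact: measurable_funM.
apply/L2P; split => //; apply/integrableP; split; first exact/measurable_EFinP.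
have mn : measurable_fun setT (fun x : R => `|(f x * f x)%:E|%E).
  by apply: measurableT_comp => //; exact/measurable_EFinP.
have /integrableP[_] := integrable_L2_mul Lf Lf.
rewrite !integral_lebesgue_on//; apply: le_lt_trans.
apply: ge0_subset_integral => //; last exact: itv_mono.
exact: measurable_funTS.
Qed.

Lemma ip_ext c d c' d' f h : c <= c' -> d' <= d -> L2 c' d' f -> measurable_fun setT h ->
  ip c d (fun x => f x * \1_`]c', d'[ x) h = ip c' d' f h.
Proof.
move=> cc dd Lf mh; rewrite /ip -(Rintegral_restrict cc dd); last first.
  by apply: measurable_funM => //; exact: L2_measurable Lf.
by apply: eq_Rintegral => x _; rewrite mulrAC.
Qed.

Lemma ae_neq c d (a : R) : {ae lebesgue_on c d, forall x, x != a}.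
Proof.
apply/ae_lebesgue_on; exists [set a]; split => //; first exact: lebesgue_measure_set1.
by move=> x /= H; apply/eqP/negPn/negP => xa; apply: H => _.
Qed.

(** The point a itself is negligible. *)
Lemma ip_split c d (a : R) f h : c <= a -> a <= d -> L2 c d f -> L2 c d h ->
  ip c d f h = ip c a f h + ip a d f h.
Proof.
move=> ca ad Lf Lh.
have L1 := L2_restrict (lexx c) ad Lf; have L2' := L2_restrict ca (lexx d) Lf.
have E1 := L2_ext (lexx c) ad L1; have E2 := L2_ext ca (lexx d) L2'.
have mh := L2_measurable Lh.
rewrite -(ip_ext (lexx c) ad L1 mh) -(ip_ext ca (lexx d) L2' mh) -ipDl//.
apply: ip_ae => //; [exact: L2D| |exact: nearW].
have := ae_neq c d a => /ae_lebesgue_on H; apply/ae_lebesgue_on; move: H.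
apply: filterS; first exact: (ae_filter_ringOfSetsType mu).
move=> x /= H xI; have xa := H xI.
move: xI; rewrite !indic_itv !in_itv/= => /andP[-> ->]; rewrite andbT/=.
by case: ltgtP xa => // _ _; rewrite mulr1 mulr0 ?addr0 ?add0r.
Qed.

Lemma test_mono c d c' d' phi : c <= c' -> d' <= d ->
  test_function c' d' phi -> test_function c d phi.
Proof.
move=> cc dd [s k sub]; split => //; apply: subset_trans sub _.
exact: itv_mono.
Qed.

Lemma weak_derivative_restrict c d c' d' k u g : c <= c' -> d' <= d ->
  L2 c d u -> L2 c d g ->
  is_weak_derivative c d k u g -> is_weak_derivative c' d' k u g.
Proof.
move=> cc dd Lu Lg ug phi tphi.
have E w psi : L2 c d w -> test_function c' d' psi ->
    (\int[lebesgue_on c' d']_x (w x * psi x) = \int[lebesgue_on c d]_x (w x * psi x))%R.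
  move=> Lw tpsi; rewrite -(Rintegral_restrict cc dd); last first.
    apply: measurable_funM; first exact: L2_measurable Lw.
    exact: L2_measurable (test_L2 c d tpsi).
  apply: eq_Rintegral => x _; rewrite indic_itv.
  have [xI|xI] := boolP (x \in `]c', d'[); first by rewrite mulr1.
  by rewrite (test_out tpsi xI) !mulr0.
rewrite !E//; last exact: test_derive1n.
by apply: ug; exact: test_mono tphi.
Qed.

Lemma wd_restrict c d c' d' k u j K : c <= c' -> d' <= d ->
  sobolev k c d u -> (j <= k)%N -> sobolev K c' d' u -> (j <= K)%N ->
  {ae lebesgue_on c' d', forall x, wd c d j u x = wd c' d' j u x}.
Proof.
move=> cc dd su jk su' jK.
have [L w] := weak_derivativeP su jk; have [L' w'] := weak_derivativeP su' jK.
apply: weak_derivative_unique w' => //; first exact: L2_restrict L.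
by apply: weak_derivative_restrict w => //; case: su.
Qed.

End Restriction.

(** * The beam operator *)

Section BeamOperator.
Context {R : realType}.
Variable a : R.
Hypothesis a01 : 0 < a < 1.
Implicit Types (u v phi : R -> R) (z : beam_state R).

Local Notation wd := weak_derivative.
Local Notation ip01 := (ip (0 : R) 1).

Let a0 : 0 < a. Proof. by case/andP : a01. Qed.
Let a1 : a < 1. Proof. by case/andP : a01. Qed.

(** The function representing - u_xxxx - v(a) delta_a: on the domain the mass that
    - u_xxxx has at a, minus the jump of u_xxx, cancels the one of - v(a) delta_a. *)
Definition beam_force u (x : R) : R :=
  - 1 * (wd 0 a 4 u x * \1_`]0, a[ x + wd a 1 4 u x * \1_`]a, 1[ x).

Lemma beam_force_L2 u : sobolev 4 0 a u -> sobolev 4 a 1 u -> L2 0 1 (beam_force u).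
Proof.
move=> s1 s2; apply: L2Z; apply: L2D.
  exact: (L2_ext (lexx 0) (ltW a1) (sobolev_L2wd s1 (leqnn 4))).
exact: (L2_ext (ltW a0) (lexx 1) (sobolev_L2wd s2 (leqnn 4))).
Qed.

Lemma ip_beam_force u h : sobolev 4 0 a u -> sobolev 4 a 1 u -> L2 0 1 h ->
  ip01 (beam_force u) h = - (ip 0 a (wd 0 a 4 u) h + ip a 1 (wd a 1 4 u) h).
Proof.
move=> s1 s2 Lh.
have L1 := sobolev_L2wd s1 (leqnn 4); have L2' := sobolev_L2wd s2 (leqnn 4).
have E1 := L2_ext (lexx 0) (ltW a1) L1; have E2 := L2_ext (ltW a0) (lexx 1) L2'.
have mh := L2_measurable Lh.
rewrite (ipZl (-1) (L2D E1 E2) Lh) ipDl//.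
rewrite (ip_ext (lexx 0) (ltW a1) L1 mh) (ip_ext (ltW a0) (lexx 1) L2' mh).
by rewrite mulN1r.
Qed.

Lemma ip_beam_force_sqr u : sobolev 4 0 a u -> sobolev 4 a 1 u ->
  ip01 (beam_force u) (beam_force u) =
  L2norm 0 a (wd 0 a 4 u) ^+ 2 + L2norm a 1 (wd a 1 4 u) ^+ 2.
Proof.
move=> s1 s2; have Lf := beam_force_L2 s1 s2.
have L1 := sobolev_L2wd s1 (leqnn 4); have L2' := sobolev_L2wd s2 (leqnn 4).
rewrite !L2norm_sqr ip_beam_force// opprD.
have L1' := L2Z (-1) L1; have L2'' := L2Z (-1) L2'.
have Lfl := L2_restrict (lexx 0) (ltW a1) Lf.
have Lfr := L2_restrict (ltW a0) (lexx 1) Lf.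
congr (_ + _).
  rewrite (@ip_ae _ _ _ _ (wd 0 a 4 u) _ (fun x => -1 * wd 0 a 4 u x))//; [|exact: nearW|].
    by rewrite (ipZr _ L1 L1) mulN1r opprK.
  apply/ae_lebesgue_on/nearW => x xI; rewrite /beam_force !indic_itv xI mulr1.
  rewrite [x \in `]a, 1[]in_itv/=; move: xI; rewrite in_itv/= => /andP[_ xa].
  by rewrite ltNge (ltW xa)/= mulr0 addr0.
rewrite (@ip_ae _ _ _ _ (wd a 1 4 u) _ (fun x => -1 * wd a 1 4 u x))//; [|exact: nearW|].
  by rewrite (ipZr _ L2' L2') mulN1r opprK.
apply/ae_lebesgue_on/nearW => x xI; rewrite /beam_force !indic_itv xI mulr1.
rewrite [x \in `]0, a[]in_itv/=; move: xI; rewrite in_itv/= => /andP[ax _].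
by rewrite [x < a]ltNge (ltW ax)/= andbF mulr0 add0r.
Qed.

(** Two integrations by parts on each side of a.  The conditions u''(0) = u''(1) = 0
    and the continuity of u'' at a remove the terms with phi', and the jump of u'''
    leaves - v(a) phi(a). *)
Lemma beam_green z phi phi1 phi2 : A3_domain a z ->
  (forall x : R, is_derive x 1 phi (phi1 x)) -> (forall x : R, is_derive x 1 phi1 (phi2 x)) ->
  continuous phi2 -> phi 0 = 0 -> phi 1 = 0 ->
  ip01 (beam_force z.1) phi = - value_at 0 1 0 z.2 a * phi a - ip01 (wd 0 1 2 z.1) phi2.
Proof.
move=> [[[V3u s1 s2 b0 b1] V3v] j2 j3] d1 d2 cphi2 p0 p1.
have cphi1 : continuous phi1 by apply: derivable_continuous => x; case: (d2 x).
have cphi : continuous phi by apply: derivable_continuous => x; case: (d1 x).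
have Lphi := continuous_L2 0 1 cphi; have Lphi2 := continuous_L2 0 1 cphi2.
have su := V3u.2; have LU := sobolev_L2wd su (leqnn 2).
rewrite ip_beam_force//.
rewrite (@ip_green R 0 a 4 z.1 3 _ _ a0 s1 isT d1 cphi1) (@ip_green R 0 a 4 z.1 2 _ _ a0 s1 isT d2 cphi2).
rewrite (@ip_green R a 1 4 z.1 3 _ _ a1 s2 isT d1 cphi1) (@ip_green R a 1 4 z.1 2 _ _ a1 s2 isT d2 cphi2).
rewrite p0 p1 b0 b1 j2.
rewrite (ip_split (ltW a0) (ltW a1) LU Lphi2).
have r1 := wd_restrict (lexx 0) (ltW a1) su (leqnn 2) s1 (isT : (2 <= 4)%N).
have r2 := wd_restrict (ltW a0) (lexx 1) su (leqnn 2) s2 (isT : (2 <= 4)%N).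
have E1 : ip 0 a (wd 0 1 2 z.1) phi2 = ip 0 a (wd 0 a 2 z.1) phi2.
  apply: ip_ae r1 _; [|exact: sobolev_L2wd s1 _|exact: continuous_L2|exact: continuous_L2|exact: nearW].
  exact: (L2_restrict (lexx 0) (ltW a1) LU).
have E2 : ip a 1 (wd 0 1 2 z.1) phi2 = ip a 1 (wd a 1 2 z.1) phi2.
  apply: ip_ae r2 _; [|exact: sobolev_L2wd s2 _|exact: continuous_L2|exact: continuous_L2|exact: nearW].
  exact: (L2_restrict (ltW a0) (lexx 1) LU).
rewrite E1 E2 -j3; ring.
Qed.

(** Tested against bumps, both functions give the defining distribution. *)
Lemma A3_force z : A3_domain a z ->
  L2 0 1 (A3 a z).2 /\ {ae lebesgue_on 0 1, forall x, (A3 a z).2 x = beam_force z.1 x}.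
Proof.
move=> Dz; have [[[V3u s1 s2 b0 b1] V3v] j2 j3] := Dz.
have Lf := beam_force_L2 s1 s2.
have su := V3u.2; have [LU wU] := weak_derivativeP su (leqnn 2).
have dist phi : test_function 0 1 phi -> ip01 (beam_force z.1) phi = A3_distribution a z phi.
  move=> tphi; have sphi := test_smooth tphi; have sphi1 := smooth_derive1 sphi.
  have sphi2 := smooth_derive1 sphi1.
  have d1 (x : R) : is_derive x 1 phi (derive1 phi x) by exact: is_derive_smooth.
  have d2 (x : R) : is_derive x 1 (derive1 phi) (derive1 (derive1 phi) x).
    exact: is_derive_smooth.
  have p0 : phi 0 = 0 by rewrite (test_out tphi)// in_itv/= ltxx.
  have p1 : phi 1 = 0 by rewrite (test_out tphi)// in_itv/= ltxx andbF.
  rewrite (beam_green Dz d1 d2 (smooth_continuous sphi2) p0 p1).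
  have := wU _ (test_derive1n 2 tphi); rewrite sqrrN expr1n mul1r => W.
  have W' : ip01 (wd 0 1 2 z.1) (derive1 (derive1 phi)) =
      (\int[lebesgue_on 0 1]_x (z.1 x * derive1n 4 phi x))%R by exact: esym W.
  by rewrite /A3_distribution W' mulNr addrC.
rewrite /A3/=; set P := [set f | _].
have [L E] : P (xget (fun=> 0) P).
  by apply: xgetPex; exists (beam_force z.1); split => // phi /dist.
split => //; apply: ip_bump_eq => // al be n ca bd.
have t := bump_test n ca bd.
by rewrite dist//; exact: E.
Qed.

End BeamOperator.

(** * Sums over the gaps between squares *)

Section NumericalSums.
Context {R : realType}.

Definition root4 (n : nat) : R := Num.sqrt (Num.sqrt n%:R).

Lemma root4_ge0 n : 0 <= root4 n. Proof. exact: sqrtr_ge0. Qed.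

Lemma root4X2 n : root4 n ^+ 2 = Num.sqrt n%:R.
Proof. by rewrite sqr_sqrtr// sqrtr_ge0. Qed.

Lemma root4X4 n : root4 n ^+ 4 = n%:R.
Proof. by rewrite (exprM _ 2 2) root4X2 sqr_sqrtr. Qed.

Lemma root4_le n m : (n <= m)%N -> root4 n <= root4 m.
Proof. by move=> nm; rewrite /root4 !ler_wsqrtr// ler_nat. Qed.

Lemma root4_1 : root4 1 = 1. Proof. by rewrite /root4 !sqrtr1. Qed.

Lemma root4_ge1 n : 1 <= root4 n.+1.
Proof. by rewrite -root4_1; exact: root4_le. Qed.

(** Comparison with a telescoping sum: for a <= b and b^4 = a^4 + 1, the term
    1 / b^5 is at most 4 / a - 4 / b. *)
Lemma sum_root4 K : \sum_(i < K) (i.+1%:R * root4 i.+1)^-1 <= 5.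
Proof.
suff H k : \sum_(i < k.+1) (i.+1%:R * root4 i.+1)^-1 <= 5 - 4 / root4 k.+1.
  case: K => [|K]; first by rewrite big_ord0.
  by apply: le_trans (H K) _; rewrite gerBl divr_ge0// root4_ge0.
elim: k => [|k IH]; first by rewrite big_ord1 root4_1 mul1r invr1; lra.
rewrite big_ord_recr/=.
set a := root4 k.+1 in IH *; set b := root4 k.+2.
have a1 : 1 <= a by exact: root4_ge1.
have ab : a <= b by exact: root4_le.
have b4 : b ^+ 4 = a ^+ 4 + 1 by rewrite !root4X4 natr1.
rewrite -(root4X4 k.+2) -/b.
suff H : (b ^+ 4 * b)^-1 <= 4 / a - 4 / b by lra.
have a0 : 0 < a by lra.
have b0 : 0 < b by lra.
have -> : 4 / a - 4 / b = 4 * (b - a) / (a * b) by field; rewrite !gt_eqF.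
rewrite ler_pdivlMr ?mulr_gt0// mulrC ler_pdivrMr ?mulr_gt0 ?exprn_gt0//.
have E : (b - a) * (b + a) * (b ^+ 2 + a ^+ 2) = 1 by have := b4; lra.
have le3 : (b + a) * (b ^+ 2 + a ^+ 2) <= 4 * b ^+ 3.
  have h1 : b + a <= 2 * b by lra.
  have h2 : b ^+ 2 + a ^+ 2 <= 2 * b ^+ 2 by have := lerXn2r 2 (ltW a0) (ltW b0) ab; lra.
  have -> : 4 * b ^+ 3 = 2 * b * (2 * b ^+ 2) by ring.
  by apply: ler_pM => //; [lra|rewrite addr_ge0 ?sqr_ge0].
have h1 : 1 <= (b - a) * (4 * b ^+ 3).
  by rewrite -{1}E -mulrA ler_wpM2l// subr_ge0.
have : b * 1 <= b * ((b - a) * (4 * b ^+ 3)) by rewrite ler_pM2l.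
have -> : 4 * (b - a) * (b ^+ 4 * b) = b * (b * ((b - a) * (4 * b ^+ 3))) by ring.
move=> h2; rewrite mulrC ler_wpM2l ?(ltW b0)//; lra.
Qed.

(** The same comparison, with 1 / b^3 <= 2 / a - 2 / b when b^2 = a^2 + 1. *)
Lemma sum_sqrt3 K : \sum_(i < K) (Num.sqrt i.+1%:R ^+ 3)^-1 <= 3 :> R.
Proof.
suff H k : \sum_(i < k.+1) (Num.sqrt i.+1%:R ^+ 3)^-1 <= 3 - 2 / Num.sqrt k.+1%:R :> R.
  case: K => [|K]; first by rewrite big_ord0.
  by apply: le_trans (H K) _; rewrite gerBl divr_ge0// sqrtr_ge0.
elim: k => [|k IH]; first by rewrite big_ord1 sqrtr1 expr1n invr1; lra.
rewrite big_ord_recr/=.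
set a := Num.sqrt k.+1%:R in IH *; set b := Num.sqrt k.+2%:R.
have a1 : 1 <= a by rewrite -sqrtr1 ler_wsqrtr// ler1n.
have ab : a <= b by rewrite ler_wsqrtr// ler_nat.
have b2 : b ^+ 2 = a ^+ 2 + 1 by rewrite !sqr_sqrtr ?natr1.
suff H : (b ^+ 3)^-1 <= 2 / a - 2 / b by lra.
have a0 : 0 < a by lra.
have b0 : 0 < b by lra.
have -> : 2 / a - 2 / b = 2 * (b - a) / (a * b) by field; rewrite !gt_eqF.
rewrite ler_pdivlMr ?mulr_gt0// mulrC ler_pdivrMr ?exprn_gt0//.
have E : (b - a) * (b + a) = 1 by have := b2; lra.
have h1 : 1 <= (b - a) * (2 * b).
  by rewrite -{1}E ler_wpM2l ?subr_ge0//; lra.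
have : b * 1 <= b * ((b - a) * (2 * b)) by rewrite ler_pM2l.
have -> : 2 * (b - a) * b ^+ 3 = b * (b * ((b - a) * (2 * b))) by ring.
move=> h2; rewrite mulrC ler_wpM2l ?(ltW b0)//; lra.
Qed.

(** Indices start at 0, so that the frequency numbers are i + 1 and j + 1. *)
Definition gap (i j : nat) : R :=
  if i == j then 0 else `|j.+1%:R ^+ 2 - i.+1%:R ^+ 2|^-1.

Lemma gap_ge0 i j : 0 <= gap i j.
Proof. by rewrite /gap; case: ifP => // _; rewrite invr_ge0. Qed.

Lemma gapC i j : gap i j = gap j i.
Proof. by rewrite /gap eq_sym distrC. Qed.

(** In m^2 - n^2 = (m - n) (m + n) the factor m + n is split as
    (m + n)^(3/4) (m + n)^(1/4): the first part is kept for the fixed index, and the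
    second makes the sum over the other one converge. *)
Lemma gap_le i j : (i < j)%N ->
  forall m, (m <= j)%N -> (i <= m)%N -> (m == i) || (m == j) ->
  gap i j <= (root4 m.+1 ^+ 3)^-1 * ((j - i)%:R * root4 (j - i))^-1.
Proof.
move=> ij m mj im mij; rewrite /gap lt_eqF//.
have ijR : i%:R < j%:R :> R by rewrite ltr_nat.
have kE : (j - i)%:R = j%:R - i%:R :> R by rewrite natrB// ltnW.
have k0 : (0 < j - i)%N by rewrite subn_gt0.
have i0 : 0 <= i%:R :> R by [].
have E : `|j.+1%:R ^+ 2 - i.+1%:R ^+ 2| = (j - i)%:R * (j.+1 + i.+1)%:R :> R.
  rewrite ger0_norm; first by rewrite natrD -!natr1 kE; ring.
  by rewrite subr_ge0 lerXn2r ?nnegrE ?ler_nat// ltnW.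
have rp n : (0 < n)%N -> 0 < root4 n.
  by case: n => // n _; exact: lt_le_trans (root4_ge1 n).
have P1 : 0 < (j - i)%:R * (j.+1 + i.+1)%:R :> R by rewrite mulr_gt0// ltr0n.
have P2 : 0 < root4 m.+1 ^+ 3 * ((j - i)%:R * root4 (j - i)).
  by rewrite mulr_gt0 ?exprn_gt0 ?rp// mulr_gt0 ?ltr0n ?rp.
rewrite E -invfM lef_pV2 ?posrE// mulrCA; apply: ler_wpM2l => //.
rewrite -(root4X4 (j.+1 + i.+1)) (exprSr _ 3).
apply: ler_pM; rewrite ?root4_ge0 ?exprn_ge0 ?root4_ge0//.
- apply: lerXn2r; rewrite ?nnegrE ?root4_ge0//; apply: root4_le.
  by case/orP : mij => /eqP->; rewrite ?leq_addl ?leq_addr.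
- by apply: root4_le; rewrite (leq_trans (leq_subr i j))// (leq_trans (leqnSn j))// leq_addr.
Qed.

(** Both sides of the diagonal contribute at most 5 times the common factor.  The
    exponent 3/4 matters: these row sums are square-summable. *)
Lemma sum_gap M j : \sum_(i < M) gap i j <= 10 * (root4 j.+1 ^+ 3)^-1.
Proof.
set c := (_ ^+ 3)^-1.
have c0 : 0 <= c by rewrite invr_ge0 exprn_ge0// root4_ge0.
pose f k : R := (k.+1%:R * root4 k.+1)^-1.
have f0 k : 0 <= f k by rewrite invr_ge0 mulr_ge0// root4_ge0.
rewrite -(big_mkord xpredT (fun i => gap i j)).
have : \sum_(0 <= i < M) gap i j <= \sum_(0 <= i < j.+1 + M) gap i j.
  rewrite [leRHS](@big_cat_nat _ _ _ M)//= ?leq_addl// lerDl.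
  by apply: sumr_ge0 => i _; exact: gap_ge0.
move=> /le_trans; apply.
rewrite (@big_cat_nat _ _ _ j.+1)//= ?leq_addr// big_nat_recr//=.
rewrite {2}/gap eqxx addr0.
have H1 : \sum_(0 <= i < j) gap i j <= c * 5.
  apply: (@le_trans _ _ (c * \sum_(0 <= i < j) f i)); last first.
    by rewrite ler_wpM2l// big_mkord; exact: sum_root4.
  rewrite big_nat_rev add0n mulr_sumr; apply: ler_sum_nat => i /andP[_ ij].
  rewrite (le_trans (gap_le (m := j) _ _ _ _))// ?eqxx ?orbT//.
  - by rewrite ltn_subrL (leq_ltn_trans _ ij).
  - by rewrite leq_subr.
  - by rewrite subKn.
have H2 : \sum_(j.+1 <= i < j.+1 + M) gap i j <= c * 5.
  apply: (@le_trans _ _ (c * \sum_(0 <= i < M) f i)); last first.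
    by rewrite ler_wpM2l// big_mkord; exact: sum_root4.
  rewrite -{1}[j.+1]add0n big_addn addKn mulr_sumr; apply: ler_sum_nat => i _.
  rewrite gapC (le_trans (gap_le (m := j) _ _ _ _))// ?eqxx//.
  - by rewrite addnS ltnS leq_addl.
  - by rewrite addnS (leq_trans (leq_addl i j)).
  - by rewrite addnS subSn ?leq_addl// addnK.
lra.
Qed.

End NumericalSums.

(** * The Lyapunov form *)

Section LyapunovForm.
Context {R : realType}.
Variable sg : nat -> R.
Hypothesis sg_le2 : forall i, sg i ^+ 2 <= 2.

Definition freq (i : nat) : R := (i.+1%:R * pi) ^+ 2.

Lemma freq_ge i : i.+1%:R ^+ 2 <= freq i.
Proof.
rewrite /freq exprMn ler_peMr ?sqr_ge0//.
by rewrite exprn_ege1// (le_trans _ (@pi_ge2 R))// ler1n.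
Qed.

Lemma freq_ge1 i : 1 <= freq i.
Proof. by apply: le_trans (freq_ge i); rewrite exprn_ege1// ler1n. Qed.

Lemma freq_gt0 i : 0 < freq i. Proof. exact: lt_le_trans ltr01 (freq_ge1 i). Qed.

Lemma freq_gap i j : i != j ->
  [/\ freq j ^+ 2 - freq i ^+ 2 != 0 &
      `|freq j / (freq j ^+ 2 - freq i ^+ 2)| <= gap i j].
Proof.
move=> ij; have p1 : 1 <= pi ^+ 2 :> R.
  by rewrite exprn_ege1// (le_trans _ (@pi_ge2 R))// ler1n.
have fE : freq j - freq i = pi ^+ 2 * (j.+1%:R ^+ 2 - i.+1%:R ^+ 2) by rewrite /freq; ring.
have d0 : j.+1%:R ^+ 2 - i.+1%:R ^+ 2 != 0 :> R.
  by rewrite subr_eq0 eqrXn2// eqr_nat eqSS eq_sym.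
have fi := freq_gt0 i; have fj := freq_gt0 j.
have f0 : freq j - freq i != 0.
  by rewrite fE mulf_neq0// gt_eqF// (lt_le_trans ltr01 p1).
have s0 : freq j + freq i != 0 by rewrite gt_eqF// addr_gt0.
rewrite subr_sqr mulf_neq0//; split => //.
rewrite (_ : freq j / _ = freq j / (freq j + freq i) * (freq j - freq i)^-1); last first.
  by field; rewrite f0 s0.
rewrite normrM /gap (negbTE ij) -[leRHS]mul1r.
apply: ler_pM => //.
  by rewrite ger0_norm ?divr_ge0 ?addr_ge0 ?(ltW fi) ?(ltW fj)// ler_pdivrMr ?addr_gt0// mul1r lerDl ltW.
rewrite normfV lef_pV2 ?posrE ?normr_gt0// fE normrM ler_peMl//.
exact: le_trans p1 (ler_norm _).
Qed.

(** The coefficients are forced by form_derivative: off the diagonal,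
    ker i j freq j + ker j i freq i = 4 sg i sg j makes the terms in p a full
    square, and ker i j freq i + ker j i freq j = 0 removes the terms in q. *)
Definition ker i j : R :=
  if i == j then sg i ^+ 2 / freq i
  else 4 * sg i * sg j * (freq j / (freq j ^+ 2 - freq i ^+ 2)).

(** A symmetric majorant of the kernel, as needed for Schur's test. *)
Definition weight i j : R := 2 * (i == j)%:R + 8 * gap i j.

Lemma weightC i j : weight i j = weight j i.
Proof. by rewrite /weight eq_sym gapC. Qed.

Lemma sgM_le2 i j : `|sg i * sg j| <= 2.
Proof.
have := sg_le2 i; have := sg_le2 j => hj hi.
have := sqr_ge0 (sg i - sg j); have := sqr_ge0 (sg i + sg j) => h1 h2.
by rewrite ler_norml; apply/andP; split; lra.
Qed.

Lemma ker_weight i j : `|ker i j| <= weight i j.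
Proof.
rewrite /ker /weight; case: eqVneq => [->|ij].
  rewrite /gap eqxx mulr0 addr0 mulr1 normrM ger0_norm ?sqr_ge0//.
  rewrite normfV ler_pdivrMr ?normr_gt0 ?gt_eqF ?freq_gt0//.
  rewrite gtr0_norm ?freq_gt0//; apply: le_trans (sg_le2 j) _.
  by rewrite ler_peMr// freq_ge1.
have [_ H] := freq_gap ij.
rewrite mulr0 add0r normrM -mulrA normrM ger0_norm//.
rewrite (_ : 8 = 4 * 2); last by ring.
by apply: ler_pM => //; rewrite ler_pM2l// sgM_le2.
Qed.

Lemma sum_weight M i : \sum_(j < M) weight i j <= 82.
Proof.
rewrite big_split/= -!mulr_sumr.
have H1 : \sum_(j < M) (i == j)%:R <= 1 :> R.
  have [iM|Mi] := ltnP i M.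
    rewrite (bigD1 (Ordinal iM))//= eqxx big1 ?addr0// => j.
    by rewrite -val_eqE/= eq_sym => /negbTE->.
  by rewrite big1// => j _; rewrite gtn_eqF// (leq_trans (ltn_ord j)).
have H2 : \sum_(j < M) gap i j <= 10 :> R.
  rewrite (eq_bigr (fun j : 'I_M => gap j i)); last by move=> j _; rewrite gapC.
  apply: le_trans (sum_gap M i) _.
  by rewrite ler_piMr// invf_le1 ?exprn_ege1 ?root4_ge1// exprn_gt0// (lt_le_trans ltr01)// root4_ge1.
lra.
Qed.

Definition modal_form M (p q : nat -> R) : R := \sum_(i < M) \sum_(j < M) ker i j * p i * q j.

(** Schur's test: half of the bound 82 on the row and column sums of the weight. *)
Lemma form_le M p q :
  `|modal_form M p q| <= 41 * (\sum_(i < M) p i ^+ 2 + \sum_(i < M) q i ^+ 2).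
Proof.
apply: (@le_trans _ _ (\sum_(i < M) \sum_(j < M)
    (2^-1 * weight i j * p i ^+ 2 + 2^-1 * weight i j * q j ^+ 2))).
  apply: le_trans (ler_norm_sum _ _ _) _; apply: ler_sum => i _.
  apply: le_trans (ler_norm_sum _ _ _) _; apply: ler_sum => j _.
  rewrite -mulrA normrM -mulrDr -mulrA mulrCA.
  apply: ler_pM => //; first exact: ker_weight.
  rewrite normrM -(real_normK (num_real (p i))) -(real_normK (num_real (q j))).
  have := sqr_ge0 (`|p i| - `|q j|); lra.
under eq_bigr do rewrite big_split/=.
rewrite big_split/= mulrDr lerD//.
  rewrite mulr_sumr; apply: ler_sum => i _.
  rewrite -mulr_suml ler_wpM2r ?sqr_ge0// -mulr_sumr.
  by have := sum_weight M i; lra.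
rewrite exchange_big/= mulr_sumr; apply: ler_sum => j _.
rewrite -mulr_suml ler_wpM2r ?sqr_ge0// -mulr_sumr.
rewrite (eq_bigr (fun i : 'I_M => weight j i)); last by move=> i _; rewrite weightC.
by have := sum_weight M j; lra.
Qed.

Lemma sum_sym M (F : nat -> nat -> R) :
  \sum_(i < M) \sum_(j < M) F i j = 2^-1 * \sum_(i < M) \sum_(j < M) (F i j + F j i).
Proof.
under [in RHS]eq_bigr do rewrite big_split/=.
rewrite big_split/= [X in _ + X]exchange_big/=.
set S := \sum_(_ < M) _; lra.
Qed.

Lemma sum_diag M (F : nat -> R) :
  \sum_(i < M) \sum_(j < M) (i == j :> nat)%:R * F i = \sum_(i < M) F i.
Proof.
apply: eq_bigr => i _; rewrite (bigD1 i)//= eqxx mul1r big1 ?addr0// => j.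
by rewrite -val_eqE/= eq_sym => /negbTE->; rewrite mul0r.
Qed.

(** The left-hand side is the derivative of the form along p' = - freq q - sg g,
    q' = freq p.  The contribution of the frequencies is computed exactly by
    symmetrisation; the one of g is a sum over j of g sg_j q_j with coefficients
    O(j^(-3/4)), hence square-summable, and half of the observed energy absorbs it. *)
Lemma form_derivative M (p q : nat -> R) (g : R) :
  modal_form M p (fun j => freq j * p j) + modal_form M (fun i => - freq i * q i - sg i * g) q
  <= 2 * (\sum_(i < M) sg i * p i) ^+ 2
     - 2^-1 * \sum_(i < M) sg i ^+ 2 * (p i ^+ 2 + q i ^+ 2) + 10086 * g ^+ 2.
Proof.
pose V i j := ker i j * (freq j * p i * p j - freq i * q i * q j).
pose U i j := ker i j * sg i * q j.
have -> : modal_form M p (fun j => freq j * p j) + modal_form M (fun i => - freq i * q i - sg i * g) q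
    = \sum_(i < M) \sum_(j < M) V i j - g * \sum_(j < M) \sum_(i < M) U i j.
  rewrite [X in _ - g * X]exchange_big/= mulr_sumr -sumrB -big_split/=.
  apply: eq_bigr => i _; rewrite mulr_sumr -sumrB -big_split/=.
  by apply: eq_bigr => j _; rewrite /V /U; ring.
have -> : \sum_(i < M) \sum_(j < M) V i j =
    2 * (\sum_(i < M) sg i * p i) ^+ 2 - \sum_(i < M) sg i ^+ 2 * (p i ^+ 2 + q i ^+ 2).
  rewrite sum_sym.
  rewrite -(sum_diag M (fun i => sg i ^+ 2 * (p i ^+ 2 + q i ^+ 2))).
  rewrite expr2 mulr_suml mulr_sumr -sumrB mulr_sumr; apply: eq_bigr => i _.
  rewrite !mulr_sumr -sumrB; apply: eq_bigr => j _.
  rewrite /V /ker (eq_sym (j : nat) i); case: eqVneq => [ij|ij].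
    by rewrite ij mul1r; field; rewrite gt_eqF ?freq_gt0.
  rewrite mul0r subr0.
  have [d0 _] := freq_gap ij.
  have d0' : freq i ^+ 2 - freq j ^+ 2 != 0 by rewrite -opprB oppr_eq0.
  by field; rewrite d0 d0'.
pose th j : R := 82 * (root4 j.+1 ^+ 3)^-1.
have Ule (j : 'I_M) : `|\sum_(i < M) U i j| <= `|sg j * q j| * th j.
  pose c : R := (root4 j.+1 ^+ 3)^-1.
  have r1 := @root4_ge1 R j.
  have c0 : 0 < root4 j.+1 ^+ 3 :> R by rewrite exprn_gt0// (lt_le_trans ltr01).
  have fc : (freq j)^-1 <= c.
    rewrite lef_pV2 ?posrE ?freq_gt0//; apply: le_trans (freq_ge j).
    by rewrite -(root4X4 j.+1) -exprM ler_weXn2l.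
  apply: (@le_trans _ _ (`|sg j * q j| * \sum_(i < M) (2 * c * (i == j :> nat)%:R + 8 * gap i j))).
    rewrite mulr_sumr; apply: le_trans (ler_norm_sum _ _ _) _; apply: ler_sum => i _.
    rewrite /U /ker; case: (eqVneq (i : nat) j) => [->|ij].
      rewrite /gap eqxx mulr0 addr0 mulr1.
      rewrite (_ : _ * q j = sg j * q j * (sg j ^+ 2 * (freq j)^-1)); last by ring.
      rewrite normrM ler_wpM2l// ger0_norm; last first.
        by rewrite mulr_ge0 ?sqr_ge0// invr_ge0 ltW// freq_gt0.
      by apply: ler_pM => //; rewrite ?sqr_ge0// invr_ge0 ltW// freq_gt0.
    have [_ H] := freq_gap ij.
    rewrite mulr0 add0r; set k := freq j / _ in H *.
    rewrite (_ : _ * q j = sg j * q j * (4 * sg i ^+ 2 * k)); last by ring.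
    rewrite normrM ler_wpM2l// normrM.
    have s4 : 0 <= 4 * sg i ^+ 2 by rewrite mulr_ge0// sqr_ge0.
    rewrite (ger0_norm s4).
    by apply: ler_pM => //; [have := sg_le2 i; lra].
  apply: ler_wpM2l => //; rewrite big_split/= -!mulr_sumr.
  have := @sum_gap R M j; rewrite -/c => H.
  have -> : \sum_(i < M) (i == j :> nat)%:R = 1 :> R.
    rewrite (bigD1 j)//= eqxx big1 ?addr0// => i.
    by rewrite -val_eqE/= => /negbTE->.
  by rewrite /th -/c; lra.
(* 20172 = 3 * 82 ^ 2, and half of it appears in the statement. *)
have th2 : \sum_(j < M) th j ^+ 2 <= 20172.
  rewrite (eq_bigr (fun j : 'I_M => 6724 * (Num.sqrt j.+1%:R ^+ 3)^-1)).
    by rewrite -mulr_sumr; have := @sum_sqrt3 R M; lra.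
  move=> j _; rewrite /th exprMn exprVn -exprM (exprM _ 2 3) root4X2.
  by congr (_ * _); ring.
have gU : - (g * \sum_(j < M) \sum_(i < M) U i j) <=
    \sum_(j < M) (2^-1 * (sg j ^+ 2 * q j ^+ 2) + 2^-1 * g ^+ 2 * th j ^+ 2).
  rewrite mulr_sumr -sumrN; apply: ler_sum => j _.
  apply: (le_trans (ler_norm _)); rewrite normrN normrM.
  apply: (@le_trans _ _ (`|g| * (`|sg j * q j| * th j))); first by rewrite ler_wpM2l.
  rewrite -exprMn -(real_normK (num_real (sg j * q j))) -(real_normK (num_real g)).
  by have := sqr_ge0 (`|sg j * q j| - `|g| * th j); lra.
have {}th2 := ler_wpM2l (sqr_ge0 g) th2.
rewrite big_split/= -!mulr_sumr in gU.
have pq : \sum_(i < M) sg i ^+ 2 * q i ^+ 2 <= \sum_(i < M) sg i ^+ 2 * (p i ^+ 2 + q i ^+ 2).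
  by apply: ler_sum => i _; rewrite ler_wpM2l ?sqr_ge0// lerDr sqr_ge0.
lra.
Qed.

End LyapunovForm.

(** * Damped systems in modal coordinates *)

Section ModalSystems.
Context {R : realType} {E : lmodType R}.
Implicit Types (x y z : E) (M i : nat).

Lemma psd_cauchy_schwarz (X : set E) (F : E -> E -> R) :
  (forall k x y, X x -> X y -> X (k *: x + y)) ->
  (forall x y, X x -> X y -> F x y = F y x) ->
  (forall k x y z, X x -> X y -> X z -> F (k *: x + y) z = k * F x z + F y z) ->
  (forall x, X x -> 0 <= F x x) ->
  forall x y, X x -> X y -> F x y ^+ 2 <= F x x * F y y.
Proof.
move=> XL FC Fl F0 x y Xx Xy.
have P (k : R) : 0 <= k ^+ 2 * F x x + 2 * k * F x y + F y y.
  have Xk : X (k *: x + y) by exact: XL.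
  have := F0 _ Xk; rewrite Fl// ![F _ (k *: x + y)]FC// !Fl// (FC y x)//.
  by congr (_ <= _); ring.
have [x0|x0] := eqVneq (F x x) 0.
  rewrite x0 mul0r; have [->|xy0] := eqVneq (F x y) 0; first by rewrite expr0n.
  have := P (- (F y y + 1) / (2 * F x y)); rewrite x0 mulr0 add0r.
  rewrite [X in 0 <= X](_ : _ = - 1); first by rewrite oppr_ge0 ler10.
  by field.
have x1 : 0 < F x x by rewrite lt_def x0 F0.
have := P (- F x y / F x x).
rewrite [X in 0 <= X](_ : _ = (F x x * F y y - F x y ^+ 2) / F x x); last by field.
by rewrite pmulr_lge0 ?invr_gt0// subr_ge0.
Qed.

Variables (X D : set E) (N : E -> R) (B : E -> E -> R) (A : E -> E).
Variables (p q : nat -> E -> R) (g : E -> R) (sg : nat -> R).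

(** A damped conservative system diagonalised by the coordinates p (velocities) and
    q (displacements, scaled by the frequency); the rank-one damping acts on the
    i-th mode with strength sg i, and g is the observed trace.  Completeness of the
    modes is asked on D only, where it is elementary; on X Bessel's inequality is
    enough. *)
Record modal_system : Prop := ModalSystem {
  ms_lin : forall k x y, X x -> X y -> X (k *: x + y);
  ms_BC : forall x y, X x -> X y -> B x y = B y x;
  ms_Bl : forall k x y z, X x -> X y -> X z -> B (k *: x + y) z = k * B x z + B y z;
  ms_N0 : forall x, 0 <= N x;
  ms_NB : forall x, X x -> N x ^+ 2 = B x x;
  ms_p : forall i k x y, X x -> X y -> p i (k *: x + y) = k * p i x + p i y;
  ms_q : forall i k x y, X x -> X y -> q i (k *: x + y) = k * q i x + q i y;
  ms_bessel : forall M x, X x ->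
    \sum_(i < M) p i x ^+ 2 + \sum_(i < M) q i x ^+ 2 <= N x ^+ 2;
  ms_D : forall z, D z -> X z;
  ms_A : forall z, D z -> X (A z);
  ms_pA : forall i z, D z -> p i (A z) = - freq i * q i z - sg i * g z;
  ms_qA : forall i z, D z -> q i (A z) = freq i * p i z;
  ms_parseval : forall z, D z ->
    \sum_(i < M) p i z ^+ 2 + \sum_(i < M) q i z ^+ 2 @[M --> \oo] --> N z ^+ 2;
  ms_trace : forall z, D z -> \sum_(i < M) sg i * p i z @[M --> \oo] --> g z;
  ms_sg : forall i, sg i ^+ 2 <= 2
}.

Hypothesis ms : modal_system.

Let XL := ms_lin ms.

Lemma ms_scale k x : X x -> X (k *: x).
Proof. by move=> Xx; rewrite -[k](subrK 1) scalerDl scale1r; exact: XL. Qed.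

Lemma ms_add x y : X x -> X y -> X (x + y).
Proof. by move=> Xx Xy; rewrite -[x]scale1r; exact: XL. Qed.

Lemma ms_sub x y : X x -> X y -> X (x - y).
Proof. by move=> Xx Xy; rewrite -scaleN1r; apply: ms_add => //; exact: ms_scale. Qed.

Lemma ms_Br k x y z : X x -> X y -> X z -> B z (k *: x + y) = k * B z x + B z y.
Proof.
move=> Xx Xy Xz; rewrite (ms_BC ms)//; last exact: XL.
by rewrite (ms_Bl ms)// !(ms_BC ms (y := z)).
Qed.

Lemma ms_Bpos x : X x -> 0 <= B x x.
Proof. by move=> Xx; rewrite -(ms_NB ms)// sqr_ge0. Qed.

Lemma ms_CS x y : X x -> X y -> `|B x y| <= N x * N y.
Proof.
move=> Xx Xy; rewrite -ler_sqr ?nnegrE ?mulr_ge0 ?(ms_N0 ms)//.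
rewrite real_normK ?num_real// exprMn !(ms_NB ms)//.
exact: (psd_cauchy_schwarz XL (ms_BC ms) (ms_Bl ms) ms_Bpos).
Qed.

Lemma ms_BD x y : X x -> X y -> B (x + y) (x + y) = B x x + 2 * B x y + B y y.
Proof.
move=> Xx Xy; have Xxy := ms_add Xx Xy.
have H z : X z -> B (x + y) z = B x z + B y z.
  by move=> Xz; have := ms_Bl ms 1 Xx Xy Xz; rewrite scale1r mul1r.
rewrite H// ![B _ (x + y)](ms_BC ms)// !H// (ms_BC ms Xy Xx); ring.
Qed.

Lemma ms_ND x y : X x -> X y -> N (x + y) <= N x + N y.
Proof.
move=> Xx Xy; have Nx := ms_N0 ms x; have Ny := ms_N0 ms y.
rewrite -ler_sqr ?nnegrE ?(ms_N0 ms) ?addr_ge0//.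
rewrite (ms_NB ms) ?ms_BD//; last exact: ms_add.
have := ms_CS Xx Xy => /(le_trans (ler_norm _)) H.
have := ms_NB ms Xx; have := ms_NB ms Xy; nra.
Qed.

Lemma ms_NZ k x : X x -> N (k *: x) = `|k| * N x.
Proof.
move=> Xx; have Xk := ms_scale k Xx.
apply/eqP; rewrite -(@eqrXn2 _ 2) ?mulr_ge0 ?(ms_N0 ms)//; apply/eqP.
rewrite exprMn real_normK ?num_real// !(ms_NB ms)//.
have Bk z : X z -> B (k *: x) z = k * B x z.
  move=> Xz; rewrite -[k](subrK 1) scalerDl scale1r (ms_Bl ms)//; ring.
by rewrite Bk// (ms_BC ms)// Bk//; ring.
Qed.

Lemma ms_NN x : X x -> N (- x) = N x.
Proof. by move=> Xx; rewrite -scaleN1r ms_NZ// normrN1 mul1r. Qed.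

Lemma ms_NB_le x y : X x -> X y -> N x <= N y + N (x - y).
Proof.
by move=> Xx Xy; rewrite -{1}[x](subrK y) addrC; apply: ms_ND => //; exact: ms_sub.
Qed.

Lemma ms_coord i x : X x -> `|p i x| <= N x /\ `|q i x| <= N x.
Proof.
move=> Xx; have := ms_bessel ms i.+1 Xx; rewrite !big_ord_recr/= => H.
have h1 : 0 <= \sum_(j < i) p j x ^+ 2 by apply: sumr_ge0 => *; exact: sqr_ge0.
have h2 : 0 <= \sum_(j < i) q j x ^+ 2 by apply: sumr_ge0 => *; exact: sqr_ge0.
have := sqr_ge0 (p i x); have := sqr_ge0 (q i x) => h3 h4.
by split; rewrite -ler_sqr ?nnegrE ?(ms_N0 ms)// real_normK ?num_real//; lra.
Qed.

(** Energy identity: Cauchy-Schwarz for the tail of Parseval's identity turns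
    the termwise computation of B z (A z) into an exact one. *)
Lemma ms_dissipation z : D z -> B z (A z) = - g z ^+ 2.
Proof.
move=> Dz; have Xz := ms_D ms Dz; have XA := ms_A ms Dz.
pose F M x y := B x y - \sum_(i < M) (p i x * p i y + q i x * q i y).
have FCS M : F M z (A z) ^+ 2 <= F M z z * N (A z) ^+ 2.
  apply: (@le_trans _ _ (F M z z * F M (A z) (A z))); last first.
    rewrite ler_wpM2l//; last first.
      by rewrite (ms_NB ms)// /F gerBl sumr_ge0// => i _; rewrite addr_ge0// -expr2 sqr_ge0.
    rewrite /F -(ms_NB ms)// subr_ge0; apply: le_trans (ms_bessel ms M Xz).
    by rewrite -big_split/=; apply: ler_sum => i _; rewrite !expr2.
  apply: (@psd_cauchy_schwarz X) => //.
  - move=> x y Xx Xy; rewrite /F (ms_BC ms)//; congr (_ - _).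
    by apply: eq_bigr => i _; rewrite mulrC [q i x * _]mulrC.
  - move=> k x y w Xx Xy Xw; rewrite /F (ms_Bl ms)// mulrBr mulr_sumr addrACA -opprD -big_split/=.
    by congr (_ - _); apply: eq_bigr => i _; rewrite (ms_p ms)// (ms_q ms)//; ring.
  - move=> x Xx; rewrite /F -(ms_NB ms)// subr_ge0; apply: le_trans (ms_bessel ms M Xx).
    by rewrite -big_split/=; apply: ler_sum => i _; rewrite !expr2.
have FE M : F M z (A z) = B z (A z) + g z * \sum_(i < M) sg i * p i z.
  rewrite /F mulr_sumr -sumrN; congr (_ + _); apply: eq_bigr => i _.
  by rewrite (ms_pA ms)// (ms_qA ms)//; ring.
have lim1 : F M z z * N (A z) ^+ 2 @[M --> \oo] --> (0 : R).
  rewrite -(mul0r (N (A z) ^+ 2)); apply: cvgM; last exact: cvg_cst.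
  rewrite -(subrr (N z ^+ 2)) /F (ms_NB ms)//; apply: cvgB; first exact: cvg_cst.
  rewrite -(ms_NB ms)//; have := ms_parseval ms Dz.
  by under eq_fun do rewrite -big_split/=.
have lim2 : F M z (A z) @[M --> \oo] --> B z (A z) + g z * g z.
  under eq_fun do rewrite FE.
  apply: cvgD; first exact: cvg_cst.
  by apply: cvgM; [exact: cvg_cst|exact: ms_trace ms _ Dz].
have lim3 : F M z (A z) ^+ 2 @[M --> \oo] --> (B z (A z) + g z * g z) ^+ 2.
  by rewrite expr2; under eq_fun do rewrite expr2; exact: cvgM.
have : (B z (A z) + g z * g z) ^+ 2 <= 0.
  have := @ler_cvg_to _ _ _ _ _ _ _ _ lim3 lim1; apply.
  by apply: nearW => M; exact: FCS.
rewrite le_eqVlt ltNge sqr_ge0 orbF sqrf_eq0 => /eqP; rewrite -expr2; lra.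
Qed.

End ModalSystems.

(** * Tails of the modal expansions *)

Section StaticEstimates.
Context {R : realType} {E : lmodType R}.
Variables (X D : set E) (N : E -> R) (B : E -> E -> R) (A : E -> E).
Variables (p q : nat -> E -> R) (g : E -> R) (sg : nat -> R).
Hypothesis ms : modal_system X D N B A p q g sg.
Implicit Types (x y z : E) (M i : nat).

Local Notation en i z := (p i z ^+ 2 + q i z ^+ 2).

Lemma freq_sqr_inv i : (freq i ^+ 2)^-1 <= (Num.sqrt i.+1%:R ^+ 3)^-1 :> R.
Proof.
have s1 : 1 <= Num.sqrt i.+1%:R :> R by rewrite -[X in X <= _]sqrtr1 ler_wsqrtr// ler1n.
have s0 : 0 < Num.sqrt i.+1%:R :> R by exact: lt_le_trans s1.
have f0 := @freq_gt0 R i.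
rewrite lef_pV2 ?posrE; [|exact: exprn_gt0|exact: exprn_gt0].
apply: (@le_trans _ _ (Num.sqrt i.+1%:R ^+ 8)); first exact: ler_weXn2l.
rewrite (exprM _ 2 4) sqr_sqrtr// (exprM _ 2 2).
by apply: lerXn2r; [rewrite nnegrE sqr_ge0|rewrite nnegrE ltW// freq_gt0|exact: freq_ge].
Qed.

(** The modal equations solved for p and q: a frequency is gained, at the price
    of the trace. *)
Lemma mode_bound i z : D z ->
  en i z <= (freq i ^+ 2)^-1 * (2 * en i (A z) + 4 * g z ^+ 2).
Proof.
move=> Dz; have f0 := @freq_gt0 R i; have := ms_sg ms i => s2.
have pE := ms_pA ms i Dz; have qE := ms_qA ms i Dz.
rewrite [leRHS]mulrC ler_pdivlMr; last exact: exprn_gt0.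
rewrite mulrDl -!exprMn.
have -> : p i z * freq i = q i (A z) by rewrite qE mulrC.
have -> : q i z * freq i = - (p i (A z) + sg i * g z) by rewrite pE; ring.
have h := sqr_ge0 (p i (A z) - sg i * g z).
have h2 : sg i ^+ 2 * g z ^+ 2 <= 2 * g z ^+ 2 by rewrite ler_wpM2r// sqr_ge0.
have := sqr_ge0 (q i (A z)); rewrite sqrrN; lra.
Qed.

(** The modes above tau have frequency at least tau^2; the constant 12 is 4 times
    the bound on the sum of the (i + 1)^(-3/2). *)
Lemma high_modes (tau : R) M z : D z -> 0 < tau ->
  \sum_(i < M | tau < i.+1%:R) en i z <= 2 * (tau ^+ 4)^-1 * N (A z) ^+ 2 + 12 * g z ^+ 2.
Proof.
move=> Dz tau0.
apply: (@le_trans _ _ (\sum_(i < M | tau < i.+1%:R)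
   (2 * (tau ^+ 4)^-1 * en i (A z) + 4 * g z ^+ 2 * (Num.sqrt i.+1%:R ^+ 3)^-1))).
  apply: ler_sum => i ti; apply: le_trans (mode_bound i Dz) _.
  have := freq_sqr_inv i => H1.
  have H2 : (freq i ^+ 2)^-1 <= (tau ^+ 4)^-1.
    have f0 := @freq_gt0 R i.
    rewrite lef_pV2 ?posrE; [|exact: exprn_gt0|exact: exprn_gt0].
    rewrite (exprM _ 2 2).
    apply: lerXn2r; rewrite ?nnegrE ?sqr_ge0 ?(ltW (freq_gt0 _))//.
    apply: le_trans (freq_ge i); apply: lerXn2r; rewrite ?nnegrE ?(ltW tau0)//; exact: ltW.
  have e0 : 0 <= en i (A z) by rewrite addr_ge0// sqr_ge0.
  rewrite mulrDr; apply: lerD.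
    by rewrite mulrCA -mulrA ler_pM2l// ler_wpM2r.
  by rewrite mulrC ler_wpM2l// mulr_ge0// sqr_ge0.
rewrite big_split/= -!mulr_sumr; apply: lerD.
  rewrite ler_wpM2l//; first by rewrite mulr_ge0// invr_ge0 exprn_ge0// ltW.
  apply: le_trans (ms_bessel ms M (ms_A ms Dz)).
  rewrite -big_split/= big_mkcond; apply: ler_sum => i _.
  by case: ifP => // _; rewrite addr_ge0// sqr_ge0.
have -> : 12 * g z ^+ 2 = 4 * g z ^+ 2 * 3 by ring.
rewrite ler_wpM2l//; first by rewrite mulr_ge0// sqr_ge0.
apply: le_trans (sum_sqrt3 M); rewrite big_mkcond; apply: ler_sum => i _.
by case: ifP => // _; rewrite invr_ge0 exprn_ge0// sqrtr_ge0.
Qed.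

Lemma sum_tail (f : nat -> R) M M' : (M <= M')%N ->
  \sum_(i < M') f i = \sum_(i < M) f i + \sum_(i < M' | M%:R < i.+1%:R :> R) f i.
Proof.
move=> MM'; rewrite -(big_mkord xpredT f) (@big_cat_nat _ _ _ M)//= big_mkord.
congr (_ + _); rewrite -(big_mkord (fun i => M%:R < i.+1%:R :> R) f) [RHS]big_mkcond.
rewrite [RHS](@big_cat_nat _ _ _ M)//= [X in _ = X + _](@eq_big_nat _ _ _ _ _ _ (fun=> 0)).
  rewrite [X in _ = X + _]big1 ?add0r//; apply: eq_big_nat => i /andP[Mi _].
  by rewrite ltr_nat ltnS Mi.
by move=> i /andP[_ iM]; rewrite ltr_nat ltnS leqNgt iM.
Qed.

Lemma energy_tail M z : D z ->
  N z ^+ 2 <= \sum_(i < M.+1) en i z +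
    (2 * (M.+1%:R ^+ 4)^-1 * N (A z) ^+ 2 + 12 * g z ^+ 2).
Proof.
move=> Dz; have H := ms_parseval ms Dz.
apply: (cvgr_to_le H).
near=> M'; rewrite -big_split/= (@sum_tail (fun i => en i z) M.+1); last first.
  by near: M'; exact: nbhs_infty_ge.
by rewrite lerD2l; apply: high_modes => //; rewrite ltr0n.
Unshelve. all: by end_near. Qed.

(** As p i z = q i (A z) / freq i, the tail of the trace series is controlled by
    the energy of A z, uniformly on trajectories. *)
Lemma trace_tail M z : D z ->
  `|g z - \sum_(i < M.+1) sg i * p i z| <= (N (A z) ^+ 2 + 2) / M.+1%:R.
Proof.
move=> Dz; have m0 : 0 < M.+1%:R :> R by rewrite ltr0n.
have H : `|\sum_(i < M') sg i * p i z - \sum_(i < M.+1) sg i * p i z| @[M' --> \oo]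
    --> `|g z - \sum_(i < M.+1) sg i * p i z|.
  by apply: cvg_norm; apply: cvgB; [exact: ms_trace ms _ Dz|exact: cvg_cst].
apply: (cvgr_to_le H); near=> M'.
rewrite (@sum_tail (fun i => sg i * p i z) M.+1); last first.
  by near: M'; exact: nbhs_infty_ge.
rewrite addrAC subrr add0r; apply: le_trans (ler_norm_sum _ _ _) _.
apply: (@le_trans _ _ (\sum_(i < M' | M.+1%:R < i.+1%:R :> R)
   (M.+1%:R^-1 * q i (A z) ^+ 2 + 2^-1 / M.+1%:R * (Num.sqrt i.+1%:R ^+ 3)^-1))).
  apply: ler_sum => i Mi.
  have f0 := @freq_gt0 R i.
  have -> : p i z = q i (A z) / freq i by rewrite (ms_qA ms)//; field; rewrite gt_eqF.
  set s := (Num.sqrt i.+1%:R ^+ 3)^-1; set m := M.+1%:R in m0 Mi *.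
  set u := q i (A z).
  have s1 : 1 <= Num.sqrt i.+1%:R :> R by rewrite -[X in X <= _]sqrtr1 ler_wsqrtr// ler1n.
  have w2 : (m / freq i) ^+ 2 <= s.
    rewrite /s -[leRHS]div1r ler_pdivlMr ?exprn_gt0 ?(lt_le_trans ltr01 s1)//.
    rewrite expr_div_n mulrAC ler_pdivrMr; last exact: exprn_gt0.
    rewrite mul1r (expr2 (freq i)).
    apply: ler_pM; rewrite ?sqr_ge0 ?exprn_ge0 ?sqrtr_ge0//.
      apply: le_trans (freq_ge i); apply: lerXn2r; rewrite ?nnegrE ?(ltW m0)//; exact: ltW.
    apply: le_trans (freq_ge i); rewrite -[i.+1%:R in leRHS]sqr_sqrtr// -exprM.
    exact: ler_weXn2l.
  have sg2 := ms_sg ms i.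
  have h1 : `|sg i * (u / freq i)| * m <= u ^+ 2 + 2^-1 * s.
    rewrite -{1}(gtr0_norm m0) -normrM.
    rewrite (_ : sg i * (u / freq i) * m = u * (sg i * (m / freq i))); last by ring.
    have h2 : (sg i * (m / freq i)) ^+ 2 <= 2 * s.
      by rewrite exprMn; apply: ler_pM; rewrite ?sqr_ge0.
    have h3 := sqr_ge0 (u - 2^-1 * (sg i * (m / freq i))).
    have h4 := sqr_ge0 (u + 2^-1 * (sg i * (m / freq i))).
    by rewrite ler_norml; apply/andP; split; lra.
  rewrite -(ler_pM2r m0); apply: le_trans h1 _.
  by rewrite le_eqVlt; apply/orP; left; apply/eqP; field; rewrite gt_eqF.
rewrite big_split/= -!mulr_sumr mulrDl [N _ ^+ 2 / _]mulrC; apply: lerD.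
  apply: ler_wpM2l; first by rewrite invr_ge0 ltW.
  apply: le_trans (ms_bessel ms M' (ms_A ms Dz)).
  rewrite -big_split/= big_mkcond; apply: ler_sum => i _.
  by case: ifP => _; rewrite ?lerDr ?addr_ge0 ?sqr_ge0.
have S3 : \sum_(i < M' | M.+1%:R < i.+1%:R :> R) (Num.sqrt i.+1%:R ^+ 3)^-1 <= 3 :> R.
  apply: le_trans (sum_sqrt3 M'); rewrite big_mkcond; apply: ler_sum => i _.
  by case: ifP => // _; rewrite invr_ge0 exprn_ge0// sqrtr_ge0.
apply: (@le_trans _ _ (2^-1 / M.+1%:R * 3)).
  by rewrite ler_wpM2l// mulr_ge0// invr_ge0 ltW.
by rewrite mulrAC ler_pM2r ?invr_gt0//; lra.
Unshelve. all: by end_near. Qed.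

End StaticEstimates.

(** * The Lyapunov function along trajectories *)

Section Decay.
Context {R : realType} {E : lmodType R}.
Variables (X D : set E) (N : E -> R) (B : E -> E -> R) (A : E -> E).
Variables (p q : nat -> E -> R) (g : E -> R) (sg : nat -> R).
Hypothesis ms : modal_system X D N B A p q g sg.
Implicit Types (x y z v : E) (M i : nat).

Local Notation W M x y := (modal_form sg M (p^~ x) (q^~ y)).

Lemma formDr M k x y z : X x -> X y -> W M z (k *: x + y) = k * W M z x + W M z y.
Proof.
move=> Xx Xy; rewrite /modal_form mulr_sumr -big_split/=; apply: eq_bigr => i _.
rewrite mulr_sumr -big_split/=; apply: eq_bigr => j _.
by rewrite (ms_q ms)//; ring.
Qed.

Lemma formDl M k x y z : X x -> X y -> W M (k *: x + y) z = k * W M x z + W M y z.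
Proof.
move=> Xx Xy; rewrite /modal_form mulr_sumr -big_split/=; apply: eq_bigr => i _.
rewrite mulr_sumr -big_split/=; apply: eq_bigr => j _.
by rewrite (ms_p ms)//; ring.
Qed.

Definition form_bound M : R := \sum_(i < M) \sum_(j < M) `|ker sg i j|.

Lemma form_bound_le M x y : X x -> X y -> `|W M x y| <= form_bound M * (N x * N y).
Proof.
move=> Xx Xy; rewrite /form_bound mulr_suml; apply: le_trans (ler_norm_sum _ _ _) _.
apply: ler_sum => i _; rewrite mulr_suml; apply: le_trans (ler_norm_sum _ _ _) _.
apply: ler_sum => j _; rewrite -mulrA !normrM ler_wpM2l//.
have [px _] := ms_coord ms i Xx; have [_ qy] := ms_coord ms j Xy.
exact: ler_pM.
Qed.

Lemma form_bound_ge0 M : 0 <= form_bound M.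
Proof. by apply: sumr_ge0 => i _; apply: sumr_ge0. Qed.

Variable K : R.

Definition lyap M z : R := K * B z z + W M z z.

(** The derivative of the quadratic form lyap at z in the direction v. *)
Definition dlyap M z v : R := 2 * K * B z v + W M z v + W M v z.

Lemma lyap_le M z : X z -> `|lyap M z - K * N z ^+ 2| <= 41 * N z ^+ 2.
Proof.
move=> Xz; rewrite /lyap (ms_NB ms)// addrAC subrr add0r.
apply: le_trans (form_le (ms_sg ms) _ _ _) _; rewrite ler_pM2l// -(ms_NB ms)//.
exact: ms_bessel ms _ _ Xz.
Qed.

Lemma lyap_add M z v : X z -> X v -> lyap M (z + v) = lyap M z + dlyap M z v + lyap M v.
Proof.
move=> Xz Xv; rewrite /lyap /dlyap (ms_BD ms)//.
have H w : W M w (z + v) = W M w z + W M w v.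
  by have := formDr M 1 w Xz Xv; rewrite scale1r mul1r.
have H' w : W M (z + v) w = W M z w + W M v w.
  by have := formDl M 1 w Xz Xv; rewrite scale1r mul1r.
by rewrite H' !H; ring.
Qed.

Lemma dlyap_lin M z k x y : X z -> X x -> X y ->
  dlyap M z (k *: x + y) = k * dlyap M z x + dlyap M z y.
Proof.
by move=> Xz Xx Xy; rewrite /dlyap formDr// formDl// (ms_Br ms)//; ring.
Qed.

Hypothesis K0 : 0 <= K.

Lemma dlyap_le M z v : X z -> X v ->
  dlyap M z v <= 2 * (K + form_bound M) * (N z * N v).
Proof.
move=> Xz Xv; rewrite /dlyap.
have h1 := le_trans (ler_norm _) (form_bound_le M Xz Xv).
have h2 := le_trans (ler_norm _) (form_bound_le M Xv Xz).
have h3 : K * B z v <= K * (N z * N v).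
  by rewrite ler_wpM2l// (le_trans (ler_norm _) (ms_CS ms Xz Xv)).
lra.
Qed.

(** The effect of the truncation to M + 1 modes. *)
Definition defect (w tau a : R) M : R :=
  2 * w * (M.+1%:R ^+ 4)^-1 * a ^+ 2 + 4 * ((a ^+ 2 + 2) / M.+1%:R) ^+ 2.

(** The dissipation - 2 K g^2 absorbs all terms in g^2: 10086 from form_derivative,
    2 * 2 from replacing the truncated trace by g, and 12 w from each of
    energy_tail and high_modes, in all at most 2 (5045 + 12 Om). *)
Lemma dlyap_generator (w Om tau : R) M z : D z -> 0 <= w <= Om -> 0 < tau ->
  (forall i, i.+1%:R <= tau -> 2 * w <= sg i ^+ 2) -> 5045 + 12 * Om <= K ->
  dlyap M.+1 z (A z) <=
    - w * N z ^+ 2 + 2 * w * (tau ^+ 4)^-1 * N (A z) ^+ 2 + defect w tau (N (A z)) M.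
Proof.
move=> Dz /andP[w0 wO] tau0 lowmodes KO; rewrite /dlyap (ms_dissipation ms)//.
have := form_derivative (ms_sg ms) M.+1 (p^~ z) (q^~ z) (g z).
rewrite (_ : (fun j => freq j * p j z) = q^~ (A z)); last first.
  by apply/funext => j; rewrite (ms_qA ms).
rewrite (_ : (fun i => - freq i * q i z - sg i * g z) = p^~ (A z)); last first.
  by apply/funext => j; rewrite (ms_pA ms).
set W1 := W _ _ _; set W2 := W _ _ _; set G := \sum_(i < _) sg i * _ => /= HW.
have HG : G ^+ 2 <= 2 * g z ^+ 2 + 2 * ((N (A z) ^+ 2 + 2) / M.+1%:R) ^+ 2.
  have := trace_tail ms M Dz; rewrite -/G; set e := _ / _ => Ge.
  have e2 : (g z - G) ^+ 2 <= e ^+ 2.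
    rewrite -(real_normK (num_real (g z - G))).
    by apply: lerXn2r; rewrite ?nnegrE// (le_trans _ Ge).
  have := sqr_ge0 (2 * g z - G); lra.
have Het := energy_tail ms M Dz.
have Hhi := high_modes ms M.+1 Dz tau0.
set S := \sum_(i < M.+1) _ in Het; set Sh := \sum_(_ < _ | _) _ in Hhi.
have HS : w * S <= 2^-1 * \sum_(i < M.+1) sg i ^+ 2 * (p i z ^+ 2 + q i z ^+ 2) + w * Sh.
  rewrite /S /Sh !mulr_sumr [X in _ + X]big_mkcond -big_split/=; apply: ler_sum => i _.
  have e0 : 0 <= p i z ^+ 2 + q i z ^+ 2 by rewrite addr_ge0// sqr_ge0.
  have := sqr_ge0 (sg i); case: ifPn => [_ s0|].
    by rewrite lerDr mulr_ge0// mulr_ge0.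
  rewrite -leNgt => /lowmodes H _; rewrite addr0 mulrA ler_wpM2r//; lra.
have h1 := ler_wpM2l w0 Het.
have h2 := ler_wpM2l w0 Hhi.
have h3 : w * g z ^+ 2 <= Om * g z ^+ 2 by rewrite ler_wpM2r// sqr_ge0.
have h4 : (5045 + 12 * Om) * g z ^+ 2 <= K * g z ^+ 2 by rewrite ler_wpM2r// sqr_ge0.
rewrite /defect; set e := _ / M.+1%:R in HG *.
set m4 := (M.+1%:R ^+ 4)^-1 in Het h1 *; set t4 := (tau ^+ 4)^-1 in Hhi h2 *.
set T := \sum_(i < M.+1) sg i ^+ 2 * _ in HW HS.
clear Het Hhi.
move: (N z ^+ 2) (N (A z) ^+ 2) (g z ^+ 2) T S Sh W1 W2 (G ^+ 2) (e ^+ 2) m4 t4 HW HG HS h1 h2 h3 h4.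
move=> n2 a2 g2 T S Sh W1 W2 G2 e2 m4 t4 HW HG HS h1 h2 h3 h4.
lra.
Qed.

Variable S : R -> E -> E.
Hypothesis CS : contraction_semigroup X N S.
Hypothesis GS : infinitesimal_generator X N S D A.

Let SX t x : 0 <= t -> X x -> X (S t x). Proof. exact: CS.1. Qed.

Lemma null_eq x y : X x -> X y -> N (x - y) = 0 -> N x <= N y.
Proof. by move=> Xx Xy xy; rewrite -[leRHS]addr0 -xy; exact: ms_NB_le ms _ _ Xx Xy. Qed.

Lemma nullN x : X x -> N x = 0 -> N (- x) = 0.
Proof. by move=> Xx x0; rewrite (ms_NN ms). Qed.

Lemma null_lin k x y : X x -> X y -> N x = 0 -> N y = 0 -> N (k *: x + y) = 0.
Proof.
move=> Xx Xy x0 y0; apply/eqP; rewrite eq_le (ms_N0 ms) andbT.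
apply: le_trans (ms_ND ms (ms_scale ms k Xx) Xy) _.
by rewrite (ms_NZ ms)// x0 y0 mulr0 addr0.
Qed.

(** The defect of the difference quotient of a trajectory is at any time bounded
    by its value at time 0, because the semigroup is contractive. *)
Lemma trajectory_increment s h x : 0 <= s -> 0 <= h -> D x ->
  N (S (s + h) x - S s x - h *: S s (A x)) <= N (S h x - x - h *: A x).
Proof.
move=> s0 h0 Dx; have Xx := ms_D ms Dx; have XA := ms_A ms Dx.
have [SL S0 SD SN Sc] := CS.2.
have Xsh : X (S (s + h) x) by apply: SX => //; rewrite addr_ge0.
have Xs := SX s0 Xx; have Xh := SX h0 Xx; have XsA := SX s0 XA; have Xssh := SX s0 Xh.
pose y := -1 *: x + S h x.
have Xy : X y by exact: (ms_lin ms).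
pose u := (- h) *: A x + y.
have Xu : X u by exact: (ms_lin ms).
have Xsy := SX s0 Xy; have Xsu := SX s0 Xu.
have uE : S h x - x - h *: A x = u.
  by rewrite /u /y scaleN1r scaleNr [RHS](AC (1*2) ((3*2)*1)).
rewrite uE; apply: le_trans (SN _ _ s0 Xu).
have Z k a : X a -> X (k *: a) by exact: (ms_scale ms).
have Xd : X (S (s + h) x - S s x - h *: S s (A x)).
  by apply: (ms_sub ms); [exact: (ms_sub ms)|exact: Z].
apply: null_eq => //.
have n1 := SD s h x s0 h0 Xx.
have n2 := SL s (-1) x (S h x) s0 Xx Xh; rewrite -/y in n2.
have n3 := SL s (- h) (A x) y s0 XA Xy; rewrite -/u in n3.
have X1 : X (S (s + h) x - S s (S h x)) by exact: (ms_sub ms).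
have X2 : X (S s y - (-1 *: S s x + S s (S h x))).
  by apply: (ms_sub ms) => //; exact: (ms_lin ms).
have X3' : X (S s u - (- h *: S s (A x) + S s y)).
  by apply: (ms_sub ms) => //; exact: (ms_lin ms).
rewrite (_ : _ - S s u = -1 *: (S s u - (- h *: S s (A x) + S s y)) +
   (-1 *: (S s y - (-1 *: S s x + S s (S h x))) + (S (s + h) x - S s (S h x)))).
  by apply: null_lin => //; [exact: (ms_lin ms)|exact: null_lin].
rewrite !scaleN1r !scaleNr !opprB.
by rewrite [RHS](AC (3*(3*2)) ((7*4*1*3)*(2*6)*(5*8)))/= !subrr !addr0.
Qed.

Lemma quotient_norm h a b : 0 < h -> X a -> X b -> N (h^-1 *: a - b) = h^-1 * N (a - h *: b).
Proof.
move=> h0 Xa Xb; rewrite -[X in X * N _]gtr0_norm ?invr_gt0// -(ms_NZ ms).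
  by rewrite scalerBr scalerA mulVf ?gt_eqF// scale1r.
by apply: (ms_sub ms) => //; exact: (ms_scale ms).
Qed.

(** On S s x the difference quotient converges to S s (A x); hence S s x is in the
    domain and its image by A is S s (A x), up to a null vector. *)
Lemma trajectory_domain s x : 0 <= s -> D x ->
  [/\ D (S s x), N (S s x) <= N x, N (A (S s x)) <= N (A x) &
      forall h, 0 <= h -> N (S (s + h) x - S s x - h *: A (S s x)) <= N (S h x - x - h *: A x)].
Proof.
move=> s0 Dx; have Xx := ms_D ms Dx; have XA := ms_A ms Dx.
have [SL S0 SD SN Sc] := CS.2.
have Xs := SX s0 Xx; have XsA := SX s0 XA.
have Z k a : X a -> X (k *: a) by exact: (ms_scale ms).
have XB a b : X a -> X b -> X (a - b) by exact: (ms_sub ms).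
have step h : 0 < h -> N (h^-1 *: (S h (S s x) - S s x) - S s (A x)) <=
    N (h^-1 *: (S h x - x) - A x).
  move=> h0; have h0' := ltW h0; have Xh := SX h0' Xx; have Xhs := SX h0' Xs.
  have Xsh : X (S (s + h) x) by apply: SX => //; rewrite addr_ge0.
  rewrite !quotient_norm//; try exact: XB.
  rewrite ler_pM2l ?invr_gt0//; apply: le_trans (trajectory_increment s0 h0' Dx).
  apply: null_eq; [by apply: (XB) => //; [exact: XB|exact: Z]..|].
  rewrite opprB addrA subrK opprB addrA subrK.
  rewrite -opprB nullN//; first by apply: XB.
  by rewrite [s + h]addrC; exact: SD.
have rdS : right_derivative_at0 N S (S s x) (S s (A x)).
  have [_ rd] := GS.2 _ Dx.
  apply: (squeeze_cvgr _ (cvg_cst 0) rd).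
  near=> h; rewrite (ms_N0 ms)/=; apply: step.
  by near: h; exact: nbhs_right_gt.
have Ds : D (S s x) by apply/GS.1; split => //; exists (S s (A x)).
have XAs := ms_A ms Ds.
have n0 : N (A (S s x) - S s (A x)) = 0.
  apply/eqP; rewrite eq_le (ms_N0 ms) andbT.
  have [_ rd] := GS.2 _ Ds.
  have lim : N (h^-1 *: (S h (S s x) - S s x) - A (S s x)) +
     N (h^-1 *: (S h (S s x) - S s x) - S s (A x)) @[h --> 0^'+] --> (0 + 0 : R).
    exact: cvgD.
  rewrite addr0 in lim; apply: (cvgr_to_ge lim); near=> h.
  have h0 : 0 <= h by apply: ltW; near: h; exact: nbhs_right_gt.
  have Xh := SX h0 Xs; set y := h^-1 *: _.
  have Xy : X y by apply: Z; exact: XB.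
  rewrite -(ms_NN ms (XB _ _ Xy XAs)) opprB.
  rewrite (_ : A (S s x) - S s (A x) = (A (S s x) - y) + (y - S s (A x))).
    by apply: (ms_ND ms); exact: XB.
  by rewrite addrA subrK.
have NA : N (A (S s x)) <= N (S s (A x)) by exact: null_eq.
split => //; [exact: SN|exact: le_trans NA (SN _ _ s0 XA)|].
move=> h h0; apply: le_trans (trajectory_increment s0 h0 Dx).
have Xsh : X (S (s + h) x) by apply: SX => //; rewrite addr_ge0.
apply: null_eq; [by apply: (XB) => //; [exact: XB|exact: Z]..|].
rewrite opprB [X in N X]addrC addrA subrK -scalerBr (ms_NZ ms); last exact: XB.
by rewrite -opprB (ms_NN ms) ?n0 ?mulr0//; exact: XB.
Unshelve. all: by end_near. Qed.

Section Stepping.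
Variables (w Om tau t : R) (M : nat) (x : E).
Hypotheses (Dx : D x) (w01 : 0 <= w <= Om) (tau0 : 0 < tau) (t0 : 0 <= t).
Hypothesis lowmodes : forall i, i.+1%:R <= tau -> 2 * w <= sg i ^+ 2.
Hypotheses (KO : 5045 + 12 * Om <= K).

Let a := N (A x).
Let n := N x.
Let eps h := N (h^-1 *: (S h x - x) - A x).
Let c := - w * N (S t x) ^+ 2 + 2 * w * (tau ^+ 4)^-1 * a ^+ 2 + defect w tau a M.
Let err h := 2 * (K + form_bound M.+1) * n * eps h + (K + 41) * h * (a + eps h) ^+ 2.

(** An Euler step from z = S s x: the increment of the trajectory is h A z up to a
    vector of norm h eps h, with eps h independent of s. *)
Lemma lyap_step s h : 0 <= s -> s <= t -> 0 < h ->
  lyap M.+1 (S (s + h) x) <= lyap M.+1 (S s x) + h * (c + err h).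
Proof.
move=> s0 st h0; have [Ds Nz NAz incr] := trajectory_domain s0 Dx.
have Xx := ms_D ms Dx; have XA := ms_A ms Dx.
have Xz := ms_D ms Ds; have XAz := ms_A ms Ds.
have Xsh : X (S (s + h) x) by apply: SX => //; rewrite addr_ge0// ltW.
have Xh : X (S h x) by apply: SX => //; exact: ltW.
have XB y1 y2 : X y1 -> X y2 -> X (y1 - y2) by exact: (ms_sub ms).
have [w0 _] := andP w01.
set z := S s x in Ds Nz NAz incr Xz XAz *.
pose v := S (s + h) x - z; pose d := v - h *: A z.
have XhA : X (h *: A z) by exact: (ms_scale ms).
have Xv : X v by exact: XB.
have Xd : X d by exact: XB.
have Nd : N d <= h * eps h.
  rewrite /eps quotient_norm//; last exact: XB.
  by rewrite mulrA divff ?gt_eqF// mul1r; apply: incr; exact: ltW.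
have e0 : 0 <= eps h by exact: ms_N0 ms _.
have a0 : 0 <= a by exact: ms_N0 ms _.
have vE : v = h *: A z + d by rewrite /d addrC subrK.
have Nv : N v <= h * (a + eps h).
  rewrite vE mulrDr; apply: le_trans (ms_ND ms XhA Xd) _; apply: lerD => //.
  by rewrite (ms_NZ ms)// gtr0_norm// ler_pM2l.
have Nt : N (S t x) <= N z.
  have [_ [SL S0 SD SN Sc]] := CS; have ts0 : 0 <= t - s by rewrite subr_ge0.
  apply: le_trans (SN _ _ ts0 Xz).
  apply: null_eq; [exact: SX|exact: SX|].
  by have := SD (t - s) s x ts0 s0 Xx; rewrite subrK.
have dz : dlyap M.+1 z (A z) <= c.
  apply: le_trans (dlyap_generator M Ds w01 tau0 lowmodes KO) _.
  have NA2 : N (A z) ^+ 2 <= a ^+ 2 by apply: lerXn2r; rewrite ?nnegrE// (ms_N0 ms).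
  have Nt2 : N (S t x) ^+ 2 <= N z ^+ 2 by apply: lerXn2r; rewrite ?nnegrE// (ms_N0 ms).
  have m0 : 0 < M.+1%:R :> R by rewrite ltr0n.
  apply: lerD; first apply: lerD.
  - by rewrite !mulNr lerN2 ler_wpM2l.
  - by rewrite ler_wpM2l// mulr_ge0 ?invr_ge0 ?exprn_ge0 ?(ltW tau0)// mulr_ge0.
  - apply: lerD; first by rewrite ler_wpM2l// mulr_ge0 ?invr_ge0 ?exprn_ge0// mulr_ge0.
    rewrite ler_pM2l//; apply: lerXn2r; rewrite ?nnegrE ?divr_ge0 ?addr_ge0 ?sqr_ge0//.
    by rewrite ler_pM2r ?invr_gt0// lerD2r.
have lv : lyap M.+1 v <= (K + 41) * (h * (a + eps h)) ^+ 2.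
  have := le_trans (ler_norm _) (lyap_le M.+1 Xv) => H.
  apply: (@le_trans _ _ ((K + 41) * N v ^+ 2)); first lra.
  apply: ler_wpM2l; first by rewrite addr_ge0.
  by apply: lerXn2r; rewrite ?nnegrE ?(ms_N0 ms)// mulr_ge0 ?addr_ge0// ltW.
have dv : dlyap M.+1 z v <= h * c + 2 * (K + form_bound M.+1) * (n * (h * eps h)).
  rewrite vE dlyap_lin//; apply: lerD; first by rewrite ler_pM2l.
  apply: le_trans (dlyap_le _ Xz Xd) _.
  apply: ler_wpM2l; first by rewrite mulr_ge0// addr_ge0// form_bound_ge0.
  by apply: ler_pM; rewrite ?(ms_N0 ms).
have -> : S (s + h) x = z + v by rewrite /v [RHS]addrC subrK.
rewrite lyap_add// -addrA lerD2l; apply: le_trans (lerD dv lv) _.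
rewrite le_eqVlt; apply/orP; left; apply/eqP; rewrite /err; ring.
Qed.

Lemma lyap_steps h k : 0 < h -> k%:R * h <= t ->
  lyap M.+1 (S (k%:R * h) x) <= (K + 41) * n ^+ 2 + k%:R * h * (c + err h).
Proof.
move=> h0; elim: k => [|k IH] kt.
  rewrite !mul0r addr0.
  have Xx := ms_D ms Dx; have X0 := SX (lexx 0) Xx.
  have := le_trans (ler_norm _) (lyap_le M.+1 X0) => H.
  apply: (@le_trans _ _ ((K + 41) * N (S 0 x) ^+ 2)); first lra.
  apply: ler_wpM2l; first by rewrite addr_ge0.
  by apply: lerXn2r; rewrite ?nnegrE ?(ms_N0 ms)//; have [_ []] := trajectory_domain (lexx 0) Dx.
have kh0 : 0 <= k%:R * h by rewrite mulr_ge0// ltW.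
have kE : k.+1%:R * h = k%:R * h + h by rewrite -natr1; ring.
have kt' : k%:R * h <= t by apply: le_trans kt; rewrite kE lerDl ltW.
rewrite kE; apply: le_trans (lyap_step kh0 kt' h0) _.
have := IH kt'; rewrite mulrDl; lra.
Qed.

Lemma err_cvg0 : err h @[h --> 0^'+] --> (0 : R).
Proof.
have [_ rd] := GS.2 _ Dx.
have ec : eps h @[h --> 0^'+] --> (0 : R) by exact: rd.
have hc : h @[h --> (0 : R)^'+] --> (0 : R) by apply: cvg_at_right_filter; exact: cvg_id.
suff : err h @[h --> 0^'+] -->
    (2 * (K + form_bound M.+1) * n * 0 + (K + 41) * 0 * (a + 0) ^+ 2 : R).
  by rewrite !mulr0 mul0r addr0.
apply: cvgD; first by apply: cvgM => //; exact: cvg_cst.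
apply: cvgM; first by apply: cvgM => //; exact: cvg_cst.
rewrite expr2; under eq_fun do rewrite expr2.
by apply: cvgM; apply: cvgD => //; exact: cvg_cst.
Qed.

(** Adding up the Euler steps and letting h tend to 0; the final value of the
    Lyapunov function is nonnegative for K >= 41 by form_le. *)
Lemma lyap_balance : 41 <= K -> 0 <= (K + 41) * n ^+ 2 + t * c.
Proof.
move=> K41; move: t0; rewrite le_eqVlt => /predU1P[<-|tp].
  by rewrite mul0r addr0 mulr_ge0 ?sqr_ge0// addr_ge0.
rewrite leNgt; apply/negP; set F := _ + _ => F0.
have eta0 : 0 < - F / t / 2 by rewrite !divr_gt0// oppr_gt0.
move: err_cvg0 => /cvgrPdist_lt/(_ _ eta0).
rewrite near_withinE => /nbhs_ballP[e /= e0 He].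
have [m hm] : exists m : nat, t / m.+1%:R < e.
  exists (Num.truncn (t / e)); rewrite ltr_pdivrMr ?ltr0n// mulrC -ltr_pdivrMr//.
  exact: truncnS_gt.
pose h := t / m.+1%:R; have h0 : 0 < h by rewrite divr_gt0// ltr0n.
have hb : ball (0 : R) e h by rewrite /ball/= sub0r normrN gtr0_norm.
have := He h hb h0; rewrite /= sub0r normrN => /(le_lt_trans (ler_norm _)) eh.
have mh : m.+1%:R * h = t by rewrite /h mulrC divfK// pnatr_eq0.
have := @lyap_steps h m.+1 h0; rewrite mh lexx => /(_ isT) H.
have [Dt _ _ _] := trajectory_domain t0 Dx; have Xt := ms_D ms Dt.
have L0 : 0 <= lyap M.+1 (S t x).
  have := lyap_le M.+1 Xt; rewrite ler_norml => /andP[H1 _].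
  have : 41 * N (S t x) ^+ 2 <= K * N (S t x) ^+ 2 by rewrite ler_wpM2r// sqr_ge0.
  lra.
have : t * err h < - F / 2.
  have -> : - F / 2 = t * (- F / t / 2) by field; rewrite gt_eqF.
  by rewrite ltr_pM2l.
have := le_trans L0 H; rewrite mulrDr addrA -/F; lra.
Qed.

End Stepping.

End Decay.

(** * The abstract decay estimate *)

Section AbstractDecay.
Context {R : realType} {E : lmodType R}.

Lemma defect_le (w tau a : R) M : 0 <= w ->
  defect w tau a M <= (2 * w * a ^+ 2 + 4 * (a ^+ 2 + 2) ^+ 2) / M.+1%:R.
Proof.
move=> w0; rewrite /defect; set m : R := M.+1%:R.
have m1 : 1 <= m by rewrite ler1n.
have m0 : 0 < m by exact: lt_le_trans m1.
have H k : (m ^+ k.+1)^-1 <= m^-1.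
  by rewrite lef_pV2 ?posrE ?exprn_gt0// ler_eXnr.
have h1 : (m ^+ 4)^-1 <= m^-1 := H 3%N; have h2 : (m ^+ 2)^-1 <= m^-1 := H 1%N.
have h3 : 0 <= 2 * w * a ^+ 2 by rewrite mulr_ge0 ?sqr_ge0// mulr_ge0.
have h4 := ler_wpM2l h3 h1.
have h5 := ler_wpM2l (sqr_ge0 (a ^+ 2 + 2)) h2.
rewrite expr_div_n.
move: (m ^+ 4)^-1 (m ^+ 2)^-1 (m^-1) {h1 h2} h4 h5 => i4 i2 i1 h4 h5; lra.
Qed.

(** On the modes up to tau the damping has strength at least 2 w; those above carry
    at most a multiple of tau^-4 of the energy of A x, up to the dissipated one.  The
    effect of the truncation is removed by letting the number of modes grow. *)
Theorem modal_decay (Om : R) : 0 <= Om -> exists2 C : R, 0 < C &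
  forall (X D : set E) N B A p q g sg, modal_system X D N B A p q g sg ->
  forall S, contraction_semigroup X N S -> infinitesimal_generator X N S D A ->
  forall (w tau t : R) x, D x -> 0 <= w <= Om -> 0 < tau -> 0 <= t ->
  (forall i : nat, i.+1%:R <= tau -> 2 * w <= sg i ^+ 2) ->
  w * (t + 1) * N (S t x) ^+ 2 <=
    C * N x ^+ 2 + 2 * (w * t) * (tau ^+ 4)^-1 * N (A x) ^+ 2.
Proof.
move=> Om0; pose K : R := 5045 + 12 * Om.
exists (K + 41 + Om); first by rewrite /K; lra.
move=> X D N B A p q g sg ms S CS GS w tau t x Dx w01 tau0 t0 low.
have K41 : 41 <= K by rewrite /K; lra.
have K0 : 0 <= K by lra.
have [w0 wO] := andP w01.
have [Dt Nt _ _] := trajectory_domain ms CS GS t0 Dx.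
have Nt2 : N (S t x) ^+ 2 <= N x ^+ 2 by apply: lerXn2r; rewrite ?nnegrE ?(ms_N0 ms).
have H : 0 <= (K + 41) * N x ^+ 2 + t * (- w * N (S t x) ^+ 2 + 2 * w * (tau ^+ 4)^-1 * N (A x) ^+ 2).
  rewrite leNgt; apply/negP; set F := _ + _ => F0.
  set c := 2 * w * N (A x) ^+ 2 + 4 * (N (A x) ^+ 2 + 2) ^+ 2.
  have c0 : 0 <= c.
    have h1 := sqr_ge0 (N (A x)); have h2 := sqr_ge0 (N (A x) ^+ 2 + 2).
    have h3 : 0 <= w * N (A x) ^+ 2 by exact: mulr_ge0.
    by rewrite /c; lra.
  have := truncnS_gt (t * c / - F); set M := Num.truncn _ => HM.
  have m0 : 0 < M.+1%:R :> R by rewrite ltr0n.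
  have nF : 0 < - F by rewrite oppr_gt0.
  have h1 : t * (c / M.+1%:R) < - F.
    by rewrite mulrA ltr_pdivrMr// [ltRHS]mulrC -ltr_pdivrMr.
  have h2 := lyap_balance ms K0 CS GS M Dx w01 tau0 t0 low (lexx K) K41.
  have h3 := ler_wpM2l t0 (@defect_le w tau (N (A x)) M w0); rewrite -/c in h3.
  move: h2; rewrite (_ : _ + _ = F + t * defect w tau (N (A x)) M); last by rewrite /F; ring.
  move: (defect _ _ _ _) (c / _) h1 h3 => d e h1 h3 h2; lra.
have h1 : w * N (S t x) ^+ 2 <= Om * N x ^+ 2.
  by apply: ler_pM; rewrite ?sqr_ge0.
lra.
Qed.

End AbstractDecay.

(** * Modal coordinates of the beam *)

Section BeamModes.
Context {R : realType}.
Variable a : R.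
Hypothesis a01 : 0 < a < 1.
Implicit Types (u v phi : R -> R) (z : beam_state R).

Local Notation wd := weak_derivative.
Local Notation ip01 := (ip (0 : R) 1).

Let a0 : 0 < a. Proof. by case/andP : a01. Qed.
Let a1 : a < 1. Proof. by case/andP : a01. Qed.

Definition beam_form z z' : R :=
  ip01 (wd 0 1 2 z.1) (wd 0 1 2 z'.1) + ip01 z.2 z'.2.

Definition velocity_mode (i : nat) z : R := ip01 z.2 (sn i.+1).

(** Equal to (n pi)^2 <u, e_n>, a displacement scaled by its frequency. *)
Definition curvature_mode (i : nat) z : R := - 1 * ip01 (wd 0 1 2 z.1) (sn i.+1).

Definition beam_trace z : R := value_at 0 1 0 z.2 a.

Lemma V3_lin k u v : V3 u -> V3 v -> V3 (fun x => k * u x + v x).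
Proof.
by move=> [su su'] [sv sv']; split; [exact: sobolev0_lin|exact: sobolev_lin].
Qed.

Lemma V3_L2wd u : V3 u -> L2 0 1 (wd 0 1 2 u).
Proof. by move=> [_ su]; exact: sobolev_L2wd su (leqnn 2). Qed.

Lemma V3_L2 u : V3 u -> L2 0 1 u.
Proof. by move=> [_ [Lu _]]. Qed.

Lemma X3_lin k z z' : X3 z -> X3 z' -> X3 (k *: z + z').
Proof. by move=> [Vz Lz] [Vz' Lz']; split; [exact: V3_lin|exact: L2_lin]. Qed.

Lemma ip_wd_lin k u v h : V3 u -> V3 v -> L2 0 1 h ->
  ip01 (wd 0 1 2 (fun x => k * u x + v x)) h = k * ip01 (wd 0 1 2 u) h + ip01 (wd 0 1 2 v) h.
Proof.
move=> Vu Vv Lh; have Lu := V3_L2wd Vu; have Lv := V3_L2wd Vv.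
rewrite (ip_ae (V3_L2wd (V3_lin k Vu Vv)) (L2_lin k Lu Lv) Lh Lh (wd_lin k Vu.2 Vv.2 (leqnn 2))); last exact: nearW.
by rewrite ipDl ?ipZl//; exact: L2Z.
Qed.

Lemma ip_lin k u v h : L2 0 1 u -> L2 0 1 v -> L2 0 1 h ->
  ip01 (fun x => k * u x + v x) h = k * ip01 u h + ip01 v h.
Proof. by move=> Lu Lv Lh; rewrite ipDl ?ipZl//; exact: L2Z. Qed.

Lemma X3_norm_sqr z : X3_norm z ^+ 2 = beam_form z z.
Proof. by rewrite sqr_sqrtr ?addr_ge0 ?sqr_ge0// /V3_norm !L2norm_sqr. Qed.

(** The sines vanish at 0 and 1, so that beam_green applies to them. *)
Lemma velocity_mode_A i z : A3_domain a z ->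
  velocity_mode i (A3 a z) = - freq i * curvature_mode i z - sn i.+1 a * beam_trace z.
Proof.
move=> Dz; have [[[V3u s1 s2 b0 b1] V3v] j2 j3] := Dz.
have [LA EA] := A3_force a01 Dz; have Ls := @L2_sn R 0 1 i.+1.
have LU := V3_L2wd V3u.
rewrite /velocity_mode (ip_ae LA (beam_force_L2 a01 s1 s2) Ls Ls EA); last exact: nearW.
have d1 (x : R) := is_derive_sn i.+1 x.
have d2 (x : R) := is_derive_cmul (i.+1%:R * pi) (is_derive_cn i.+1 x).
have c2 : continuous (fun x : R => i.+1%:R * pi * (- (i.+1%:R * pi) * sn i.+1 x)).
  by move=> x; do 2![apply: cvgM; first exact: cvg_cst]; exact: sn_continuous.
rewrite (beam_green a01 Dz d1 d2 c2 (sn_0 _) (sn_1 _)) /beam_trace /curvature_mode.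
have Ls' := L2Z (- (i.+1%:R * pi)) Ls.
rewrite (ipZr (i.+1%:R * pi) Ls' LU) (ipZr (- (i.+1%:R * pi)) Ls LU) /freq; ring.
Qed.

(** One integration by parts has no boundary terms because the sine vanishes at 0
    and 1, the other one because v is in H^1_0. *)
Lemma curvature_mode_A i z : A3_domain a z ->
  curvature_mode i (A3 a z) = freq i * velocity_mode i z.
Proof.
move=> Dz; have [[_ V3v] _ _] := Dz.
rewrite /curvature_mode /velocity_mode/=.
have d1 (x : R) := is_derive_sn i.+1 x.
have d2 (x : R) := is_derive_cmul (i.+1%:R * pi) (is_derive_cn i.+1 x).
have c1 : continuous (fun x : R => i.+1%:R * pi * cn i.+1 x).
  by move=> x; apply: cvgM; [exact: cvg_cst|exact: cn_continuous].
have c2 : continuous (fun x : R => i.+1%:R * pi * (- (i.+1%:R * pi) * sn i.+1 x)).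
  by move=> x; do 2![apply: cvgM; first exact: cvg_cst]; exact: sn_continuous.
have Ls := @L2_sn R 0 1 i.+1; have Ls' := L2Z (- (i.+1%:R * pi)) Ls.
have Lv := V3_L2 V3v.
rewrite (ip_green ltr01 V3v.2 (leqnn 2) d1 c1) sn_0 sn_1 !mulr0 subrr sub0r.
rewrite (sobolev0_parts ltr01 V3v.1 d2 c2).
rewrite (ipZr (i.+1%:R * pi) Ls' Lv) (ipZr (- (i.+1%:R * pi)) Ls Lv) /freq; ring.
Qed.

End BeamModes.

(** * Completeness of the modes on the domain *)

Section BeamCompleteness.
Context {R : realType}.
Variable a : R.
Hypothesis a01 : 0 < a < 1.
Implicit Types (u v phi f F : R -> R) (z : beam_state R).

Local Notation mu := (@lebesgue_measure R).
Local Notation wd := weak_derivative.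
Local Notation ip01 := (ip (0 : R) 1).

Let a0 : 0 < a. Proof. by case/andP : a01. Qed.
Let a1 : a < 1. Proof. by case/andP : a01. Qed.

(** Coefficients depend on f only up to equality almost everywhere. *)
Lemma sine_series_lipschitz_rep f F (K : R) : L2 0 1 f ->
  (forall x y, `|F x - F y| <= K * `|x - y|) ->
  {ae lebesgue_on 0 1, forall x, f x = F x} ->
  (forall x, 0 < x < 1 -> sine_sum f M x @[M --> \oo] --> F x) /\
  \sum_(i < M) ip01 f (sn i.+1) ^+ 2 @[M --> \oo] --> ip01 f f.
Proof.
move=> Lf FK fF; have LF : L2 0 1 F := continuous_L2 0 1 (lipschitz_continuous FK).
have S x : 0 < x < 1 -> sine_sum f M x @[M --> \oo] --> F x.
  move=> x01; rewrite [X in X @ _ --> _](_ : _ = fun M => sine_sum F M x).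
    exact: sine_sum_cvg FK x01.
  apply/funext => M /=; apply: eq_bigr => i _; congr (_ * _).
  by apply: ip_ae => //; [exact: L2_sn|exact: L2_sn|exact: nearW].
split => //; apply: parseval => //; move/ae_lebesgue_on : fF => fF.
apply/ae_lebesgue_on; move: fF.
apply: filterS; first exact: (ae_filter_ringOfSetsType mu).
move=> x H xI; rewrite (H xI); apply: S; by move: xI; rewrite in_itv.
Qed.

Lemma lipschitz_glue F1 F2 (K1 K2 : R) : F1 a = F2 a ->
  (forall x y, `|F1 x - F1 y| <= K1 * `|x - y|) ->
  (forall x y, `|F2 x - F2 y| <= K2 * `|x - y|) ->
  let F := fun x => if x <= a then F1 x else F2 x in
  forall x y, `|F x - F y| <= (`|K1| + `|K2|) * `|x - y|.
Proof.
move=> Fa L1 L2 F.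
have n1 x y : `|F1 x - F1 y| <= `|K1| * `|x - y|.
  by apply: le_trans (L1 x y) _; apply: ler_wpM2r => //; exact: ler_norm.
have n2 x y : `|F2 x - F2 y| <= `|K2| * `|x - y|.
  by apply: le_trans (L2 x y) _; apply: ler_wpM2r => //; exact: ler_norm.
have mixed x y : x <= a -> a < y -> `|F1 x - F2 y| <= (`|K1| + `|K2|) * `|x - y|.
  move=> xa ay; have -> : F1 x - F2 y = (F1 x - F1 a) + (F2 a - F2 y) by rewrite Fa; ring.
  apply: le_trans (ler_normD _ _) _; rewrite mulrDl.
  have h1 : `|x - a| <= `|x - y|.
    by rewrite !ler0_norm; [lra|lra|lra].
  have h2 : `|a - y| <= `|x - y|.
    by rewrite !ler0_norm; [lra|lra|lra].
  apply: lerD; first exact: le_trans (n1 _ _) (ler_wpM2l _ h1).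
  exact: le_trans (n2 _ _) (ler_wpM2l _ h2).
move=> x y; rewrite /F; case: (leP x a) => xa; case: (leP y a) => ya.
- by apply: le_trans (n1 _ _) _; apply: ler_wpM2r; rewrite // lerDl.
- exact: mixed.
- by rewrite distrC (distrC x); exact: mixed.
- by apply: le_trans (n2 _ _) _; apply: ler_wpM2r; rewrite // lerDr.
Qed.

Lemma ae_glue (P : R -> Prop) : {ae lebesgue_on 0 a, forall x, P x} ->
  {ae lebesgue_on a 1, forall x, P x} -> {ae lebesgue_on 0 1, forall x, P x}.
Proof.
move=> /ae_lebesgue_on H1 /ae_lebesgue_on H2.
have /ae_lebesgue_on H3 := ae_neq 0 1 a.
apply/ae_lebesgue_on; move: H1 H2 H3.
apply: filterS3; first exact: (ae_filter_ringOfSetsType mu).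
move=> x H1 H2 H3 xI; have := H3 xI; move: xI; rewrite in_itv/= => /andP[x0 x1].
rewrite neq_lt => /orP[xa|ax].
  by apply: H1; rewrite in_itv/= x0.
by apply: H2; rewrite in_itv/= x1 andbT.
Qed.

(** The Lipschitz representatives of u'' on the two sides of a take the same value
    at a, by the first transmission condition of the domain. *)
Lemma curvature_rep z : A3_domain a z -> exists F (K : R),
  (forall x y, `|F x - F y| <= K * `|x - y|) /\
  {ae lebesgue_on 0 1, forall x, wd 0 1 2 z.1 x = F x}.
Proof.
move=> [[[V3u s1 s2 _ _] _] j2 _].
have [k1 [K1]] := sobolev_rep_lip a0 s1 (isT : (3 < 4)%N).
set W1 := (fun x => k1 + _) => -[_ E1 V1 L1].
have [k2 [K2]] := sobolev_rep_lip a1 s2 (isT : (3 < 4)%N).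
set W2 := (fun x => k2 + _) => -[_ E2 V2 L2'].
have Wa : W1 a = W2 a.
  rewrite -V1; last by rewrite in_itv/= lexx (ltW a0).
  by rewrite -V2 ?j2// in_itv/= lexx (ltW a1).
exists (fun x => if x <= a then W1 x else W2 x), (`|K1| + `|K2|).
split; first exact: lipschitz_glue.
have r1 := wd_restrict (lexx 0) (ltW a1) V3u.2 (leqnn 2) s1 (isT : (2 <= 4)%N).
have r2 := wd_restrict (ltW a0) (lexx 1) V3u.2 (leqnn 2) s2 (isT : (2 <= 4)%N).
apply: ae_glue.
  have I : {ae lebesgue_on 0 a, forall x, x \in `]0, a[}.
    by apply/ae_lebesgue_on/nearW.
  apply: filterS3 r1 E1 I => x -> ->; rewrite in_itv/= => /andP[_ xa].
  by rewrite (ltW xa).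
have I : {ae lebesgue_on a 1, forall x, x \in `]a, 1[}.
  by apply/ae_lebesgue_on/nearW.
apply: filterS3 r2 E2 I => x -> ->; rewrite in_itv/= => /andP[ax _].
by rewrite leNgt ax.
Qed.

(** Here the value at a enters the trace, so that the representative has to be the
    one chosen by [value_at]. *)
Lemma velocity_rep v : V3 v -> exists F (K : R),
  [/\ forall x y, `|F x - F y| <= K * `|x - y|,
      {ae lebesgue_on 0 1, forall x, v x = F x} & value_at 0 1 0 v a = F a].
Proof.
move=> [_ sv]; have [k0 [K []]] := sobolev_rep_lip ltr01 sv (isT : (1 < 2)%N).
set W := (fun x => k0 + _) => _ E V L.
exists W, K; split => //; last by apply: V; rewrite in_itv/= (ltW a0) (ltW a1).
by apply: filterS2 (wd0_ae sv) E => x e1 e2; exact: etrans (esym e1) e2.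
Qed.

Lemma beam_modal_system : modal_system (@X3 R) (A3_domain a) X3_norm (@beam_form R)
  (A3 a) (@velocity_mode R) (@curvature_mode R) (@beam_trace R a)
  (fun i => sn i.+1 a).
Proof.
have sumsq z M : \sum_(i < M) curvature_mode i z ^+ 2 =
    \sum_(i < M) ip01 (wd 0 1 2 z.1) (sn i.+1) ^+ 2.
  by apply: eq_bigr => i _; rewrite /curvature_mode mulN1r sqrrN.
have lin1 k (x y : beam_state R) : (k *: x + y).1 = (fun t => k * x.1 t + y.1 t) by [].
have lin2 k (x y : beam_state R) : (k *: x + y).2 = (fun t => k * x.2 t + y.2 t) by [].
split.
- exact: X3_lin.
- by move=> z z' _ _; rewrite /beam_form ipC (ipC _ _ z.2).
- move=> k x y z [Vx Lx] [Vy Ly] [Vz Lz]; rewrite /beam_form lin1 lin2.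
  rewrite (ip_lin k Lx Ly Lz) (ip_wd_lin k Vx Vy (V3_L2wd Vz)).
  have E (b1 b2 b3 b4 : R) : k * b1 + b2 + (k * b3 + b4) = k * (b1 + b3) + (b2 + b4).
    by ring.
  exact: E.
- by move=> z; exact: sqrtr_ge0.
- by move=> z _; exact: X3_norm_sqr.
- by move=> i k x y [_ Lx] [_ Ly]; rewrite /velocity_mode lin2; exact: ip_lin (L2_sn _ _ _).
- move=> i k x y [Vx _] [Vy _].
  by rewrite /curvature_mode lin1 (ip_wd_lin k Vx Vy (L2_sn _ _ _)) mulrDr mulrCA.
- move=> M z [Vz Lz]; rewrite X3_norm_sqr /beam_form addrC sumsq.
  by apply: lerD; apply: bessel => //; exact: V3_L2wd.
- by move=> z [[[Vu _ _ _ _] Vv] _ _]; split => //; exact: V3_L2.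
- move=> z Dz; have [[_ Vv] _ _] := Dz; split => //; exact: (A3_force a01 Dz).1.
- by move=> i z; exact: velocity_mode_A.
- by move=> i z; exact: curvature_mode_A.
- move=> z Dz; have [[[Vu _ _ _ _] Vv] _ _] := Dz.
  rewrite X3_norm_sqr /beam_form addrC.
  have [F [K [FK EF]]] := curvature_rep Dz.
  have [G [H [GH EG _]]] := velocity_rep Vv.
  have [_ cU] := sine_series_lipschitz_rep (V3_L2wd Vu) FK EF.
  have [_ cv] := sine_series_lipschitz_rep (V3_L2 Vv) GH EG.
  under eq_fun do rewrite sumsq; exact: cvgD.
- move=> z Dz; have [[_ Vv] _ _] := Dz.
  rewrite /beam_trace; have [G [H [GH EG ->]]] := velocity_rep Vv.
  have [/(_ _ a01) cv _] := sine_series_lipschitz_rep (V3_L2 Vv) GH EG.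
  rewrite [X in X @ _ --> _](_ : _ = fun M => sine_sum z.2 M a)//.
  by apply/funext => M /=; apply: eq_bigr => i _; rewrite mulrC.
- by move=> i; rewrite /sn exprMn sqr_sqrtr// ler_piMr//.
Qed.

End BeamCompleteness.

(** * The lower convex envelope *)

Section Envelope.
Context {R : realType}.
Variables (u : nat -> R) (w : R -> R).
Hypothesis u0 : forall n, 0 <= u n.
Hypothesis uw : lower_convex_envelope u w.

Lemma closed_hull_point n : (0 < n)%N -> closed_hull u (n%:R, u n).
Proof.
move=> n0; apply: subset_closure; apply: sub_smallest; first exact: subset_refl.
by exists n.
Qed.

(** The half plane of nonnegative ordinates is closed and convex. *)
Lemma closed_hull_ge0 p : closed_hull u p -> 0 <= p.2.
Proof.
have cl : closed [set p : R^o * R^o | 0 <= p.2].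
  have -> : [set p : R^o * R^o | 0 <= p.2] = snd @^-1` [set s : R^o | 0 <= s] by [].
  apply: closed_comp => [x _|]; first exact: cvg_snd.
  exact: closed_ge.
suff H : closed_hull u `<=` [set p : R^o * R^o | 0 <= p.2] by move=> /H.
rewrite [X in _ `<=` X](iffLR (closure_id _) cl); apply: closureS.
apply: smallest_sub => [|_ [n [_ ->]] /=]; last exact: u0.
apply/convex_setW => x y; rewrite !inE/= => x0 y0 l l0 l1.
apply/mem_set => /=; change (0 <= l%:num * x.2 + (1 - l%:num) * y.2).
by rewrite addr_ge0// mulr_ge0// ?subr_ge0 ltW.
Qed.

Lemma envelope_le n : (0 < n)%N -> w n%:R <= u n.
Proof.
move=> n0; have [H _ _ _] := uw; have n1 : 1 <= n%:R :> R by rewrite ler1n.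
have [_] := H _ n1.
by apply; exact: closed_hull_point.
Qed.

Lemma envelope_decr s t : 0 <= s -> s < t -> w t < w s.
Proof.
move=> s0 st; have [_ dec _ _] := uw; apply: dec => //; rewrite in_itv/= andbT//.
exact: le_trans s0 (ltW st).
Qed.

(** A strictly decreasing function that is nonnegative far out is positive. *)
Lemma envelope_gt0 t : 0 <= t -> 0 < w t.
Proof.
move=> t0; have [H _ _ _] := uw.
have T1 : 1 <= Num.max 1 (t + 1) by rewrite le_max lexx.
apply: le_lt_trans (closed_hull_ge0 (H _ T1).1) _.
by apply: envelope_decr => //; rewrite lt_max ltrDl ltr01 orbT.
Qed.

(** Intermediate value theorem for s |-> w s - y s^4, which is positive at 0. *)
Lemma envelope_ratio_surj y : 0 < y -> exists2 tau, 0 < tau & w tau / tau ^+ 4 = y.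
Proof.
move=> y0; have [_ _ cw _] := uw.
have w00 := envelope_gt0 (lexx 0).
(* At T >= 1 one has y T^4 >= y T >= w 0. *)
pose T : R := 1 + w 0 / y; pose f s := w s - y * s ^+ 4.
have wy : 0 < w 0 / y by exact: divr_gt0.
have T1 : 1 < T by rewrite ltrDl.
have T0 : 0 < T by exact: lt_trans T1.
have cf : {within `[0, T], continuous f}.
  have cf : {within `[0, +oo[, continuous f}.
    have c4 : continuous (fun s : R => y * s ^+ 4).
      by move=> x; apply: cvgM; [exact: cvg_cst|exact: exprn_continuous].
    by move=> x; apply: cvgB; [exact: cw|exact: (continuous_subspaceT c4)].
  apply: continuous_subspaceW cf => x /=.
  by rewrite !in_itv/= => /andP[->].
have f0 : f 0 = w 0 by rewrite /f expr0n mulr0 subr0.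
have fT : f T <= 0.
  rewrite subr_le0; apply: le_trans (ltW (envelope_decr (lexx 0) T0)) _.
  rewrite mulrC -ler_pdivrMr//; apply: (@le_trans _ _ T); first by rewrite lerDr.
  by rewrite ler_eXnr// ltW.
have [|tau] := @IVT R f 0 T 0 (ltW T0) cf.
  by rewrite ge_min fT orbT le_max f0 (ltW w00).
rewrite in_itv/= => /andP[tau0 _] /eqP; rewrite /f subr_eq0 => /eqP E.
have tau1 : 0 < tau.
  rewrite lt_def tau0 andbT; apply/eqP => tau00.
  by move: E w00; rewrite tau00 expr0n mulr0 => ->; rewrite ltxx.
by exists tau => //; rewrite E mulfK// expf_neq0// gt_eqF.
Qed.

Lemma envelope_ratio_pinv y : 0 < y ->
  let phi := fun t : R => w t / t ^+ 4 in
  let tau := 'pinv_(fun=> 0) `]0, +oo[ phi y in 0 < tau /\ w tau = y * tau ^+ 4.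
Proof.
move=> y0 phi tau; have [t0 t00 ty] := envelope_ratio_surj y0.
have yI : (phi @` `]0, +oo[) y by exists t0 => //=; rewrite in_itv/= t00.
have tau0 : 0 < tau.
  have := @surjpinv_image_sub _ _ (fun=> 0) `]0, +oo[ (phi @` `]0, +oo[) phi.
  move=> /(_ (fun _ => id)) /(_ tau) /=; rewrite in_itv/= andbT; apply.
  by exists y.
split=> //; have := pinvK (fun=> 0) (mem_set yI); rewrite -/tau /phi => <-.
by rewrite divfK// expf_neq0// gt_eqF.
Qed.

End Envelope.

(** * The norm of the domain *)

Section DomainNorm.
Context {R : realType}.
Variable a : R.
Hypothesis a01 : 0 < a < 1.
Implicit Types (z : beam_state R).

Local Notation wd := weak_derivative.
Local Notation ip01 := (ip (0 : R) 1).

Let a0 : 0 < a. Proof. by case/andP : a01. Qed.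
Let a1 : a < 1. Proof. by case/andP : a01. Qed.

Lemma L2norm_sqr_le_sobolev (c d : R) k j u : (j <= k)%N ->
  L2norm c d (wd c d j u) ^+ 2 <= sobolev_norm k c d u ^+ 2.
Proof.
move=> jk; apply: lerXn2r; rewrite ?nnegrE ?L2norm_ge0 ?sqrtr_ge0//.
exact: L2norm_le_sobolev.
Qed.

Lemma ip_le_sobolev (c d : R) f k j u : L2 c d f -> sobolev k c d u -> (j <= k)%N ->
  {ae lebesgue_on c d, forall x, f x = wd c d j u x} ->
  ip c d f f <= sobolev_norm k c d u ^+ 2.
Proof.
move=> Lf su jk fu; have Lu := sobolev_L2wd su jk.
rewrite (ip_ae Lf Lu Lf Lu fu fu) -L2norm_sqr; exact: L2norm_sqr_le_sobolev.
Qed.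

Lemma X3_norm_le_domain z : A3_domain a z -> X3_norm z <= A3_domain_norm a z.
Proof.
move=> [[[V3u s1 s2 _ _] V3v] _ _]; apply: ler_wsqrtr.
have LU := V3_L2wd V3u; rewrite /V3_norm !L2norm_sqr.
rewrite (ip_split (ltW a0) (ltW a1) LU LU).
have r1 := wd_restrict (lexx 0) (ltW a1) V3u.2 (leqnn 2) s1 (isT : (2 <= 4)%N).
have r2 := wd_restrict (ltW a0) (lexx 1) V3u.2 (leqnn 2) s2 (isT : (2 <= 4)%N).
apply: lerD; first apply: lerD.
- exact: (@ip_le_sobolev _ _ _ 4 2 _ (L2_restrict (lexx 0) (ltW a1) LU) s1 isT r1).
- exact: (@ip_le_sobolev _ _ _ 4 2 _ (L2_restrict (ltW a0) (lexx 1) LU) s2 isT r2).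
apply: (@ip_le_sobolev _ _ _ 2 0 _ (V3_L2 V3v) V3v.2 isT).
by apply: filterS (wd0_ae V3v.2) => x ->.
Qed.

(** The fourth derivatives on the two sides of a give the norm of the second
    component of A z. *)
Lemma X3_norm_A3_le_domain z : A3_domain a z -> X3_norm (A3 a z) <= A3_domain_norm a z.
Proof.
move=> Dz; have [[[V3u s1 s2 _ _] V3v] _ _] := Dz; apply: ler_wsqrtr.
have [LA EA] := A3_force a01 Dz; have Lf := beam_force_L2 a01 s1 s2.
rewrite (L2norm_sqr _ _ (A3 a z).2) (ip_ae LA Lf LA Lf EA EA) ip_beam_force_sqr//.
rewrite addrC; apply: lerD; last exact: (@L2norm_sqr_le_sobolev 0 1 2 2).
by apply: lerD; exact: (@L2norm_sqr_le_sobolev _ _ 4 4).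
Qed.

End DomainNorm.

(** * Decay of the beam *)

Theorem theorem5p2p2 (R : realType) (a : R) (omega1 : R -> R) :
  0 < a < 1 ->
  irrational a ->
  lower_convex_envelope (fun n : nat => sin (n%:R * pi * a) ^+ 2) omega1 ->
  let phi := fun t : R => omega1 t / t ^+ 4 in
  let phi_inv := 'pinv_(fun=> 0) `]0, +oo[ phi in
  exists C : R, 0 < C /\
    forall S : R -> beam_state R -> beam_state R,
    beam_semigroup a S ->
    forall u0 u1 : R -> R^o, A3_domain a (u0, u1) ->
    forall t : R, 0 <= t ->
      X3_norm (S t (u0, u1)) <=
        C / (phi_inv (1 / (t + 1))) ^+ 2 * A3_domain_norm a (u0, u1).
Proof.
move=> a01 _ env phi phi_inv.
have sin0 n : 0 <= sin (n%:R * pi * a) ^+ 2 by exact: sqr_ge0.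
have om0 := envelope_gt0 sin0 env.
have [C C0 decay] := @modal_decay R (beam_state R) (omega1 0) (ltW (om0 _ (lexx 0))).
(* C comes from the initial value of the Lyapunov function, and 2 from the term
   in N (A x): the factor w t tau^-4 is at most 1. *)
exists (Num.sqrt (C + 2)); split; first by rewrite sqrtr_gt0 addr_gt0.
move=> S [contr gen] u0 u1 Dx t t0.
have t1 : 0 < t + 1 by rewrite ltr_wpDl.
have [] := envelope_ratio_pinv sin0 env (divr_gt0 ltr01 t1).
rewrite -/phi -/phi_inv; set tau := phi_inv _ => tau0 otau.
have w0 := om0 _ (ltW tau0).
have low (i : nat) : i.+1%:R <= tau -> 2 * omega1 tau <= sn i.+1 a ^+ 2.
  move=> itau; rewrite /sn exprMn sqr_sqrtr// ler_pM2l//.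
  apply: le_trans (envelope_le env (ltn0Sn i)).
  move: itau; rewrite le_eqVlt => /orP[/eqP ->//|itau].
  exact: ltW (envelope_decr env (ler0n _ _) itau).
have wO : 0 <= omega1 tau <= omega1 0.
  by rewrite (ltW w0) ltW//; exact: (envelope_decr env).
have tau4 : 0 < tau ^+ 4 by exact: exprn_gt0.
have wt1 : omega1 tau * (t + 1) = tau ^+ 4.
  by rewrite otau mulrAC div1r mulVf ?mul1r// gt_eqF.
have := decay _ _ _ _ _ _ _ _ _ (beam_modal_system a01) S contr gen _ tau t _ Dx wO tau0 t0 low.
set Ns := X3_norm (S t _); set Nx := X3_norm _; set NA := X3_norm _.
set Nd := A3_domain_norm _ _ => H.
have hx : Nx ^+ 2 <= Nd ^+ 2.
  apply: lerXn2r; rewrite ?nnegrE ?sqrtr_ge0//; exact: X3_norm_le_domain.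
have hA : NA ^+ 2 <= Nd ^+ 2.
  apply: lerXn2r; rewrite ?nnegrE ?sqrtr_ge0//; exact: X3_norm_A3_le_domain.
have wt : omega1 tau * t / tau ^+ 4 <= 1.
  by rewrite ler_pdivrMr// mul1r -wt1 ler_wpM2l ?(ltW w0)// lerDl.
have bound : tau ^+ 4 * Ns ^+ 2 <= (C + 2) * Nd ^+ 2.
  rewrite -wt1; apply: le_trans H _; rewrite [leRHS]mulrDl.
  apply: lerD; first by rewrite ler_wpM2l// ltW.
  rewrite -(mulrA 2 _ (tau ^+ 4)^-1) -mulrA ler_wpM2l//.
  apply: le_trans (_ : 1 * NA ^+ 2 <= _); last by rewrite mul1r.
  by rewrite ler_wpM2r// sqr_ge0.
rewrite mulrAC ler_pdivlMr ?exprn_gt0//.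
rewrite -ler_sqr ?nnegrE ?mulr_ge0 ?sqrtr_ge0 ?exprn_ge0 ?(ltW tau0)//.
have tau22 : (tau ^+ 2) ^+ 2 = tau ^+ 4 by rewrite -exprM.
have sC : Num.sqrt (C + 2) ^+ 2 = C + 2 by rewrite sqr_sqrtr// addr_ge0// ltW.
by rewrite [leLHS]exprMn [leRHS]exprMn tau22 sC mulrC.
Qed.
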